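(* Let $\Pi$ be any outside decomposition of a skew shape $\lambda/\mu$, and let $D(\Pi)$ be the associated Hamel–Goulden determinant whose entries are the supersymmetric ribbon Schur functions in the variable sets $X=\{\ldots,x_{-1},x_0,x_1,\ldots\}$ and $Y=\{\ldots,y_{-1},y_0,y_1,\ldots\}$. Then $D(\Pi)$ equals the supersymmetric skew Schur function $s_{\lambda/\mu}(X,Y)$.
   Context: Skew shapes. For partitions $\lambda=(\lambda_1\ge\dots\ge\lambda_k\ge 0)$, $\mu=(\mu_1\ge\dots\ge\mu_k\ge 0)$ with $\mu_i\le\lambda_i$ for all $i$, the skew diagram (skew shape) $\lambda/\mu$ is the set of boxes $(i,j)\in\mathbb{Z}^2$ with $1\le i\le k$, $\mu_i<j\le\lambda_i$; box $(i,j)$ lies in row $i$ from the top and column $j$ from the left. Two boxes are edgewise connected if they share a common edge; a block of $\lambda/\mu$ is an edgewise connected component. The content of $(i,j)$ is $j-i$; a diagonal with content $c$ is the set of all boxes with content $c$ (only nonempty diagonals are counted). Diagonals are ordered by increasing content. Border strips. A (border) strip, or ribbon, is an edgewise connected skew diagram (considered up to translation when regarded as an abstract shape) containing no $2\times2$ block of boxes. Its starting box is at its lower left end, its ending box at its upper right end, and boxes are ordered by increasing content. A box that is not the ending box goes right if the next box is to its right, and goes up if the next box is above it. Outside decompositions. A border strip decomposition of $\lambda/\mu$ is a partition of its boxes into pairwise disjoint strips. It is an outside decomposition if every strip has its starting box on the left or bottom perimeter of $\lambda/\mu$ (its left or lower neighbour is not in $\lambda/\mu$) and its ending box on the right or top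 perimeter of $\lambda/\mu$ (its right or upper neighbour is not in $\lambda/\mu$). For a strip $\theta$, $p(\theta)$ and $q(\theta)$ denote the contents of its starting and ending boxes. Directions and cutting strip (edgewise connected $\lambda/\mu$). Given an outside decomposition $\Pi$ and a box $b$ in the strip $\theta\in\Pi$: if $b$ is not the ending box of $\theta$, $b$ goes right (resp. up) in $\lambda/\mu$ if it does so in $\theta$. If $b$ is the ending box of $\theta$, it goes up if it is on the top perimeter of $\lambda/\mu$ (including when it is a corner), and otherwise (it is on the right perimeter) it goes right. It is a known fact (Hamel and Goulden's nested property) that the boxes on the same diagonal all go up or all go right; consequently the contents of the ending boxes of the strips are distinct. If $\lambda/\mu$ has $d$ diagonals, the cutting strip $\phi$ of $\Pi$ is the border strip with $d$ boxes such that for $t=1,\dots,d-1$ its $t$-th box goes right or up according to whether the boxes in the $t$-th diagonal of $\lambda/\mu$ go right or up with respect to $\Pi$; its $t$-th box is assigned the content of the $t$-th diagonal. Write $\phi[p,q]$ for: the segment of $\phi$ from its box of content $p$ to its box of content $q$ if $p\le q$; the empty strip $\varnothing$ if $p=q+1$; undefined if $p>q+1$. Supersymmetric skew Schur functions. $s_{\lambda/\mu}(X,Y)=\sum_{\mu\subseteq\nu\subseteq\lambda}s_{\nu/\mu}(X)\,s_{\lambda'/\nu'}(Y)$, where $'$ denotes conjugation and the $s$ on the right are ordinary skew Schur functions; equivalently, $s_{\lambda/\mu}(X,Y)=\det[h_{\lambda_i-\mu_j-i+j}(X,Y)]_{i,j}$ with $\sum_{n\ge0}h_n(X,Y)t^n=\prod_{i\in\mathbb{Z}}\frac{1+y_it}{1-x_it}$.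 Also $s_\varnothing=1$, and $s$ of an undefined strip is $0$. Determinant. For edgewise connected $\lambda/\mu$ and $\Pi=(\theta_1,\dots,\theta_m)$ ordered so that $q(\theta_1)>\dots>q(\theta_m)$, with cutting strip $\phi$, $$D(\Pi)=\det\left[\,s_{\phi[p(\theta_j),\,q(\theta_i)]}(X,Y)\,\right]_{i,j=1}^m$$ ($i$ the row index, $j$ the column index). If $\lambda/\mu$ has blocks $B_1,\dots,B_k$, then $\Pi$ splits into outside decompositions $\Pi_1,\dots,\Pi_k$ of the blocks, and $D(\Pi)$ is understood as the block diagonal determinant $D(\Pi_1)\cdots D(\Pi_k)$. *)

(* Defs.v *)
From HB Require Import structures.
From mathcomp Require Import all_boot all_order all_algebra.
From mathcomp Require Import finmap multiset.
From mathcomp Require Import boolp.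

Set Implicit Arguments.
Unset Strict Implicit.
Unset Printing Implicit Defensive.

Import Order.TTheory GRing.Theory Num.Theory.

Local Open Scope fset_scope.
Local Open Scope mset_scope.
Local Open Scope ring_scope.

(* Formal power series with integer coefficients in an arbitrary set K of
   commuting variables.  A monomial is a finite multiset of variables, and
   [f m] is the coefficient of the monomial [m] in [f]. *)

Definition series (K : choiceType) : Type := {mset K} -> int.

Section SeriesRing.
Variable K : choiceType.
Implicit Types (f g h : series K) (m a b c : {mset K}).

Definition divisors_of m : {fset {mset K}} :=
  [fset seq_mset (mask (val t) (enum_mset m))
     | t : (size (enum_mset m)).-tuple bool].

Lemma in_divisors_of m a : (a \in divisors_of m) = (a `<=` m).
Proof.
apply/imfsetP/msubsetP => [[t _ ->] x|le_am].
  by rewrite mset_seqE -count_mem_mset leq_count_mask.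
have /count_maskP[t sz_t eq_t] :
    forall x, (count_mem x (enum_mset a) <= count_mem x (enum_mset m))%N.
  by move=> x; rewrite !count_mem_mset.
exists (Tuple (introT eqP sz_t)) => //=.
by rewrite -[LHS]seq_mset_id; apply/eq_seq_msetP.
Qed.

Definition series0 : series K := fun=> 0.
Definition series_opp f : series K := fun m => - f m.
Definition series_add f g : series K := fun m => f m + g m.
Definition series1 : series K := fun m => (m == mset0)%:R.
Definition series_mul f g : series K :=
  fun m => \sum_(a <- divisors_of m) f a * g (m `\` a).

HB.instance Definition _ := gen_eqMixin (series K).
HB.instance Definition _ := gen_choiceMixin (series K).

Fact series_addA : associative series_add.
Proof. by move=> f g h; apply/funext => m; apply: addrA. Qed.
Fact series_addC : commutative series_add.
Proof. by move=> f g; apply/funext => m; apply: addrC. Qed.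
Fact series_add0 : left_id series0 series_add.
Proof. by move=> f; apply/funext => m; apply: add0r. Qed.
Fact series_addN : left_inverse series0 series_opp series_add.
Proof. by move=> f; apply/funext => m; apply: addNr. Qed.

HB.instance Definition _ := GRing.isZmodule.Build (series K)
  series_addA series_addC series_add0 series_addN.

Lemma divisorP m a b : a `+` b = m -> a `<=` m /\ b = m `\` a.
Proof.
move=> <-; split; last by rewrite msetDKB.
by apply/msubsetP => x; rewrite msetE2 leq_addr.
Qed.

Lemma series_mulE (S : {fset {mset K}}) f g m :
    (forall a, a `<=` m -> a \in S) ->
  series_mul f g m = \sum_(a <- S) \sum_(b <- S) f a * g b *+ (a `+` b == m).
Proof.
move=> memS; rewrite /series_mul.
have sDS : (divisors_of m `<=` S)%fset.
  by apply/fsubsetP => a; rewrite in_divisors_of => /memS.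
have inner a : \sum_(b <- S) f a * g b *+ (a `+` b == m)
    = if a \in divisors_of m then f a * g (m `\` a) else 0.
  rewrite in_divisors_of; case: ifP => [le_am|nle_am]; last first.
    by rewrite big1 // => b _; case: eqP => // /divisorP[]; rewrite nle_am.
  have eq_m : a `+` (m `\` a) = m.
    by apply/msetP => x; rewrite !msetE2 subnKC //; apply/msubsetP.
  rewrite (bigD1_seq (m `\` a)) ?fset_uniq //=; last first.
    by apply: memS; apply/msubsetP => x; rewrite msetE2 leq_subr.
  rewrite eq_m eqxx big1 ?addr0 // => b neq_b.
  by case: eqP => // /divisorP[_ eq_b]; rewrite eq_b eqxx in neq_b.
rewrite (eq_bigr _ (fun a _ => inner a)) -(big_fset_incl _ sDS).
  by rewrite big_seq [RHS]big_seq; apply: eq_bigr => a ->.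
by move=> a _ /negPf->.
Qed.

Fact series_mulC : commutative series_mul.
Proof.
move=> f g; apply/funext => m.
have memS a : a `<=` m -> a \in divisors_of m by rewrite in_divisors_of.
rewrite !(series_mulE _ _ memS) exchange_big /=.
by apply: eq_bigr => b _; apply: eq_bigr => a _; rewrite msetDC mulrC.
Qed.

Lemma series_mul3E f g h m (S := divisors_of m) :
  series_mul (series_mul f g) h m = \sum_(a <- S) \sum_(b <- S) \sum_(c <- S)
    f a * g b * h c *+ ((a `+` b) `+` c == m).
Proof.
have memS a : a `<=` m -> a \in S by rewrite in_divisors_of.
rewrite (series_mulE _ _ memS).
transitivity (\sum_(d <- S) \sum_(c <- S) \sum_(a <- S) \sum_(b <- S)
    f a * g b * h c *+ (a `+` b == d) *+ (d `+` c == m)).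
  rewrite big_seq [RHS]big_seq; apply: eq_bigr => d.
  rewrite in_divisors_of => le_dm; apply: eq_bigr => c _.
  have memS' a : a `<=` d -> a \in S.
    by move=> le_ad; apply/memS/(msubset_trans le_ad).
  rewrite (series_mulE _ _ memS') big_distrl -sumrMnl; apply: eq_bigr => a _.
  rewrite big_distrl -sumrMnl; apply: eq_bigr => b _ /=.
  by rewrite mulrnAl.
rewrite exchange_big /=.
under eq_bigr => c _ do
  (rewrite exchange_big /=; under eq_bigr => a _ do rewrite exchange_big /=).
rewrite exchange_big; apply: eq_bigr => a _ /=.
rewrite exchange_big; apply: eq_bigr => b _ /=; apply: eq_bigr => c _ /=.
have [le_abm|nle_abm] := boolP (a `+` b \in S).
  rewrite (bigD1_seq (a `+` b)) ?fset_uniq //= eqxx mulr1n big1 ?addr0 // => d.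
  by rewrite eq_sym => /negPf->; rewrite mul0rn.
rewrite big_seq big1 => [|d Sd].
  case: eqP => // /divisorP[le_abm _].
  by rewrite memS in nle_abm.
by case: eqP => [eq_d|_]; [rewrite eq_d Sd in nle_abm | rewrite mul0rn].
Qed.

Fact series_mulA : associative series_mul.
Proof.
move=> f g h; apply/funext => m.
rewrite series_mulC !series_mul3E.
under eq_bigr => a _ do rewrite exchange_big /=.
rewrite exchange_big; apply: eq_bigr => c _ /=.
apply: eq_bigr => a _; apply: eq_bigr => b _.
by rewrite [_ `+` c]msetDC msetDA [_ * f c]mulrC mulrA.
Qed.

Fact series_mul1 : left_id series1 series_mul.
Proof.
move=> f; apply/funext => m; rewrite /series_mul (bigD1_seq mset0) ?fset_uniq //=.
  rewrite /series1 eqxx mul1r big1 ?addr0 => [|a /negPf->]; last exact: mul0r.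
  by rewrite -(divisorP (mset0D m)).2.
by rewrite in_divisors_of; apply/msubsetP => x; rewrite mset0E.
Qed.

Fact series_mulDl : left_distributive series_mul series_add.
Proof.
move=> f g h; apply/funext => m.
rewrite /series_mul /series_add -big_split.
by apply: eq_bigr => a _; exact: mulrDl.
Qed.

Fact series_1neq0 : series1 != 0.
Proof.
by apply/eqP => /(congr1 (fun f : series K => f mset0)); rewrite /series1 eqxx.
Qed.

HB.instance Definition _ := GRing.Zmodule_isComNzRing.Build (series K)
  series_mulA series_mulC series_mul1 series_mulDl series_1neq0.

End SeriesRing.

(* Shapes.  As in matrices, box (i, j) lies in row i, counted from the top,
   and column j, counted from the left. *)

Definition box : Type := (int * int)%type.
HB.instance Definition _ := Choice.on box.

Definition right_of (b : box) : box := (b.1, b.2 + 1).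
Definition left_of (b : box) : box := (b.1, b.2 - 1).
Definition above (b : box) : box := (b.1 - 1, b.2).
Definition below (b : box) : box := (b.1 + 1, b.2).

Definition content (b : box) : int := b.2 - b.1.

(* A partition is a weakly decreasing sequence of parts, null parts being
   allowed; [all2] also forces both sequences to have the same length. *)
Definition skew_pair (la mu : seq nat) : bool :=
  [&& sorted geq la, sorted geq mu & all2 leq mu la].

Definition diagram (la mu : seq nat) : {fset box} :=
  [fset b in [seq (i.+1%:Z, j.+1%:Z) | i <- iota 0 (size la),
     j <- iota (nth 0%N mu i) (nth 0%N la i - nth 0%N mu i)]].

Lemma in_diagram (la mu : seq nat) (i j : nat) :
  ((i.+1%:Z, j.+1%:Z) \in diagram la mu)
    = (nth 0%N mu i <= j < nth 0%N la i)%N.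
Proof.
rewrite /diagram in_fset; apply/allpairsPdep/idP.
  move=> [i' [j' []]]; rewrite !mem_iota /= => _ /andP[le_j lt_j] [-> ->].
  rewrite le_j; case: (leqP (nth 0%N mu i') (nth 0%N la i')) lt_j => [le|/ltnW].
    by rewrite subnKC.
  rewrite -subn_eq0 => /eqP->.
  by rewrite addn0 => /(leq_trans) /(_ le_j); rewrite ltnn.
move=> /andP[le_j lt_j]; exists i, j; rewrite !mem_iota le_j /=.
rewrite subnKC ?lt_j ?(leq_trans le_j (ltnW lt_j)) //; split => //.
by rewrite add0n; case: ltnP => // /(nth_default 0%N) eq0; rewrite eq0 in lt_j.
Qed.

Definition conjugate (la : seq nat) : seq nat :=
  [seq count (fun part => (j < part)%N) la | j <- iota 0 (head 0%N la)].

(* Variables and Schur functions.  The variable x_i is [(false, i)] and the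
   variable y_i is [(true, i)]. *)

Definition variable : Type := (bool * int)%type.
HB.instance Definition _ := Choice.on variable.

Definition X_family : bool := false.
Definition Y_family : bool := true.

(* Semistandard fillings of the boxes of D by variables of the family k,
   ordered by their subscripts. *)
Definition semistandard (k : bool) (D : {fset box}) (V : {fset variable})
    (T : {ffun D -> V}) : bool :=
  [&& [forall b, (val (T b)).1 == k],
      [forall b, forall c, ((val b).1 == (val c).1) && ((val b).2 < (val c).2)
         ==> ((val (T b)).2 <= (val (T c)).2)]
    & [forall b, forall c, ((val b).2 == (val c).2) && ((val b).1 < (val c).1)
         ==> ((val (T b)).2 < (val (T c)).2)]].

Definition weight (D : {fset box}) (V : {fset variable}) (T : {ffun D -> V}) :
    {mset variable} :=
  seq_mset [seq val (T b) | b : D].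

(* The coefficient of m is the number of semistandard tableaux of weight m;
   the entries of such a tableau necessarily lie in the support of m. *)
Definition skew_schur (k : bool) (la mu : seq nat) : series variable := fun m =>
  #|[set T : {ffun diagram la mu -> finsupp m}
      | semistandard k T && (weight T == m)]|%:Z.

(* Since nu is contained in la, it has as many parts as la (null parts being
   allowed) and all its parts are at most the first part of la. *)
Definition super_schur (la mu : seq nat) : series variable :=
  \sum_(nu : (size la).-tuple 'I_(head 0%N la).+1
        | skew_pair (map val nu) mu && skew_pair la (map val nu))
    skew_schur X_family (map val nu) mu
      * skew_schur Y_family (conjugate la) (conjugate (map val nu)).

(* Connectedness, blocks and strips. *)

Definition adjacent (b c : box) : bool :=
  c \in [:: right_of b; left_of b; above b; below b].

Definition linked (D : {fset box}) : rel D :=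
  connect (fun b c : D => adjacent (val b) (val c)).

Definition edgewise_connected (D : {fset box}) : bool :=
  [forall b : D, forall c : D, linked b c].

Definition blocks (D : {fset box}) : {fset {fset box}} :=
  [fset [fset val c | c : D & linked b c] | b : D].

Definition has_square (D : {fset box}) : bool :=
  [exists b : D, [&& right_of (val b) \in D, below (val b) \in D
                   & right_of (below (val b)) \in D]].

Definition is_strip (th : {fset box}) : Prop :=
  [/\ th != fset0,
      exists la mu, skew_pair la mu /\ th = diagram la mu,
      edgewise_connected th
    & ~~ has_square th].

Definition strip_boxes (th : {fset box}) : seq box :=
  sort (fun b c => content b <= content c) (enum_fset th).

Definition start_box (th : {fset box}) : box := head (0, 0) (strip_boxes th).
Definition end_box (th : {fset box}) : box := last (0, 0) (strip_boxes th).
Definition next_box (th : {fset box}) (b : box) : box :=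
  nth b (strip_boxes th) (index b (strip_boxes th)).+1.

Definition p_content (th : {fset box}) : int := content (start_box th).
Definition q_content (th : {fset box}) : int := content (end_box th).

Definition outside_decomposition (D : {fset box}) (Pi : {fset {fset box}}) :
    Prop :=
  [/\ trivIfset Pi, fcover Pi = D
    & forall th, th \in Pi ->
      [/\ is_strip th,
          (left_of (start_box th) \notin D) || (below (start_box th) \notin D)
        & (right_of (end_box th) \notin D) || (above (end_box th) \notin D)]].

(* A strip, up to translation, is encoded by its word of directions: its t-th
   letter tells whether the t-th box goes up ([true]) or right ([false]), so
   that a word of length n describes a strip with n + 1 boxes.  [ribbon w] is
   the corresponding pair (la, mu), built from the single box 1/0: going right
   lengthens the top row by one box, going up adds a new top row whose only
   box lies above the last box of the previous top row. *)
Definition extend_ribbon (s : seq nat * seq nat) (up : bool) :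
    seq nat * seq nat :=
  if up then (head 0%N s.1 :: s.1, (head 0%N s.1).-1 :: s.2)
  else ((head 0%N s.1).+1 :: behead s.1, s.2).

Definition ribbon (w : seq bool) : seq nat * seq nat :=
  foldl extend_ribbon ([:: 1%N], [:: 0%N]) w.

Section Determinant.
(* D is meant to be edgewise connected, and Pi an outside decomposition of D. *)
Variables (D : {fset box}) (Pi : {fset {fset box}}).

Definition goes_up (th : {fset box}) (b : box) : bool :=
  if b == end_box th then above b \notin D else next_box th b == above b.

(* All the boxes of a diagonal go in the same direction, hence "some box goes
   up" amounts to "all boxes go up". *)
Definition diagonal_goes_up (c : int) : bool :=
  [exists th : Pi, exists b : val th,
     (content (val b) == c) && goes_up (val th) (val b)].

Definition diagonals : seq int :=
  sort <=%R (undup [seq content b | b <- enum_fset D]).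

Definition cutting_strip : seq bool :=
  [seq diagonal_goes_up c | c <- take (size diagonals).-1 diagonals].

Definition cutting_segment (p q : int) : seq bool :=
  drop (index p diagonals) (take (index q diagonals) cutting_strip).

(* The empty strip (p = q + 1) contributes 1 and an undefined one
   (p > q + 1) contributes 0. *)
Definition segment_schur (p q : int) : series variable :=
  if p <= q then
    let s := ribbon (cutting_segment p q) in super_schur s.1 s.2
  else (p == q + 1)%:R.

Definition ordered_strips : seq {fset box} :=
  sort (fun th1 th2 => q_content th2 <= q_content th1) (enum_fset Pi).

Definition block_determinant : series variable :=
  \det (\matrix_(i < size ordered_strips, j < size ordered_strips)
     segment_schur (p_content (nth fset0 ordered_strips j))
                   (q_content (nth fset0 ordered_strips i))).

End Determinant.

Definition hamel_goulden_determinant (D : {fset box})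
    (Pi : {fset {fset box}}) : series variable :=
  \prod_(B <- blocks D)
    block_determinant B [fset th in Pi | (th `<=` B)%fset]%fset.

(* Main.v *)
Require Import Defs.
From HB Require Import structures.
From mathcomp Require Import all_boot all_order all_algebra perm.
From mathcomp Require Import finmap multiset.
From mathcomp Require Import boolp zify ring.

Set Implicit Arguments.
Unset Strict Implicit.
Unset Printing Implicit Defensive.

Import Order.TTheory GRing.Theory Num.Theory.

Local Open Scope fset_scope.
Local Open Scope mset_scope.
Local Open Scope ring_scope.

(** Number the rows from 0 and put l_i = la_i - i, m_j = mu_j - j; these are
    the [labels] of la and mu.  The content of the first box of row i is m_i,
    and l_i is one more than the content of its last box.  The theorem rests
    on three facts.

    The Jacobi-Trudi formula ([super_jacobi_trudi]): the supersymmetric series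
    of la/mu is the determinant of the h(l_i - m_j).  Both sides are computed by
    letting in the variables one by one, all the x's before all the y's, each
    family by increasing subscripts.  Letting in a largest variable z turns
    either side into the sum, over ka between mu and la, of z^|la/ka| times the
    same series for ka/mu, where la/ka runs over the horizontal strips if z is
    an x and over the vertical strips if z is a y.  On the side of tableaux,
    la/ka is the set of boxes filled with z ([card_tableaux_step],
    [super_schur_step]); on the side of determinants, the rows are reduced and
    then expanded by multilinearity ([restrict_jacobi_trudi_step]).

    The ribbon relation ([ribbon_schur_up]): expanding the Jacobi-Trudi
    determinant of a ribbon along its first column gives
    s(w up R^n) = s(w) h(n+1) - s(w R^(n+1)), where R^n stands for n steps to
    the right.  Let S(a, f) be the series of the segment of the cutting strip
    with contents a, ..., f - 1, where S(a, a) = 1 and S(a, f) = 0 for f < a.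
    The relation says that turning one diagonal from right to up transforms the
    matrix S, up to signs, by a pivot on a diagonal entry ([pivotedE]), and a
    pivot exchanges minors of a matrix with minors of its transform.

    The sweep: let the diagonals of content less than c go in their true
    directions, and all the others go right.  The strips obtained follow the
    decomposition up to the content c and continue along the rows.
    Their determinant, [sweep c], is the Jacobi-Trudi determinant of la/mu when
    c is small and the determinant of Pi when c is large.  It does not depend
    on c: a diagonal going right changes nothing ([sweep_straight]); for a
    diagonal going up, the pivot matches the two minors and its sign is that of
    the cyclic shift which the turn induces on the strips that cross the
    diagonal ([sweep_turn]).

    The geometry needed is the nested property ([nested]): all the boxes of a
    diagonal go in the same direction.  If the shape is not connected, the
    contents of two blocks are separated by a missing diagonal, so the
    determinant over all the strips is block triangular and equals the product
    over the blocks ([hamel_goulden_ldet]). *)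

(** * Determinants indexed by lists of labels *)

Section ListDeterminant.
Variable A : comNzRingType.
Implicit Types (w : int -> int -> A) (rs cs : seq int).

(** The labels are contents, so that the same label names a row and a column, and
    moving a strip inside a determinant amounts to moving a pair of labels. *)
Definition ldet w rs cs : A :=
  \det (\matrix_(i < size rs, j < size rs) w rs`_i cs`_j).

Lemma eq_ldet w w' rs cs : size rs = size cs ->
    {in rs & cs, forall a f, w a f = w' a f} ->
  ldet w rs cs = ldet w' rs cs.
Proof.
move=> sz eqw; congr (\det _); apply/matrixP => i j; rewrite !mxE.
by apply: eqw; apply: mem_nth; rewrite -?sz.
Qed.

Lemma ldet_tr w rs cs : size rs = size cs ->
  ldet w rs cs = ldet (fun a f => w f a) cs rs.
Proof.
rewrite /ldet => sz; rewrite -det_tr; move: (size rs) (size cs) sz => n m <-.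
by congr (\det _); apply/matrixP => i j; rewrite !mxE.
Qed.

(** Rows and columns undergo the same permutation, whose sign is squared. *)
Lemma ldet_perm w (s t : seq (int * int)) : perm_eq s t ->
  ldet w (unzip1 s) (unzip2 s) = ldet w (unzip1 t) (unzip2 t).
Proof.
move=> st; rewrite /ldet !size_map -(perm_size st).
have szt : size t == size s by rewrite (perm_size st).
pose tt : (size s).-tuple _ := Tuple szt.
have /tuple_permP[p def_s] : perm_eq s tt by [].
transitivity (\det (row_perm p (col_perm p
    (\matrix_(i < size s, j < size s) w (unzip1 t)`_i (unzip2 t)`_j)))); last first.
  rewrite row_permE col_permE !det_mulmx !det_perm odd_permV.
  by rewrite [X in _ * X]mulrC mulrA -signr_addb addbb mul1r.
congr (\det _); apply/matrixP => i j; rewrite !mxE.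
have nth_s (k : 'I_(size s)) : nth (0, 0) s k = nth (0, 0) t (p k).
  by rewrite {1}def_s -tnth_nth tnth_mktuple (tnth_nth (0, 0)).
have lt_t k : (p k < size t)%N by rewrite -(perm_size st).
by rewrite !(nth_map (0, 0)) ?nth_s.
Qed.

(** Expand both determinants along the row of x: the minors are the same. *)
Lemma ldet_row_move w x rs1 rs2 cs :
  ldet w (rs1 ++ x :: rs2) cs
    = (-1) ^+ size rs1 * ldet w (x :: rs1 ++ rs2) cs.
Proof.
rewrite /ldet size_cat /= addnS -size_cat; set n := size (rs1 ++ rs2).
have lt_n : (size rs1 < n.+1)%N by rewrite ltnS /n size_cat leq_addr.
rewrite (expand_det_row _ (Ordinal lt_n)) (expand_det_row _ ord0) mulr_sumr.
apply: eq_bigr => j _; rewrite !mxE /= nth_cat ltnn subnn /= [RHS]mulrCA; congr (_ * _).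
rewrite /cofactor /= mulrA add0n exprD; congr (_ * \det _).
apply/matrixP => i k; rewrite !mxE /=; congr (w _ _).
rewrite /bump !nth_cat; case: (leqP (size rs1) i) => h.
  by rewrite add1n ltnNge (leqW h) /= subSn // ltnNge h.
by rewrite add0n h.
Qed.

Lemma ldet_col_move w x rs cs1 cs2 : size rs = (size cs1 + size cs2).+1 ->
  ldet w rs (cs1 ++ x :: cs2)
    = (-1) ^+ size cs1 * ldet w rs (x :: cs1 ++ cs2).
Proof.
move=> sz; rewrite ldet_tr ?size_cat /= ?addnS // ldet_row_move.
by rewrite -ldet_tr //= size_cat.
Qed.

Lemma ldet_scale (s t : int -> A) w rs cs : size rs = size cs ->
  ldet (fun a f => s a * w a f * t f) rs cs
    = \prod_(a <- rs) s a * \prod_(f <- cs) t f * ldet w rs cs.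
Proof.
move=> sz; rewrite (big_nth 0) [X in _ * X * _](big_nth 0) -sz !big_mkord.
transitivity (\det (diag_mx (\row_(i < size rs) s rs`_i)
   *m (\matrix_(i < size rs, j < size rs) w rs`_i cs`_j)
   *m diag_mx (\row_(i < size rs) t cs`_i))).
  congr (\det _); apply/matrixP => i j.
  by rewrite mul_mx_diag mul_diag_mx !mxE.
rewrite !det_mulmx !det_diag [RHS]mulrAC; congr (_ * _ * _).
  by apply: eq_bigr => i _; rewrite mxE.
by apply: eq_bigr => i _; rewrite mxE.
Qed.

Lemma ldet_block w rs1 rs2 cs1 cs2 : size rs1 = size cs1 ->
    size rs2 = size cs2 -> {in rs2 & cs1, forall a f, w a f = 0} ->
  ldet w (rs1 ++ rs2) (cs1 ++ cs2) = ldet w rs1 cs1 * ldet w rs2 cs2.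
Proof.
move=> sz1 sz2 w0; rewrite /ldet size_cat.
rewrite -(det_ublock _ (\matrix_(i < size rs1, j < size rs2) w rs1`_i cs2`_j)).
congr (\det _); apply/matrixP => i j.
rewrite -(splitK i) -(splitK j).
case: (split i) => i'; case: (split j) => j' /=;
rewrite !mxE ?(unsplitK (inl _)) ?(unsplitK (inr _)) ?mxE /=;
rewrite ?(unsplitK (inl _)) ?(unsplitK (inr _)) ?mxE /= !nth_cat -?sz1 ?ltn_ord;
rewrite ?addKn ?ltnNge ?leq_addr //=.
by apply: w0; rewrite mem_nth // -sz1.
Qed.
End ListDeterminant.

(** The matrix w2 is the principal pivot transform of w at the entry (r, r),
    which equals 1.  Depending on whether r is among the rows and among the
    columns, four kinds of minors of w are exchanged with minors of w2. *)
Section Pivot.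
Variable A : comNzRingType.
Implicit Types rs cs : seq int.
Variables (w w2 : int -> int -> A) (r : int).
Hypothesis wrr : w r r = 1.
Hypothesis w2r : forall f, f != r -> w2 r f = w r f.
Hypothesis w2E : forall a f, a != r -> f != r ->
  w2 a f = w a f - w a r * w r f.

(** The right-hand side is the Schur complement of the entry (r, r). *)
Lemma pivot_in_in rs cs : size rs = size cs -> r \notin rs -> r \notin cs ->
  ldet w (r :: rs) (r :: cs) = ldet w2 rs cs.
Proof.
move=> sz nr nc; rewrite /ldet /=; set n := size rs.
have nth_r (i : 'I_n) : rs`_i != r.
  by apply: contraNneq nr => <-; rewrite mem_nth.
have nth_c (i : 'I_n) : cs`_i != r.
  by apply: contraNneq nc => <-; rewrite mem_nth // -sz.
pose xi : 'M[A]_(n, 1) := \matrix_(i, j) w rs`_i r.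
pose rho : 'M[A]_(1, n) := \matrix_(i, j) w r cs`_j.
pose X : 'M[A]_n := \matrix_(i, j) w rs`_i cs`_j.
pose M2 : 'M[A]_n := \matrix_(i, j) w2 rs`_i cs`_j.
have eM : \matrix_(i < 1 + n, j < 1 + n) w (r :: rs)`_i (r :: cs)`_j
    = block_mx 1%:M 0 xi 1%:M *m block_mx 1%:M rho 0 M2.
  rewrite mulmx_block !mul1mx !mul0mx !addr0 mulmx1.
  apply/matrixP => i j; rewrite -(splitK i) -(splitK j).
  case: (split i) => i'; case: (split j) => j' /=;
  rewrite ?block_mxEul ?block_mxEur ?block_mxEdl ?block_mxEdr !mxE ?ord1 //=.
  by rewrite big_ord1 !mxE w2E // addrC subrK.
by rewrite [LHS](congr1 determinant eM) det_mulmx det_lblock det_ublock !det1 !mul1r.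
Qed.

(** Adding multiples of the row r to the other rows. *)
Lemma pivot_in_out rs cs : (size rs).+1 = size cs -> r \notin rs ->
    r \notin cs -> ldet w2 (r :: rs) cs = ldet w (r :: rs) cs.
Proof.
move=> sz nr nc; rewrite /ldet /=; set n := size rs.
have nth_r (i : 'I_n) : rs`_i != r.
  by apply: contraNneq nr => <-; rewrite mem_nth.
have nth_c (i : 'I_(1 + n)) : cs`_i != r.
  by apply: contraNneq nc => <-; rewrite mem_nth // -sz.
pose xi : 'M[A]_(n, 1) := \matrix_(i, j) w rs`_i r.
pose M2 : 'M[A]_(1 + n) := \matrix_(i, j) w2 (r :: rs)`_i cs`_j.
have eM : \matrix_(i < 1 + n, j < 1 + n) w (r :: rs)`_i cs`_j
    = block_mx 1%:M 0 xi 1%:M *m M2.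
  rewrite -[M2]vsubmxK mul_block_col !mul1mx !mul0mx !addr0.
  apply/matrixP => i j; rewrite -(splitK i).
  case: (split i) => i' /=; rewrite ?col_mxEu ?col_mxEd !mxE ?ord1 /=.
    by rewrite w2r.
  by rewrite big_ord1 !mxE add0n /= w2r // w2E // addrC subrK.
by rewrite [RHS](congr1 determinant eM) det_mulmx det_lblock !det1 !mul1r.
Qed.
End Pivot.

Section PivotInverse.
Variable A : comNzRingType.
Implicit Types rs cs : seq int.
Variables (w w2 : int -> int -> A) (r : int).
Hypothesis w2rr : w2 r r = 1.
Hypothesis w2r : forall f, f != r -> w2 r f = w r f.
Hypothesis w2c : forall a, a != r -> w2 a r = - w a r.
Hypothesis w2E : forall a f, a != r -> f != r ->
  w2 a f = w a f - w a r * w r f.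

(** The pivot transform is an involution up to the sign of the column r, so
    this is [pivot_in_in] with w and w2 exchanged. *)
Lemma pivot_out_out rs cs : size rs = size cs -> r \notin rs -> r \notin cs ->
  ldet w2 (r :: rs) (r :: cs) = ldet w rs cs.
Proof.
apply: pivot_in_in => // a f neq_a neq_f.
by rewrite w2E // w2c // w2r // mulNr opprK subrK.
Qed.

Lemma pivot_out_in rs cs : size rs = (size cs).+1 -> r \notin rs ->
  r \notin cs -> ldet w2 rs (r :: cs) = - ldet w rs (r :: cs).
Proof.
move=> sz nr nc; rewrite ldet_tr // [in RHS]ldet_tr //=.
pose t f := if f == r then -1 else 1 : A.
pose w3 f a := if f == r then - w2 a f else w2 a f.
have -> : ldet (fun a f => w2 f a) (r :: cs) rs = - ldet w3 (r :: cs) rs.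
  have -> : ldet w3 (r :: cs) rs
     = ldet (fun a f => t a * w2 f a * 1) (r :: cs) rs.
    apply: eq_ldet => // a f _ _; rewrite /w3 /t mulr1.
    by case: eqP => _; rewrite ?mulN1r ?mul1r.
  rewrite (ldet_scale t (fun=> 1) (fun a f => w2 f a)) //.
  rewrite [X in _ * X * _]big1 // mulr1 big_cons {1}/t eqxx big_seq big1.
    by rewrite mulr1 mulN1r opprK.
  by move=> f fc; rewrite /t; case: eqP => // eq_f; rewrite -eq_f fc in nc.
congr (- _).
apply: (pivot_in_out (w := fun a f => w f a)) => //.
- by move=> f nf; rewrite /w3 eqxx w2c // opprK.
- by move=> a f na nf; rewrite /w3 (negPf na) w2E // mulrC.
Qed.
End PivotInverse.

(** * Restricting the variables of a series *)

HB.lock Definition restrict (K : choiceType) (F : pred K) (f : series K) :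
  series K := fun m => if all F (enum_mset m) then f m else 0.

HB.lock Definition monomial (K : choiceType) (a : {mset K}) : series K :=
  fun m => (m == a)%:R.

Section Restriction.
Variable K : choiceType.
Implicit Types (F : pred K) (f g : series K) (m a b : {mset K}) (z : K).

Lemma series_mulrE f g m :
  (f * g) m = \sum_(a <- divisors_of m) f a * g (m `\` a)%mset.
Proof. by []. Qed.

Lemma series_sumE (I : Type) (s : seq I) (P : pred I) (G : I -> series K) m :
  (\sum_(i <- s | P i) G i) m = \sum_(i <- s | P i) G i m.
Proof. by elim/big_rec2: _ => // i y x _ <-. Qed.

Lemma all_msetP F m : reflect (forall x, x \in m -> F x) (all F (enum_mset m)).
Proof. exact: allP. Qed.

Lemma all_msetD F a b :
  all F (enum_mset (a `+` b)%mset) = all F (enum_mset a) && all F (enum_mset b).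
Proof.
apply/all_msetP/andP => [Fab|[/all_msetP Fa /all_msetP Fb] x].
  by split; apply/all_msetP => x xa; apply: Fab; rewrite in_msetD xa ?orbT.
by rewrite in_msetD => /orP[/Fa|/Fb].
Qed.

Lemma restrictE F f m : restrict F f m = if all F (enum_mset m) then f m else 0.
Proof. by rewrite unlock. Qed.

Lemma monomialE a m : monomial a m = (m == a)%:R.
Proof. by rewrite unlock. Qed.

Lemma divisors_split m a : a \in divisors_of m -> (a `+` (m `\` a))%mset = m.
Proof.
rewrite in_divisors_of => /msubsetP le_am; apply/msetP => x.
by rewrite !msetE2 subnKC.
Qed.

Section RestrictMorphism.
Variable F : pred K.

Fact restrict_zmod_morphism : zmod_morphism (restrict F).
Proof.
move=> f g; apply/funext => m.
rewrite -[RHS]/(restrict F f m - restrict F g m) !restrictE.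
by case: ifP => _; rewrite ?subr0.
Qed.

Fact restrict_monoid_morphism : monoid_morphism (restrict F).
Proof.
split.
  apply/funext => m; rewrite restrictE -[(1 : series K) m]/((m == mset0)%:R).
  by case: eqP => [->|_]; rewrite ?enum_mset0 //; case: ifP.
move=> f g; apply/funext => m.
rewrite restrictE [in RHS]series_mulrE.
case: ifP => Fm.
  rewrite series_mulrE big_seq [RHS]big_seq; apply: eq_bigr => a a_m.
  rewrite !restrictE; move: Fm; rewrite -{1}(divisors_split a_m) all_msetD.
  by case/andP => -> ->.
rewrite big_seq big1 // => a a_m; rewrite !restrictE.
move: Fm; rewrite -{1}(divisors_split a_m) all_msetD.
by case: ifP => [_ /= ->|]; rewrite ?mulr0 ?mul0r.
Qed.

HB.instance Definition _ := GRing.isZmodMorphism.Build (series K) (series K)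
  (restrict F) restrict_zmod_morphism.
HB.instance Definition _ := GRing.isMonoidMorphism.Build (series K) (series K)
  (restrict F) restrict_monoid_morphism.
End RestrictMorphism.

Lemma monomialME a f m :
  (monomial a * f) m = if (a `<=` m)%mset then f (m `\` a)%mset else 0.
Proof.
rewrite series_mulrE -in_divisors_of.
case: ifP => a_m.
  rewrite (bigD1_seq a) ?fset_uniq //= monomialE eqxx mul1r big1 ?addr0 //.
  by move=> b /negPf neq; rewrite monomialE neq mul0r.
rewrite big_seq big1 // => b b_m; rewrite monomialE; case: eqP => [eq_ba|_]; last by rewrite mul0r.
by rewrite -eq_ba b_m in a_m.
Qed.

Lemma monomialM a b : monomial a * monomial b = monomial (a `+` b)%mset.
Proof.
apply/funext => m; rewrite monomialME !monomialE.
case: ifP => [/msubsetP le_am|n_am].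
  congr (nat_of_bool _)%:R; apply/eqP/eqP => [<-|->]; last by rewrite msetDKB.
  by apply/msetP => x; rewrite !msetE2 subnKC.
by case: eqP => // eq_m; rewrite (divisorP (esym eq_m)).1 in n_am.
Qed.

Lemma monomial0 : monomial (mset0 : {mset K}) = 1.
Proof. by rewrite unlock. Qed.

Definition power z d := monomial (msetn d z).

Lemma power0 z : power z 0 = 1.
Proof. by rewrite /power msetn0 monomial0. Qed.

Lemma powerD z d e : power z (d + e)%N = power z d * power z e.
Proof.
rewrite /power monomialM; congr monomial; apply/msetP => x.
by rewrite msetE2 !msetnE; case: eqP.
Qed.

Lemma power_prod z (I : finType) (d : I -> nat) :
  \prod_i power z (d i) = power z (\sum_i d i)%N.
Proof.
elim/big_rec2: _ => [|i y1 y2 _ ->]; first by rewrite power0.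
by rewrite powerD.
Qed.

(** This removes all the copies of z. *)
Definition drop_variable z m : {mset K} := (m `\` msetn (m z) z)%mset.

Lemma drop_variableE z m x : drop_variable z m x = if x == z then 0%N else m x.
Proof.
rewrite /drop_variable msetE2 msetnE; case: eqP => [->|_]; rewrite ?subnn ?subn0 //.
Qed.

(** Since f has no monomial containing z, the exponent of z in m must be d. *)
Lemma powerME F z d f m : ~~ F z ->
  (power z d * restrict F f) m = if m z == d then restrict F f (drop_variable z m) else 0.
Proof.
move=> nFz; rewrite monomialME; case: (eqVneq (m z) d) => [<-|neq_d].
  rewrite ifT //; apply/msubsetP => x; rewrite msetnE; case: eqP => // ->.
  exact: leqnn.
case: ifP => // le_dm; rewrite restrictE; case: ifP => // /all_msetP Fm.
case/negP: nFz; apply: Fm; rewrite in_msetB msetnxx ltn_neqAle eq_sym neq_d.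
by move/msubsetP: le_dm => /(_ z); rewrite msetnxx.
Qed.
End Restriction.

(** * Partitions and diagrams *)

Section Partitions.
Implicit Types (la mu nu ka : seq nat).
Local Notation "la `[ i ]" := (nth 0%N la i) (at level 2, format "la `[ i ]").

Lemma sorted_geqP la :
  reflect (forall i, la`[i.+1] <= la`[i])%N (sorted geq la).
Proof.
apply: (iffP (sortedP 0%N)) => [dec i|dec i _]; last exact: dec.
by case: (ltnP i.+1 (size la)) => [/dec //|/(nth_default 0%N) ->].
Qed.

Lemma sorted_geq_nth la i j :
  sorted geq la -> (i <= j)%N -> (la`[j] <= la`[i])%N.
Proof.
move=> /sorted_geqP dec /subnKC <-; elim: (j - i)%N => [|d IHd].
  by rewrite addn0.
by rewrite addnS (leq_trans (dec _)).
Qed.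

Lemma all2_leqP mu la : reflect
  (size mu = size la /\ forall i, (mu`[i] <= la`[i])%N) (all2 leq mu la).
Proof.
elim: mu la => [|x mu IHmu] [|y la] /=; try by constructor=> -[].
  by constructor; split=> // -[].
apply: (iffP andP) => [[le_xy /IHmu[-> le_mu]]|[[sz] le_mu]].
  by split=> // -[|i] /=.
split; first exact: (le_mu 0%N).
by apply/IHmu; split=> // i; apply: (le_mu i.+1).
Qed.

Lemma skew_pairP la mu : reflect
  [/\ sorted geq la, sorted geq mu, size mu = size la
    & forall i, (mu`[i] <= la`[i])%N] (skew_pair la mu).
Proof.
apply: (iffP and3P) => [[? ? /all2_leqP[]] //|[? ? ? ?]].
by split=> //; apply/all2_leqP.
Qed.

Lemma sumn_nth la k : size la = k -> sumn la = (\sum_(i < k) la`[i])%N.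
Proof. by move=> <-; rewrite sumnE (big_nth 0%N) big_mkord. Qed.

(** The truncated differences are true ones because mu is contained in la. *)
Lemma skew_pair_sum la mu : skew_pair la mu ->
  sumn la = (sumn mu + \sum_(i < size la) (la`[i] - mu`[i]))%N.
Proof.
case/skew_pairP => _ _ sz le_mu.
rewrite (sumn_nth (erefl (size la))) (sumn_nth sz) -big_split /=.
by apply: eq_bigr => i _; rewrite subnKC.
Qed.

Lemma diagramP la mu b : reflect
  (exists i j : nat, b = (i.+1%:Z, j.+1%:Z) /\ (mu`[i] <= j < la`[i])%N)
  (b \in diagram la mu).
Proof.
apply: (iffP idP) => [|[i [j [-> le_j]]]]; last by rewrite in_diagram.
move=> bD; have := bD; rewrite {1}/diagram in_fset => /allpairsPdep.
by move=> [i [j [_ _ eq_b]]]; exists i, j; rewrite -in_diagram -eq_b.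
Qed.

Lemma card_diagram la mu : skew_pair la mu ->
  (sumn mu + #|` diagram la mu|)%N = sumn la.
Proof.
move=> sp; rewrite (skew_pair_sum sp); congr addn.
rewrite /diagram card_fseq undup_id; last first.
  apply: allpairs_uniq_dep => [|i _|[i j] [i' j'] _ _ /= [-> ->] //];
  exact: iota_uniq.
rewrite size_allpairs_dep sumnE big_map -[X in iota _ X]subn0 big_mkord.
by apply: eq_bigr => i _; rewrite size_iota.
Qed.

Lemma diagram_inj la mu ka : skew_pair la mu -> skew_pair ka mu ->
  diagram la mu = diagram ka mu -> la = ka.
Proof.
move=> /skew_pairP[_ _ sz le1] /skew_pairP[_ _ sz' le2] eqD.
apply: (@eq_from_nth _ 0%N); first by rewrite -sz.
move=> i _; apply/eqP; rewrite eqn_leq; apply/andP; split; rewrite leqNgt.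
  apply/negP => lt; have := in_diagram la mu i ka`[i].
  by rewrite eqD in_diagram ltnn le2 lt.
apply/negP => lt; have := in_diagram ka mu i la`[i].
by rewrite -eqD in_diagram ltnn le1 lt.
Qed.
End Partitions.

(** * Tableaux as functions on boxes *)

Section Tableaux.
Implicit Types (D : {fset box}) (m : {mset variable}) (z : variable).
Implicit Types (k t : bool) (b c : box) (f : box -> variable).

(** Semistandard fillings by y's of a conjugate shape are fillings of the
    original shape with the roles of rows and columns exchanged; the flag t
    performs this exchange, which avoids conjugating shapes. *)
Definition orient t b : box := if t then (b.2, b.1) else b.

Definition semistandard_by t k D (V : {fset variable}) (T : {ffun D -> V}) :=
  [&& [forall b, (val (T b)).1 == k],
      [forall b, forall c, ((orient t (val b)).1 == (orient t (val c)).1)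
         && ((orient t (val b)).2 < (orient t (val c)).2)
         ==> ((val (T b)).2 <= (val (T c)).2)]
    & [forall b, forall c, ((orient t (val b)).2 == (orient t (val c)).2)
         && ((orient t (val b)).1 < (orient t (val c)).1)
         ==> ((val (T b)).2 < (val (T c)).2)]].

Definition outside_entry : variable := (false, 0).

(** Extending tableaux to all boxes by a constant makes fillings of different
    shapes comparable: they all have the same type. *)
Definition filling D (V : {fset variable}) (T : {ffun D -> V}) : box -> variable :=
  fun b => if insub b is Some b' then val (T b') else outside_entry.

Definition tableaux t k D m : {fset (box -> variable)} :=
  [fset filling T | T : {ffun D -> finsupp m}
     in [set T | semistandard_by t k T && (weight T == m)]].

Lemma fillingE D (V : {fset variable}) (T : {ffun D -> V}) (b : D) :
  filling T (val b) = val (T b).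
Proof. by rewrite /filling valK. Qed.

Lemma filling_inj D (V : {fset variable}) : injective (@filling D V).
Proof.
move=> T U eqTU; apply/ffunP => b; apply: val_inj.
by rewrite -!fillingE eqTU.
Qed.

Lemma card_tableaux t k D m : #|` tableaux t k D m|
  = #|[set T : {ffun D -> finsupp m} | semistandard_by t k T && (weight T == m)]|.
Proof. by rewrite card_imfset //=; [rewrite cardE|apply: filling_inj]. Qed.

Lemma skew_schurE k la mu m :
  skew_schur k la mu m = #|` tableaux false k (diagram la mu) m|%:Z.
Proof. by rewrite card_tableaux. Qed.

Lemma weightP D m (f : box -> variable) : reflect
  (forall v, count (fun b => f b == v) (enum_fset D) = m v)
  (seq_mset [seq f (val b) | b : D] == m).
Proof.
have cnt v : seq_mset [seq f (val b) | b : D] v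
    = count (fun b => f b == v) (enum_fset D).
  have -> : [seq f (val b) | b : D] = [seq f b | b <- enum_fset D].
    by rewrite enum_fsetE -map_comp.
  by rewrite mset_seqE count_map.
apply: (iffP eqP) => [<- v|eq_m]; first by rewrite cnt.
by apply/msetP => v; rewrite cnt eq_m.
Qed.

Lemma tableauxP t k D m f : reflect
  [/\ forall b, b \notin D -> f b = outside_entry,
      {in D, forall b, (f b).1 = k},
      {in D &, forall b c, (orient t b).1 = (orient t c).1 ->
        (orient t b).2 < (orient t c).2 -> (f b).2 <= (f c).2},
      {in D &, forall b c, (orient t b).2 = (orient t c).2 ->
        (orient t b).1 < (orient t c).1 -> (f b).2 < (f c).2}
    & forall v, count (fun b => f b == v) (enum_fset D) = m v]
  (f \in tableaux t k D m).
Proof.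
have wE (T : {ffun D -> finsupp m}) :
    weight T = seq_mset [seq filling T (val b) | b : D].
  by rewrite /weight; congr seq_mset; apply: eq_map => b; rewrite fillingE.
apply: (iffP (imfsetP _ _ _ _)) => [[T /=]|[out fam weak strict wt]].
  rewrite inE => /andP[/and3P[/forallP fam /'forall_forallP weak
    /'forall_forallP strict] wt] ->.
  split.
  - by move=> b nDb; rewrite /filling insubN.
  - by move=> b bD; rewrite -[b]/(val [` bD]) fillingE; apply/eqP/fam.
  - move=> b c bD cD; rewrite -[b]/(val [` bD]) -[c]/(val [` cD]) !fillingE.
    by move=> /eqP e l; have := weak [` bD] [` cD]; rewrite e l.
  - move=> b c bD cD; rewrite -[b]/(val [` bD]) -[c]/(val [` cD]) !fillingE.
    by move=> /eqP e l; have := strict [` bD] [` cD]; rewrite e l.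
  - by apply/weightP; rewrite -wE.
have mem_f (b : D) : f (val b) \in finsupp m.
  rewrite msuppE -mset_neq0 -wt -lt0n -has_count.
  by apply/hasP; exists (val b); [apply: (valP b)|apply: eqxx].
pose T : {ffun D -> finsupp m} := [ffun b => [` mem_f b]].
have TE (b : D) : val (T b) = f (val b) by rewrite ffunE.
have fT : f = filling T.
  apply/funext => b; rewrite /filling; case: insubP => [b' bD <-|/out //].
  by rewrite TE.
exists T => //=; rewrite inE wE -fT; apply/andP; split; last exact/weightP.
apply/and3P; split.
- by apply/forallP => b; rewrite TE fam ?(valP b).
- apply/'forall_forallP => b c; rewrite !TE; apply/implyP => /andP[/eqP e l].
  by apply: weak => //; apply: valP.
- apply/'forall_forallP => b c; rewrite !TE; apply/implyP => /andP[/eqP e l].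
  by apply: strict => //; apply: valP.
Qed.

Definition transpose (D : {fset box}) : {fset box} :=
  [fset (b.2, b.1) | b in D].

Lemma mem_transpose D b : (b \in transpose D) = ((b.2, b.1) \in D).
Proof.
case: b => i j; apply/imfsetP/idP => [[[i' j'] /= bD [-> ->]] //|bD].
by exists (j, i).
Qed.

Lemma transposeK : involutive transpose.
Proof. by move=> D; apply/fsetP => -[i j]; rewrite !mem_transpose. Qed.

Lemma orient_swap t b : orient t (b.2, b.1) = orient (~~ t) b.
Proof. by case: t; case: b. Qed.

Lemma tableaux_swap t k D m f : f \in tableaux t k D m ->
  (fun b => f (b.2, b.1)) \in tableaux (~~ t) k (transpose D) m.
Proof.
case/tableauxP => out fam weak strict wt; apply/tableauxP; split.
- by move=> b; rewrite mem_transpose => /out.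
- by move=> b; rewrite mem_transpose => /fam.
- move=> b c; rewrite !mem_transpose => bD cD.
  by rewrite -!orient_swap => e l; apply: weak.
- move=> b c; rewrite !mem_transpose => bD cD.
  by rewrite -!orient_swap => e l; apply: strict.
move=> v; rewrite -wt.
have -> : count (fun b => f b == v) (enum_fset D) = count (fun b => f (b.2, b.1) == v)
    [seq (b.2, b.1) | b <- enum_fset D].
  by rewrite count_map; apply: eq_count => -[i j].
apply/seq.permP; apply: uniq_perm; first exact: fset_uniq.
  by rewrite map_inj_uniq ?fset_uniq // => -[i j] [i' j'] /= [-> ->].
move=> [i j]; rewrite [LHS](mem_transpose D (i, j)) /=.
apply/idP/mapP => [bD|[[i' j'] /= bD [-> ->]] //].
by exists (j, i).
Qed.

Lemma card_tableaux_transpose t k D m :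
  #|` tableaux t k (transpose D) m| = #|` tableaux (~~ t) k D m|.
Proof.
pose sw f : box -> variable := fun b => f (b.2, b.1).
have swK : involutive sw by move=> f; apply/funext => -[i j].
have -> : tableaux t k (transpose D) m
    = [fset sw f | f in tableaux (~~ t) k D m].
  apply/fsetP => f; apply/idP/imfsetP => /= [fD|[g gD ->]].
    by exists (sw f); rewrite ?swK //; have := tableaux_swap fD; rewrite transposeK.
  by have := tableaux_swap gD; rewrite negbK.
by rewrite card_imfset //; apply: inv_inj.
Qed.
End Tableaux.

(** * Removing the largest entry of a tableau *)

Section Branching.
Implicit Types (la mu nu ka : seq nat).
Local Notation "la `[ i ]" := (nth 0%N la i) (at level 2, format "la `[ i ]").

Definition box_at (i j : nat) : box := (i.+1%:Z, j.+1%:Z).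

(** la/ka is a vertical strip if t holds, a horizontal strip otherwise. *)
Definition strip_step (t : bool) la ka : bool :=
  skew_pair la ka && [forall i : 'I_(size la),
    (if t then la`[i] <= ka`[i].+1 else la`[i.+1] <= ka`[i])%N].

Lemma strip_stepP t la ka : reflect
  (skew_pair la ka /\
    forall i, (if t then la`[i] <= ka`[i].+1 else la`[i.+1] <= ka`[i])%N)
  (strip_step t la ka).
Proof.
apply: (iffP andP) => -[sp step]; split=> //; last exact/forallP.
move=> i; case: (ltnP i (size la)) => [lt_i|le_i].
  exact: (forallP step (Ordinal lt_i)).
by case: t {step}; rewrite nth_default // (leq_trans le_i).
Qed.

Definition candidates (k N : nat) : seq (seq nat) :=
  [seq map val (val s) | s <- enum {: k.-tuple 'I_N.+1}].

Lemma candidates_uniq k N : uniq (candidates k N).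
Proof.
rewrite map_inj_uniq ?enum_uniq // => s t; move/(inj_map val_inj).
exact: val_inj.
Qed.

Lemma mem_candidates k N ka :
  (ka \in candidates k N) = (size ka == k) && all (fun x => x <= N)%N ka.
Proof.
apply/mapP/andP => [[s _ ->]|[sz_ka /allP le_N]].
  rewrite size_map size_tuple eqxx; split=> //.
  by apply/allP => _ /mapP[i _ ->]; rewrite -ltnS ltn_ord.
have sz : size [seq inord x : 'I_N.+1 | x <- ka] == k by rewrite size_map.
exists (Tuple sz); first by rewrite mem_enum.
rewrite /= -map_comp -[LHS]map_id; apply/eq_in_map => x /le_N le_x /=.
by rewrite inordK.
Qed.

Lemma skew_pair_candidate la ka N : skew_pair la ka -> (head 0%N la <= N)%N ->
  ka \in candidates (size la) N.
Proof.
case/skew_pairP => dec_la dec_ka sz le_ka le_N.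
rewrite mem_candidates sz eqxx; apply/allP => x /(nthP 0%N)[i _ <-].
rewrite (leq_trans (le_ka i)) // (leq_trans _ le_N) // -nth0.
exact: sorted_geq_nth.
Qed.

(** The range of a sum over partitions only has to contain the partitions that
    satisfy the condition. *)
Lemma big_candidates (R : nmodType) (s1 s2 : seq (seq nat)) (P : pred (seq nat))
    (F : seq nat -> R) : uniq s1 -> uniq s2 ->
    (forall ka, P ka -> (ka \in s1) = (ka \in s2)) ->
  \sum_(ka <- s1 | P ka) F ka = \sum_(ka <- s2 | P ka) F ka.
Proof.
move=> u1 u2 eq12; rewrite -[LHS]big_filter -[RHS]big_filter.
apply: perm_big; apply: uniq_perm; rewrite ?filter_uniq //.
by move=> ka; rewrite !mem_filter; case: (boolP (P ka)) => // /eq12.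
Qed.

(** A downward closed predicate on an interval holds on an initial segment,
    whose length is the number of elements satisfying it. *)
Lemma count_prefix (P : pred nat) a n :
    (forall j, a <= j -> j.+1 < a + n -> P j.+1 -> P j)%N ->
  forall j, (a <= j < a + n)%N -> P j = (j < a + count P (iota a n))%N.
Proof.
elim: n a => [|n IHn] a closed j; first by rewrite addn0 ltnNge; case/andP=> ->.
move=> /andP[le_aj lt_j] /=.
have IH := IHn a.+1; rewrite addSnnS in IH.
have {}IH : forall j, (a < j < a + n.+1)%N ->
    P j = (j < a.+1 + count P (iota a.+1 n))%N.
  by apply: IH => i le_i; apply: closed; apply: ltnW.
have [Pa|nPa] := boolP (P a).
  move: le_aj; rewrite leq_eqVlt => /orP[/eqP <-|lt_aj].
    by rewrite Pa -addn1 leq_add2l.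
  by rewrite IH ?lt_aj // addnA addn1.
rewrite add0n; have c0 : count P (iota a.+1 n) = 0%N.
  apply/eqP; rewrite -leqn0 leqNgt -has_count; apply/negP => Pn.
  have n_gt0 : (0 < n)%N by case: (n) Pn.
  have := IH a.+1; rewrite -[X in (X < _ + count _ _)%N]addn0 ltn_add2l -has_count Pn.
  have lt1 : (a.+1 < a + n.+1)%N by move: n_gt0; clear; lia.
  rewrite ltnSn lt1 => /(_ isT) Pa1; move: nPa.
  by rewrite (closed a).
rewrite c0 addn0; move: le_aj; rewrite leq_eqVlt => /orP[/eqP <-|lt_aj].
  by rewrite ltnn; apply: negbTE.
by rewrite IH ?lt_aj // c0 addn0 ltnNge lt_aj ltnNge (ltnW lt_aj).
Qed.

Lemma box_atI i j i' j' : box_at i j = box_at i' j' -> i = i' /\ j = j'.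
Proof. by case=> -> ->. Qed.

Lemma perm_diagram la ka mu : skew_pair la ka -> skew_pair ka mu ->
  perm_eq (diagram la mu : {fset box})
    (enum_fset (diagram ka mu) ++ enum_fset (diagram la ka)).
Proof.
move=> /skew_pairP[_ _ _ le1] /skew_pairP[_ _ _ le2].
apply: uniq_perm; first exact: fset_uniq.
  rewrite cat_uniq !fset_uniq andbT /=; apply/hasPn => b /diagramP[i [j [-> h]]].
  by rewrite /= in_diagram; move: h (le1 i) (le2 i); clear; lia.
move=> b; rewrite mem_cat; apply/idP/orP.
  case/diagramP=> i [j [-> h]]; rewrite !in_diagram.
  by case: (ltnP j ka`[i]) => h'; [left|right]; move: h; clear; lia.
by case=> /diagramP[i [j [-> h]]]; rewrite in_diagram;
  move: h (le1 i) (le2 i); clear; lia.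
Qed.

Section Step.
Variables (t k : bool) (la mu : seq nat) (m : {mset variable}) (z : variable).
Hypothesis sp : skew_pair la mu.
Hypothesis kz : z.1 = k.
Hypothesis max_z : forall x, x \in m -> x != z -> x.2 < z.2.

Definition extend_by ka (f : box -> variable) : box -> variable :=
  fun b => if b \in diagram la ka then z else f b.

Let good ka := [&& skew_pair ka mu, strip_step t la ka
  & sumn la == (sumn ka + m z)%N].

Lemma tableau_entry D f b : f \in tableaux t k D m -> b \in D -> f b \in m.
Proof.
case/tableauxP => _ _ _ _ wt bD; rewrite -mset_gt0 -wt -has_count.
by apply/hasP; exists b.
Qed.

Lemma tableau_entryC D f b : f \in tableaux t k D (drop_variable z m) -> b \in D ->
  f b != z /\ (f b).2 < z.2.
Proof.
case/tableauxP => _ _ _ _ wt bD.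
have := wt (f b); rewrite drop_variableE; case: eqVneq => [eq_z|neq_z] cnt.
  have : has (fun c => f c == f b) (enum_fset D) by apply/hasP; exists b.
  by rewrite has_count cnt.
split=> //; apply: max_z => //; rewrite -mset_gt0 -cnt -has_count.
by apply/hasP; exists b.
Qed.

(** The strip condition is what makes the new entries z compatible with the
    order in rows and columns, z being larger than all the other entries. *)
Lemma extend_tableau ka f : good ka ->
  f \in tableaux t k (diagram ka mu) (drop_variable z m) ->
  extend_by ka f \in tableaux t k (diagram la mu) m.
Proof.
case/and3P=> spk /strip_stepP[spl step] /eqP sum_la fT.
have lt_z b := tableau_entryC fT (b := b).
have [out fam weak strict wt] := tableauxP _ _ _ _ _ fT.
have /skew_pairP[dla _ _ le1] := spl; have /skew_pairP[dka dmu _ le2] := spk.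
have inD i j : (box_at i j \in diagram la mu)
    = (box_at i j \in diagram la ka) || (box_at i j \in diagram ka mu).
  by rewrite !in_diagram; move: (le1 i) (le2 i); clear; lia.
have sub b : b \in diagram la mu -> b \notin diagram la ka -> b \in diagram ka mu.
  by move=> bD; have := bD; case/diagramP: bD => i [j [-> _]]; rewrite inD => /orP[->|].
apply/tableauxP; split.
- move=> b nD; rewrite /extend_by ifF.
    apply: out; apply: contra nD => /diagramP[i [j [-> h]]].
    by rewrite (inD i j) !in_diagram h orbT.
  by apply: contraNF nD => /diagramP[i [j [-> h]]]; rewrite (inD i j) in_diagram h.
- by move=> b bD; rewrite /extend_by; case: ifPn => // /(sub b bD)/fam.
- move=> b c bD cD e l; rewrite /extend_by.
  case: (ifPn (c \in _)) => cE; case: (ifPn (b \in _)) => bE //.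
  + by have [] := lt_z b (sub _ bD bE) => _ /ltW.
  + case/negP: cE; case/diagramP: bE e l => i [j [-> h]].
    case/diagramP: cD => i' [j' [-> h']].
    rewrite in_diagram; case: (t) (step i) => /= st [e]; rewrite ltz_nat ltnS => l.
      rewrite -e in h' *; have le_ii := ltnW l.
      by move: (sorted_geq_nth dka le_ii) (le1 i'); move: h h'; clear; lia.
    by rewrite -e in h' *; move: l h h'; clear; lia.
  + by apply: weak => //; apply: sub.
- move=> b c bD cD e l; rewrite /extend_by.
  case: (ifPn (c \in _)) => cE; case: (ifPn (b \in _)) => bE //.
  + exfalso; case/diagramP: bE e l => i [j [-> h]].
    case/diagramP: cD {cE} => i' [j' [-> h']].
    case: (t) (step i) => /= st [e]; rewrite ltz_nat ltnS => l.
      by rewrite -e in h'; move: st h h' l; clear; lia.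
    rewrite -e in h'; have le_ii : (i.+1 <= i')%N := l.
    by move: (sorted_geq_nth dla le_ii) st h h'; clear; lia.
  + by have [] := lt_z b (sub _ bD bE).
  + exfalso; case/diagramP: bE e l => i [j [-> h]].
    case/diagramP: cD {cE} => i' [j' [-> h']].
    case: (t) (step i) => /= st [e]; rewrite ltz_nat ltnS => l.
      by rewrite -e in h'; move: st h h' l; clear; lia.
    rewrite -e in h'; have le_ii : (i.+1 <= i')%N := l.
    by move: (sorted_geq_nth dla le_ii) st h h'; clear; lia.
  + by apply: strict => //; apply: sub.
move=> v; rewrite (seq.permP (perm_diagram spl spk)) count_cat.
have -> : count (fun b => extend_by ka f b == v) (enum_fset (diagram ka mu))
    = drop_variable z m v.
  rewrite -wt; apply: eq_in_count => b bD; rewrite /extend_by ifF //.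
  apply/negP => /diagramP[i [j [eq_b h]]].
  by move: bD; rewrite eq_b in_diagram; move: h; clear; lia.
have -> : count (fun b => extend_by ka f b == v) (enum_fset (diagram la ka))
    = ((z == v) * #|` diagram la ka|)%N.
  rewrite -count_predT -[RHS]/(_ * count _ (enum_fset (diagram la ka)))%N.
  case: (z =P v) => [<-|neq_v].
    rewrite mul1n; apply: eq_in_count => b bE.
    by rewrite /extend_by bE eqxx.
  rewrite mul0n; apply/eqP; rewrite -leqn0 leqNgt -has_count.
  by apply/hasPn => b bE; rewrite /extend_by bE; apply/eqP.
rewrite drop_variableE eq_sym; case: (z =P v) => [<-|_]; last by rewrite mul0n addn0.
by have := card_diagram spl; rewrite mul1n add0n sum_la => /addnI.
Qed.

Lemma extend_inj ka ka' f f' : good ka -> good ka' ->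
    f \in tableaux t k (diagram ka mu) (drop_variable z m) ->
    f' \in tableaux t k (diagram ka' mu) (drop_variable z m) ->
  extend_by ka f = extend_by ka' f' -> ka = ka' /\ f = f'.
Proof.
move=> /and3P[spk /strip_stepP[spl _] _] /and3P[spk' /strip_stepP[spl' _] _].
move=> fT fT' eqE.
have sub ka1 ka2 f1 f2 : skew_pair ka1 mu -> skew_pair la ka1 ->
    skew_pair ka2 mu -> skew_pair la ka2 ->
    f1 \in tableaux t k (diagram ka1 mu) (drop_variable z m) ->
    f2 \in tableaux t k (diagram ka2 mu) (drop_variable z m) ->
    extend_by ka1 f1 = extend_by ka2 f2 ->
    forall b, b \in diagram ka1 mu -> b \in diagram ka2 mu.
  move=> s1 l1 s2 l2 T1 T2 eq12 b bD.
  have [] := tableau_entryC T1 bD; case/diagramP: bD => i [j [-> h]] neq_z _.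
  have := congr1 (fun f => f (box_at i j)) eq12; rewrite /extend_by.
  have /skew_pairP[_ _ _ /(_ i) le1] := l1.
  rewrite ifF; last by rewrite in_diagram; move: h le1; clear; lia.
  case: ifPn => [_ eq_z|]; first by rewrite eq_z eqxx in neq_z.
  by rewrite !in_diagram => n2 _; move: h le1 n2; clear; lia.
have eqD : diagram ka mu = diagram ka' mu.
  apply/fsetP => b; apply/idP/idP; first exact: (sub ka ka' f f').
  by apply: (sub ka' ka f' f).
have eqka := diagram_inj spk spk' eqD; split=> //; subst ka'.
have [out _ _ _ _] := tableauxP _ _ _ _ _ fT.
have [out' _ _ _ _] := tableauxP _ _ _ _ _ fT'.
apply/funext => b; have [bD|nD] := boolP (b \in diagram ka mu); last first.
  by rewrite out ?out'.
have nE : (b \in diagram la ka) = false.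
  by case/diagramP: bD => i [j [-> h]]; rewrite in_diagram; move: h; clear; lia.
by have := congr1 (fun f => f b) eqE; rewrite /extend_by nE.
Qed.

(** Entries increase along rows, so the entries other than the largest variable
    z fill an initial segment of each row. *)
Definition recovered (f : box -> variable) : seq nat :=
  mkseq (fun i => mu`[i] + count (fun j => f (box_at i j) != z)
    (iota mu`[i] (la`[i] - mu`[i])))%N (size la).

(** Conversely the boxes filled with z form a strip: two of them violating the
    strip condition would be in a strictly increasing position. *)
Lemma tableau_extends f : f \in tableaux t k (diagram la mu) m ->
  exists ka f', [/\ good ka, f' \in tableaux t k (diagram ka mu) (drop_variable z m)
    & f = extend_by ka f'].
Proof.
move=> fT; have [out fam weak strict wt] := tableauxP _ _ _ _ _ fT.
have /skew_pairP[dla dmu sz le_mu] := sp.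
pose ka := recovered f; pose f' b := if b \in diagram ka mu then f b else outside_entry.
have le_z b : b \in diagram la mu -> f b != z -> (f b).2 < z.2.
  by move=> bD neq_z; apply: max_z => //; apply: tableau_entry bD.
have kaE i : ka`[i] = (mu`[i] + count (fun j => f (box_at i j) != z)
    (iota mu`[i] (la`[i] - mu`[i])))%N.
  case: (ltnP i (size la)) => [lt_i|le_i]; first by rewrite nth_mkseq.
  by rewrite !nth_default ?sz ?size_mkseq.
have le_ka i : (mu`[i] <= ka`[i] <= la`[i])%N.
  rewrite kaE leq_addr /= -[X in (_ <= X)%N](subnKC (le_mu i)) leq_add2l.
  by rewrite (leq_trans (count_size _ _)) // size_iota.
have lt_ka i j : (mu`[i] <= j < la`[i])%N ->
    (f (box_at i j) != z) = (j < ka`[i])%N.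
  move=> le_j; rewrite kaE.
  apply: (count_prefix (P := fun j => f (box_at i j) != z)); last first.
    by rewrite subnKC.
  move=> {le_j} j le_j; rewrite subnKC // => lt_j neq_z.
  have bD : box_at i j \in diagram la mu by rewrite in_diagram; move: le_j lt_j; clear; lia.
  have cD : box_at i j.+1 \in diagram la mu by rewrite in_diagram; move: le_j lt_j; clear; lia.
  have lt_c := le_z _ cD neq_z.
  suff : (f (box_at i j)).2 < z.2 by apply: contraTneq => ->; rewrite ltxx.
  have lt_bc : (box_at i j).2 < (box_at i j.+1).2 by rewrite /= ltz_nat.
  case: (t) weak strict => weak strict.
    by apply: lt_trans lt_c; apply: strict.
  by apply: le_lt_trans lt_c; apply: weak.
have eq_z i j : (mu`[i] <= j < la`[i])%N -> (ka`[i] <= j)%N -> f (box_at i j) = z.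
  by move=> /lt_ka e le; apply/eqP; rewrite -[_ == _]negbK e -leqNgt.
have stp i : (if t then la`[i] <= ka`[i].+1 else la`[i.+1] <= ka`[i])%N.
  case tE : t; rewrite leqNgt; apply/negP => lt.
    have bD : box_at i ka`[i] \in diagram la mu.
      by rewrite in_diagram; move: (le_ka i) lt; clear; lia.
    have cD : box_at i ka`[i].+1 \in diagram la mu.
      by rewrite in_diagram; move: (le_ka i) lt; clear; lia.
    have := strict _ _ bD cD; rewrite tE /= ltz_nat => /(_ erefl (ltnSn _)).
    by rewrite !eq_z ?ltxx //; rewrite ?in_diagram in bD cD.
  have /sorted_geqP/(_ i) le1 := dla; have /sorted_geqP/(_ i) le2 := dmu.
  have bD : box_at i ka`[i] \in diagram la mu.
    by rewrite in_diagram; move: (le_ka i) lt le1; clear; lia.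
  have cD : box_at i.+1 ka`[i] \in diagram la mu.
    by rewrite in_diagram; move: (le_ka i) lt le2; clear; lia.
  have := strict _ _ bD cD; rewrite tE /= ltz_nat => /(_ erefl (ltnSn _)).
  rewrite eq_z //; last by rewrite in_diagram in bD.
  have [->|/(le_z _ cD) lt_c] := eqVneq (f (box_at i.+1 ka`[i])) z.
    by rewrite ltxx.
  by move=> /lt_trans/(_ lt_c); rewrite ltxx.
have dka : sorted geq ka.
  apply/sorted_geqP => i; case tE : t stp => stp; last first.
    by move: (stp i) (le_ka i.+1); clear; lia.
  rewrite leqNgt; apply/negP => lt.
  have /sorted_geqP/(_ i) le1 := dla; have /sorted_geqP/(_ i) le2 := dmu.
  have bD : box_at i ka`[i] \in diagram la mu.
    by rewrite in_diagram; move: (le_ka i) (le_ka i.+1) lt le1; clear; lia.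
  have cD : box_at i.+1 ka`[i] \in diagram la mu.
    by rewrite in_diagram; move: (le_ka i) (le_ka i.+1) lt le2; clear; lia.
  have := weak _ _ bD cD; rewrite tE /= ltz_nat => /(_ erefl (ltnSn _)).
  rewrite eq_z //; last by rewrite in_diagram in bD.
  rewrite leNgt le_z // lt_ka //; by rewrite in_diagram in cD.
have spk : skew_pair ka mu.
  by apply/skew_pairP; split=> // [|i]; rewrite ?size_mkseq //; case/andP: (le_ka i).
have spl : skew_pair la ka.
  by apply/skew_pairP; split=> // [|i]; rewrite ?size_mkseq //; case/andP: (le_ka i).
have subD b : b \in diagram ka mu -> b \in diagram la mu.
  by case/diagramP => i [j [-> h]]; rewrite in_diagram; move: h (le_ka i); clear; lia.
have neq_z b : b \in diagram ka mu -> f b != z.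
  by case/diagramP => i [j [-> h]]; rewrite lt_ka; move: h (le_ka i); clear; lia.
have is_z b : b \in diagram la ka -> f b = z.
  by case/diagramP => i [j [-> h]]; apply: eq_z; move: h (le_ka i); clear; lia.
have cnt v : m v = (count (fun b => f b == v) (enum_fset (diagram ka mu))
    + (z == v) * #|` diagram la ka|)%N.
  rewrite -wt (seq.permP (perm_diagram spl spk)) count_cat; congr addn.
  rewrite -count_predT; case: (z =P v) => [<-|neq_v].
    by rewrite mul1n; apply: eq_in_count => b /is_z ->; rewrite eqxx.
  rewrite mul0n; apply/eqP; rewrite -leqn0 leqNgt -has_count.
  by apply/hasPn => b /is_z ->; apply/eqP.
have cntz : count (fun b => f b == z) (enum_fset (diagram ka mu)) = 0%N.
  apply/eqP; rewrite -leqn0 leqNgt -has_count.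
  by apply/hasPn => b /neq_z.
exists ka, f'; split.
- apply/and3P; split=> //; first exact/strip_stepP.
  by rewrite cnt cntz eqxx mul1n add0n (card_diagram spl).
- apply/tableauxP; split.
  + by move=> b /negPf nb; rewrite /f' nb.
  + by move=> b bD; rewrite /f' bD fam ?subD.
  + by move=> b c bD cD; rewrite /f' bD cD; apply: weak; apply: subD.
  + by move=> b c bD cD; rewrite /f' bD cD; apply: strict; apply: subD.
  move=> v; rewrite drop_variableE.
  transitivity (count (fun b => f b == v) (enum_fset (diagram ka mu))).
    by apply: eq_in_count => b bD; rewrite /f' bD.
  case: (eqVneq v z) => [->//|neq_v].
  by rewrite cnt eq_sym (negPf neq_v) mul0n addn0.
apply/funext => b; rewrite /extend_by /f'; case: ifP => [/is_z //|nE].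
case: ifP => // nK; apply: out; apply/negP => /diagramP[i [j [eq_b h]]].
by move: nE nK; rewrite eq_b !in_diagram; move: h (le_ka i); clear; lia.
Qed.

Lemma card_tableaux_step : #|` tableaux t k (diagram la mu) m|
  = (\sum_(ka <- candidates (size la) (head 0%N la) | good ka)
      #|` tableaux t k (diagram ka mu) (drop_variable z m)|)%N.
Proof.
pose s := [seq ka <- candidates (size la) (head 0%N la) | good ka].
pose T ka := enum_fset (tableaux t k (diagram ka mu) (drop_variable z m)).
rewrite -big_filter -/s.
transitivity (size [seq extend_by ka f | ka <- s, f <- T ka]); last first.
  by rewrite size_allpairs_dep sumnE big_map.
apply/perm_size/uniq_perm; first exact: fset_uniq.
  apply: allpairs_uniq_dep => [|ka _|]; rewrite ?fset_uniq //.
    by rewrite filter_uniq ?candidates_uniq.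
  move=> _ _ /allpairsPdep[ka [f [ka_s fT ->]]] /allpairsPdep[ka' [f' [ka_s' fT' ->]]] /=.
  move: ka_s ka_s'; rewrite !mem_filter => /andP[gka _] /andP[gka' _] e.
  by have [] := extend_inj gka gka' fT fT' e; move=> eka ef; subst.
move=> f; apply/idP/allpairsPdep => [fT|[ka [f' [ka_s fT ->]]]]; last first.
  by move: ka_s; rewrite mem_filter => /andP[gka _]; apply: extend_tableau.
have [ka [f' [gka fT' ->]]] := tableau_extends fT.
exists ka, f'; split=> //; rewrite mem_filter gka /=.
case/and3P: gka => _ /strip_stepP[spl _] _.
exact: skew_pair_candidate spl (leqnn _).
Qed.
End Step.
End Branching.

(** * Branching of supersymmetric Schur functions *)

Section SuperCoefficients.
Implicit Types (la mu nu ka : seq nat) (m : {mset variable}) (z : variable).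
Local Notation "la `[ i ]" := (nth 0%N la i) (at level 2, format "la `[ i ]").

Lemma skew_pair_refl la : sorted geq la -> skew_pair la la.
Proof. by move=> dla; apply/skew_pairP. Qed.

Lemma skew_pair_trans ka la mu : skew_pair la ka -> skew_pair ka mu ->
  skew_pair la mu.
Proof.
move=> /skew_pairP[dla _ sz1 le1] /skew_pairP[_ dmu sz2 le2].
apply/skew_pairP; split=> // [|i]; first by rewrite sz2.
exact: leq_trans (le1 i).
Qed.

(** The box (i, j) is in la exactly when (j, i) is in the conjugate of la. *)
Lemma conjugateE la i j : sorted geq la ->
  (i < (conjugate la)`[j])%N = (j < la`[i])%N.
Proof.
move=> dla; have -> : (conjugate la)`[j] = count (fun x => j < x)%N la.
  case: (ltnP j (head 0%N la)) => [lt_j|le_j].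
    by rewrite (nth_map 0%N) ?size_iota // nth_iota.
  rewrite nth_default ?size_map ?size_iota //; apply/esym/eqP.
  rewrite -leqn0 leqNgt -has_count; apply/hasPn => x /(nthP 0%N)[k _ <-].
  by rewrite -leqNgt (leq_trans _ le_j) // -nth0 sorted_geq_nth.
elim: la i dla => [|x la IHla] i dla; first by rewrite !nth_nil.
have dla' : sorted geq la by case: la dla {IHla} => //= y la /andP[].
rewrite /=; have [lt_jx|le_xj] := ltnP j x.
  by case: i => [|i]; rewrite ?lt_jx //= add1n ltnS IHla.
rewrite add0n IHla //; have := sorted_geq_nth dla (leq0n i).
have /= := sorted_geq_nth dla (leq0n i.+1).
by case: i => [|i] /=; move: le_xj; clear; lia.
Qed.

Lemma diagram_conjugate la nu : sorted geq la -> sorted geq nu ->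
  diagram (conjugate la) (conjugate nu) = transpose (diagram la nu).
Proof.
move=> dla dnu; have E i j : (box_at j i \in diagram (conjugate la) (conjugate nu))
    = (box_at i j \in diagram la nu).
  by rewrite !in_diagram conjugateE // leqNgt conjugateE // -leqNgt.
apply/fsetP => b; rewrite mem_transpose.
apply/idP/idP => bD; have := bD; case/diagramP: bD => j [i [eb _]].
  by rewrite eb (E i j).
by case: b eb => b1 b2 /= [-> ->]; rewrite -(E j i).
Qed.

Definition family_part k m : {mset variable} :=
  seq_mset [seq x <- enum_mset m | x.1 == k].

Lemma family_partE k m x : family_part k m x = if x.1 == k then m x else 0%N.
Proof.
rewrite mset_seqE count_filter -count_mem_mset; case: eqP => [<-|neq_k].
  by apply: eq_count => y /=; case: eqP => // ->; rewrite eqxx.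
apply/eqP; rewrite -leqn0 leqNgt -has_count; apply/hasPn => y _ /=.
by case: eqP => // ->; apply/eqP.
Qed.

Lemma tableaux_family t k D m f : f \in tableaux t k D m -> m = family_part k m.
Proof.
case/tableauxP => _ fam _ _ wt; apply/msetP => x; rewrite family_partE.
case: eqP => // neq_k; apply/eqP; rewrite -wt -leqn0 leqNgt -has_count.
by apply/hasPn => b bD /=; apply/negP => /eqP eq_x; rewrite -eq_x fam in neq_k.
Qed.

(** In a product of a series in the x's by a series in the y's, only the
    factorization of m into its two families contributes to the coefficient. *)
Lemma super_schur_coef la mu m : skew_pair la mu ->
  super_schur la mu m =
    \sum_(nu <- candidates (size la) (head 0%N la)
        | skew_pair nu mu && skew_pair la nu)
      (#|` tableaux false false (diagram nu mu) (family_part false m)|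
       * #|` tableaux true true (diagram la nu) (family_part true m)|)%:R.
Proof.
move=> sp; rewrite /super_schur series_sumE [RHS]big_map enumT /=.
apply: eq_bigr => t /andP[]; move: (map val _) => nu sp1 sp2.
rewrite series_mulrE.
have [dla dnu _ _] := skew_pairP _ _ sp2.
have YE a : skew_schur Y_family (conjugate la) (conjugate nu) a
    = #|` tableaux true true (diagram la nu) a|%:Z.
  by rewrite skew_schurE diagram_conjugate // card_tableaux_transpose.
have partK : (family_part false m `+` family_part true m)%mset = m.
  by apply/msetP => x; rewrite msetE2 !family_partE; case: x.1; rewrite ?addn0.
have [le_m eq_m] := divisorP partK.
rewrite (bigD1_seq (family_part false m)) ?fset_uniq ?in_divisors_of //=.
rewrite -eq_m YE skew_schurE big_seq_cond big1 ?addr0 => [|a /andP[a_m neq_a]].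
  by rewrite natrM !natz.
rewrite YE skew_schurE.
have [->|[f fT]] := fset_0Vmem (tableaux false X_family (diagram nu mu) a).
  by rewrite cardfs0 mul0r.
have [->|[g gT]] := fset_0Vmem (tableaux true true (diagram la nu) (m `\` a)%mset).
  by rewrite cardfs0 mulr0.
case/eqP: neq_a; rewrite -[in RHS](divisors_split a_m); apply/msetP => x.
rewrite family_partE msetE2 (tableaux_family gT) (tableaux_family fT) !family_partE.
by case: x.1 => //=; rewrite addn0.
Qed.

Lemma card_tableaux0 t k la nu : skew_pair la nu ->
  #|` tableaux t k (diagram la nu) mset0| = (la == nu).
Proof.
move=> sp; have [->|neq] := eqVneq la nu.
  have D0 b : b \notin diagram nu nu.
    by apply/negP => /diagramP[i [j [_]]]; clear; lia.
  suff -> : tableaux t k (diagram nu nu) mset0 = [fset (fun=> outside_entry)].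
    by rewrite cardfs1.
  apply/fsetP => f; rewrite in_fset1; apply/tableauxP/eqP => [[out _ _ _ _]|->].
    by apply/funext => b; apply: out.
  split=> // [b|b|v]; rewrite ?(negPf (D0 b)) // mset0E.
  apply/eqP; rewrite -leqn0 leqNgt -has_count; apply/hasPn => b.
  by rewrite (negPf (D0 b)).
apply/eqP; rewrite cardfs_eq0; apply/eqP/fsetP => f; rewrite in_fset0.
apply/negP => fT; case/eqP: neq.
have sz : size nu = size la by case/skew_pairP: sp.
apply: (@eq_from_nth _ 0%N) => // i _.
have /skew_pairP[_ _ _ /(_ i) le_i] := sp.
apply/eqP; rewrite eqn_leq le_i andbT leqNgt; apply/negP => lt_i.
have bD : box_at i nu`[i] \in diagram la nu by rewrite in_diagram leqnn.
by have := tableau_entry fT bD; rewrite in_mset0.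
Qed.

(** The order in which the variables are let in: the x's come first. *)
Definition variable_lt (x z : variable) :=
  (~~ x.1 && z.1) || ((x.1 == z.1) && (x.2 < z.2)).

Lemma super_schur0 la mu : skew_pair la mu ->
  super_schur la mu mset0 = (la == mu)%:R.
Proof.
move=> sp; rewrite super_schur_coef //.
have f0 k : family_part k mset0 = mset0.
  by apply/msetP => x; rewrite family_partE mset0E if_same.
have sz : size mu = size la by case/skew_pairP: sp.
have laC := skew_pair_candidate (skew_pair_refl (proj1 (andP sp))) (leqnn _).
have dla : sorted geq la by case/andP: sp.
rewrite big_mkcond (bigD1_seq la) ?candidates_uniq //=.
rewrite sp skew_pair_refl //= !f0 !card_tableaux0 ?skew_pair_refl //.
rewrite eqxx muln1 big1 ?addr0 // => nu neq; case: ifP => // /andP[s1 s2].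
by rewrite !card_tableaux0 // [la == nu]eq_sym (negPf neq) muln0.
Qed.

Lemma super_schur_X la mu m : skew_pair la mu -> (forall x, x \in m -> ~~ x.1) ->
  super_schur la mu m = #|` tableaux false false (diagram la mu) m|%:R.
Proof.
move=> sp mX; rewrite super_schur_coef //.
have fY : family_part true m = mset0.
  apply/msetP => x; rewrite family_partE mset0E; case: ifP => // /eqP xY.
  by apply/eqP; rewrite mset_eq0; apply/negP => /mX; rewrite xY.
have fX : family_part false m = m.
  apply/msetP => x; rewrite family_partE; case: ifP => // xY.
  by apply/esym/eqP; rewrite mset_eq0; apply/negP => /mX; rewrite -eqbF_neg xY.
have laC := skew_pair_candidate (skew_pair_refl (proj1 (andP sp))) (leqnn _).
have dla : sorted geq la by case/andP: sp.
rewrite fX fY big_mkcond (bigD1_seq la) ?candidates_uniq //=.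
rewrite sp skew_pair_refl //= card_tableaux0 ?skew_pair_refl //.
rewrite eqxx muln1 big1 ?addr0 // => nu neq; case: ifP => // /andP[s1 s2].
by rewrite card_tableaux0 // [la == nu]eq_sym (negPf neq) muln0.
Qed.

(** If z is a y, it belongs to the second factor of the definition, and la/ka is
    removed from la/nu for all nu at once; if z is an x, then m contains no y, so
    that nu = la. *)
Lemma super_schur_step la mu m z : skew_pair la mu ->
    (forall x, x \in m -> x != z -> variable_lt x z) ->
  super_schur la mu m =
    \sum_(ka <- candidates (size la) (head 0%N la)
       | [&& skew_pair ka mu, strip_step z.1 la ka & sumn la == (sumn ka + m z)%N])
      super_schur ka mu (drop_variable z m).
Proof.
move=> sp max_z; case zk : z.1; last first.
  have mX x : x \in m -> ~~ x.1.
    move=> xm; case: (eqVneq x z) => [->|neq]; first by rewrite zk.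
    by have := max_z x xm neq; rewrite /variable_lt zk andbF /=; case: x.1.
  rewrite super_schur_X // (card_tableaux_step false sp zk); last first.
    move=> x xm neq; have := max_z x xm neq; rewrite /variable_lt zk andbF /=.
    by case/andP.
  rewrite natr_sum; apply: eq_bigr => ka /and3P[spk _ _].
  rewrite super_schur_X // => x; rewrite -mset_gt0 drop_variableE; case: eqP => // _.
  by rewrite mset_gt0; apply: mX.
have partX : family_part false (drop_variable z m) = family_part false m.
  apply/msetP => x; rewrite !family_partE drop_variableE; case: ifP => //.
  by case: (x =P z) => [->|//]; rewrite zk.
have partY : family_part true (drop_variable z m) = drop_variable z (family_part true m).
  apply/msetP => x; rewrite family_partE !drop_variableE family_partE.
  by case: (x == z); rewrite ?if_same.
have mYz : family_part true m z = m z by rewrite family_partE zk.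
pose N := head 0%N la; pose k := size la.
pose GX nu := #|` tableaux false false (diagram nu mu) (family_part false m)|.
pose GY ka nu := #|` tableaux true true (diagram ka nu)
  (drop_variable z (family_part true m))|.
transitivity (\sum_(nu <- candidates k N | skew_pair nu mu && skew_pair la nu)
   \sum_(ka <- candidates k N | [&& skew_pair ka nu, strip_step true la ka
       & sumn la == (sumn ka + m z)%N]) ((GX nu * GY ka nu)%:R : int)).
  rewrite super_schur_coef //; apply: eq_bigr => nu /andP[s1 s2].
  rewrite (card_tableaux_step true s2 zk); last first.
    move=> x; rewrite -mset_gt0 family_partE; case: ifP => // /eqP xk xm neq.
    have := max_z x _ neq; rewrite -mset_gt0 => /(_ xm).
    by rewrite /variable_lt xk zk.
  by rewrite mYz big_distrr /= natr_sum.
rewrite (exchange_big_dep (fun ka => [&& skew_pair ka mu, strip_step true la ka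
    & sumn la == (sumn ka + m z)%N])) /=; last first.
  move=> nu ka /andP[s1 s2] /and3P[s3 -> ->]; rewrite !andbT.
  exact: skew_pair_trans s1.
apply: eq_bigr => ka /and3P[spk stp sm]; rewrite super_schur_coef //.
have spl : skew_pair la ka by case/strip_stepP: stp.
have [_ _ szk lek] := skew_pairP _ _ spl.
rewrite partX partY.
transitivity (\sum_(nu <- candidates k N | skew_pair nu mu && skew_pair ka nu)
    ((GX nu * GY ka nu)%:R : int)).
  apply: eq_bigl => nu; rewrite stp sm !andbT.
  case: (boolP (skew_pair ka nu)) => s3; rewrite ?andbF // andbT.
  by rewrite (skew_pair_trans spl s3) andbT.
apply: big_candidates; rewrite ?candidates_uniq // => nu /andP[_ s3].
rewrite /k -szk !(skew_pair_candidate s3) //.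
by rewrite /N -!nth0.
Qed.
End SuperCoefficients.

(** * Complete functions and multilinear expansions *)

Section DeterminantExpansion.
Variable A : comNzRingType.

Lemma det_sum_rows (k n : nat) (c : 'I_k -> 'I_n -> A)
    (v : 'I_k -> 'I_n -> 'I_k -> A) :
  \det (\matrix_(i, j) \sum_(d < n) c i d * v i d j)
    = \sum_(f : {ffun 'I_k -> 'I_n})
        (\prod_i c i (f i)) * \det (\matrix_(i, j) v i (f i) j).
Proof.
rewrite /determinant.
transitivity (\sum_(s : 'S_k) \sum_(f : {ffun 'I_k -> 'I_n})
    (-1) ^+ s * \prod_i (c i (f i) * v i (f i) (s i))).
  apply: eq_bigr => s _; rewrite -mulr_sumr; congr (_ * _).
  by under eq_bigr => i _ do rewrite mxE; rewrite bigA_distr_bigA.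
rewrite exchange_big; apply: eq_bigr => f _; rewrite mulr_sumr.
apply: eq_bigr => s _; rewrite big_split /= mulrCA; congr (_ * (_ * _)).
by apply: eq_bigr => i _; rewrite mxE.
Qed.

(** A permutation cannot map the k - i0 indices from i0 on into the
    k - i0 - 1 indices after i0. *)
Lemma det_zero_block k (M : 'M[A]_k) (i0 : 'I_k) :
  (forall i j : 'I_k, (i0 <= i)%N -> (j <= i0)%N -> M i j = 0) -> \det M = 0.
Proof.
move=> M0; apply: big1 => s _.
suff [i le_i le_s] : exists2 i : 'I_k, (i0 <= i)%N & (s i <= i0)%N.
  by rewrite (bigD1 i) //= M0 // mul0r mulr0.
apply/exists_inP; apply: contraT => /exists_inPn noi.
pose U := [set i : 'I_k | (i0 <= i)%N].
have : s @: U \proper U.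
  apply: (@sub_proper_trans _ _ (U :\ i0)); last first.
    by apply: properD1; rewrite inE.
  apply/subsetP => x /imsetP[i]; rewrite inE => le_i ->{x}.
  have := noi i le_i; rewrite -ltnNge !inE => lt_i.
  by rewrite (ltnW lt_i) andbT; apply: contraTneq lt_i => ->; rewrite ltnn.
by move/proper_card; rewrite card_imset ?ltnn //; apply: perm_inj.
Qed.

Lemma det_rows_eq k (M : 'M[A]_k) (i i' : 'I_k) : i != i' ->
  (forall j, M i j = M i' j) -> \det M = 0.
Proof. by move=> neq eqM; apply: (determinant_alternate neq). Qed.
End DeterminantExpansion.

(** This is h(n): the monomials of degree n in which each y occurs at most once. *)
HB.lock Definition complete (n : int) : series variable := fun m =>
  ((n == (size (enum_mset m))%:Z)
     && `[< forall x : variable, x.1 -> (m x <= 1)%N >])%:R.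

Section JacobiTrudi.
Implicit Types (la mu nu ka : seq nat) (m : {mset variable}) (z : variable).
Local Notation "la `[ i ]" := (nth 0%N la i) (at level 2, format "la `[ i ]").

Definition labels la : seq int :=
  [seq (la`[i])%:Z - i%:Z | i <- iota 0 (size la)].

Lemma size_labels la : size (labels la) = size la.
Proof. by rewrite size_map size_iota. Qed.

Lemma nth_labels la i : (i < size la)%N -> (labels la)`_i = (la`[i])%:Z - i%:Z.
Proof. by move=> lt_i; rewrite (nth_map 0%N) ?size_iota // nth_iota. Qed.

Definition jacobi_trudi la mu : series variable :=
  ldet (fun a b => complete (a - b)) (labels la) (labels mu).

Lemma completeE n m : complete n m =
  ((n == (size (enum_mset m))%:Z) && `[< forall x : variable, x.1 -> (m x <= 1)%N >])%:R.
Proof. by rewrite unlock. Qed.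

Lemma complete_neg n : n < 0 -> complete n = 0.
Proof.
move=> n_lt0; apply/funext => m; rewrite completeE.
by case: eqP n_lt0 => [->|].
Qed.

Lemma restrict_jacobi_trudi (F : pred variable) la mu :
  restrict F (jacobi_trudi la mu)
    = ldet (fun a b => restrict F (complete (a - b))) (labels la) (labels mu).
Proof.
rewrite /jacobi_trudi /ldet -det_map_mx; congr (\det _).
by apply/matrixP => i j; rewrite !mxE.
Qed.
Lemma size_msetD (a b : {mset variable}) :
  size (enum_mset (a `+` b)%mset) = (size (enum_mset a) + size (enum_mset b))%N.
Proof.
rewrite -size_cat; apply/perm_size/allP => x _.
by rewrite /= count_cat !count_mem_mset msetE2.
Qed.

Lemma all_predU1 (F : pred variable) z m :
  all (predU1 z F) (enum_mset m) = all F (enum_mset (drop_variable z m)).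
Proof.
apply/all_msetP/all_msetP => allF x.
  rewrite -mset_gt0 drop_variableE; case: eqP => // /eqP neq.
  by rewrite mset_gt0 => /allF /=; rewrite (negPf neq).
move=> xm /=; case: (x =P z) => //= /eqP neq; apply: allF.
by rewrite -mset_gt0 drop_variableE (negPf neq) mset_gt0.
Qed.

Lemma all_notin (F : pred variable) z m : ~~ F z ->
  all F (enum_mset m) = all (predU1 z F) (enum_mset m) && (m z == 0%N).
Proof.
move=> nFz; apply/all_msetP/andP => [allF|[/all_msetP allF /eqP mz] x xm].
  split; first by apply/all_msetP => x /allF /= ->; rewrite orbT.
  by rewrite mset_eq0; apply: contra nFz => /allF.
have /orP[/eqP eqz|//] := allF x xm.
by move: xm; rewrite eqz -mset_gt0 mz.
Qed.

Lemma mset_split z m : (msetn (m z) z `+` drop_variable z m)%mset = m.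
Proof.
apply/msetP => x; rewrite msetE2 drop_variableE msetnE.
by case: eqP => [->|_]; rewrite ?addn0.
Qed.

(** Multiplication of the generating function of the h(n) by 1 + z t. *)
Lemma complete_step_Y (F : pred variable) z n : ~~ F z -> z.1 ->
  restrict (predU1 z F) (complete n)
    = restrict F (complete n) + power z 1 * restrict F (complete (n - 1)).
Proof.
move=> nFz zY; apply/funext => m.
rewrite -[RHS]/(restrict F (complete n) m
  + (power z 1 * restrict F (complete (n - 1))) m) powerME //.
rewrite !restrictE (all_notin m nFz) -all_predU1.
case: ifP => [allF|_]; last by rewrite if_same.
have [mz0|mz_gt0] := posnP (m z); first by rewrite mz0 /= addr0.
rewrite /= add0r !completeE -{1}[m](mset_split z) size_msetD.
rewrite enum_msetn size_nseq; case: (m z =P 1%N) => [mz1|/eqP neq1].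
  congr ((_ && _)%:R).
    by rewrite mz1 PoszD; apply/eqP/eqP; clear; lia.
  apply/asboolP/asboolP => le1 x xY.
    by rewrite drop_variableE; case: eqP => // _; apply: le1.
  have := le1 x xY; rewrite drop_variableE; case: eqP => [->|//].
  by rewrite mz1.
rewrite [X in _ && X](_ : _ = false) ?andbF //; apply/asboolP => /(_ z zY).
by move: neq1 mz_gt0; clear; lia.
Qed.

(** Multiplication of the generating function of the h(n) by 1/(1 - z t). *)
Lemma complete_step_X (F : pred variable) z n : ~~ F z -> ~~ z.1 ->
  restrict (predU1 z F) (complete n)
    = restrict F (complete n) + power z 1 * restrict (predU1 z F) (complete (n - 1)).
Proof.
move=> nFz zX; apply/funext => m.
rewrite -[RHS]/(restrict F (complete n) m
  + (power z 1 * restrict (predU1 z F) (complete (n - 1))) m) monomialME.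
rewrite !restrictE (all_notin m nFz).
have [mz0|mz_gt0] := posnP (m z).
  have nle : (msetn 1 z `<=` m)%mset = false.
    by apply/negP => /msubsetP/(_ z); rewrite msetnxx mz0.
  by rewrite nle andbT addr0.
have le_zm : (msetn 1 z `<=` m)%mset.
  by apply/msubsetP => x; rewrite msetnE; case: eqP => // ->.
have eq_m : (msetn 1 z `+` (m `\` msetn 1 z))%mset = m.
  by apply: divisors_split; rewrite in_divisors_of.
rewrite le_zm andbF add0r.
have -> : all (predU1 z F) (enum_mset (m `\` msetn 1 z)%mset)
    = all (predU1 z F) (enum_mset m).
  by rewrite -[in RHS]eq_m all_msetD enum_msetn /= eqxx.
case: ifP => // _; rewrite !completeE -{1}eq_m size_msetD enum_msetn size_nseq.
congr ((_ && _)%:R); first by rewrite PoszD; apply/eqP/eqP; clear; lia.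
apply/asboolP/asboolP => le1 x xY; move: (le1 x xY); rewrite msetE2 msetnE.
  by case: eqP => _; clear; lia.
by case: eqP => [eqx|_]; [rewrite eqx (negPf zX) in xY|rewrite subn0].
Qed.

Lemma complete_expand_X (F : pred variable) z n d : ~~ F z -> ~~ z.1 ->
  restrict (predU1 z F) (complete n)
    = \sum_(e < d) power z e * restrict F (complete (n - e%:Z))
      + power z d * restrict (predU1 z F) (complete (n - d%:Z)).
Proof.
move=> nFz zX; elim: d => [|d IHd].
  by rewrite big_ord0 add0r power0 mul1r subr0.
rewrite big_ord_recr /= -addrA; set S := \sum_(e < d) _ in IHd *.
apply: etrans IHd _; apply: (congr1 (+%R S)).
apply: etrans (congr1 ( *%R (power z d)) (complete_step_X (n - d%:Z) nFz zX)) _.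
have key (p q a b : series variable) : p * (a + q * b) = p * a + (p * q) * b.
  by rewrite mulrDr mulrA.
rewrite [LHS]key -(powerD z d 1) addn1.
by have -> : n - d%:Z - 1 = n - d.+1%:Z by clear; lia.
Qed.

(** The exponent of z in a monomial determines the size of la/ka, so the condition
    on the size in [super_schur_step] disappears when series are summed. *)
Lemma restrict_super_step (F : pred variable) z la mu : skew_pair la mu ->
    ~~ F z -> (forall x, F x -> variable_lt x z) ->
  restrict (predU1 z F) (super_schur la mu) =
    \sum_(ka <- candidates (size la) (head 0%N la)
       | skew_pair ka mu && strip_step z.1 la ka)
      power z (sumn la - sumn ka)%N * restrict F (super_schur ka mu).
Proof.
move=> sp nFz lt_z; apply/funext => m; rewrite series_sumE restrictE.
under eq_bigr => ka _ do rewrite powerME // restrictE -all_predU1.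
case: ifP => allF; last by rewrite big1 // => ka _; rewrite if_same.
rewrite (super_schur_step sp (z := z)); last first.
  move=> x xm neq; apply: lt_z; have /all_msetP/(_ x xm) /= := allF.
  by rewrite (negPf neq).
rewrite [RHS](bigID (fun ka => m z == (sumn la - sumn ka)%N)) /=.
rewrite [X in _ + X]big1 ?addr0 => [|ka /andP[_ /negPf->] //].
rewrite [RHS](eq_bigr (fun ka => super_schur ka mu (drop_variable z m))); last first.
  by move=> ka /andP[_ ->].
apply: eq_bigl => ka; rewrite andbA.
case: (boolP (strip_step z.1 la ka)) => [/strip_stepP[spl _]|]; last first.
  by rewrite !andbF.
congr (_ && _); have : (sumn ka <= sumn la)%N.
  by rewrite (skew_pair_sum spl) leq_addr.
by clear; lia.
Qed.
End JacobiTrudi.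

(** * Branching of Jacobi-Trudi determinants *)

(** Letting in the variable z transforms the Jacobi-Trudi determinant as it
    transforms the series of tableaux.  In [ok i d], the number d is how much
    the strip la/ka takes off the row i. *)
Section JacobiTrudiStep.
Variables (la mu : seq nat) (z : variable) (F : pred variable).
Local Notation "s `[ i ]" := (nth 0%N s i) (at level 2, format "s `[ i ]").
Hypothesis sp : skew_pair la mu.
Hypothesis nFz : ~~ F z.

Local Notation k := (size la).
Let n := (head 0%N la).+2.
Let l i : int := (la`[i])%:Z - i%:Z.
Let m i : int := (mu`[i])%:Z - i%:Z.
Let hF a : series variable := restrict F (complete a).
Let hF' a : series variable := restrict (predU1 z F) (complete a).
Let ok (i d : nat) : bool := (if z.1 then d <= 1 else d <= la`[i] - la`[i.+1])%N.

Let sz_mu : size mu = k. Proof. by case/skew_pairP: sp. Qed.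
Let dla : sorted geq la. Proof. by case/skew_pairP: sp. Qed.
Let dmu : sorted geq mu. Proof. by case/skew_pairP: sp. Qed.

Lemma ldet_labels (g : int -> series variable) ka : size ka = k ->
  ldet (fun a b => g (a - b)) (labels ka) (labels mu)
    = \det (\matrix_(i < k, j < k) g ((ka`[i])%:Z - i%:Z - m j)).
Proof.
move=> sz; rewrite /ldet size_labels sz; congr (\det _).
apply/matrixP => i j; rewrite !mxE !nth_labels ?sz ?sz_mu ?ltn_ord //.
Qed.

(** If z is an x, h is an infinite geometric sum in z; subtracting a multiple of
    the next row truncates it at the length allowed in a horizontal strip. *)
Lemma row_expansion (i : 'I_k) a :
  \sum_(d < n) (if ok i d then power z d else 0) * hF (a - d%:Z)
    = hF' a - (if z.1 then 0 else
        power z (la`[i] - la`[i.+1]).+1 * hF' (a - l i + l i.+1)).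
Proof.
rewrite /ok; case: ifP => zk.
  rewrite subr0 /hF' complete_step_Y // !big_ord_recl big1 => [|d _].
    by rewrite power0 mul1r subr0 /= addr0.
  by rewrite mul0r.
set D := (la`[i] - la`[i.+1])%N.
have /sorted_geqP/(_ i) le_i := dla.
have le_D : (D.+1 <= n)%N.
  have := sorted_geq_nth dla (leq0n i); rewrite nth0 /n /D; clear; lia.
rewrite /hF' (complete_expand_X a D.+1) ?zk // -[RHS]addrA.
have -> : a - D.+1%:Z = a - l i + l i.+1.
  by rewrite /l /D; move: le_i; clear; lia.
rewrite [X in _ = _ + X]subrr addr0.
rewrite (big_ord_widen n (fun e => power z e * hF (a - e%:Z))) //.
rewrite [RHS]big_mkcond; apply: eq_bigr => d _; rewrite ltnS.
by case: ifP; rewrite ?mul0r.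
Qed.

(** The subtractions of multiples of the next row form a unitriangular matrix.
    Under the last row nothing has to be subtracted, because the label -k that
    would come next is smaller than all the labels of mu. *)
Lemma det_row_reduction :
  \det (\matrix_(i < k, j < k) hF' (l i - m j))
   = \det (\matrix_(i < k, j < k)
       \sum_(d < n) (if ok i d then power z d else 0) * hF (l i - m j - d%:Z)).
Proof.
case zk : z.1.
  congr (\det _); apply/matrixP => i j.
  by rewrite !mxE row_expansion zk subr0.
pose p i := power z (la`[i] - la`[i.+1]).+1.
pose T : 'M[series variable]_k :=
  \matrix_(i, j) ((i == j)%:R - (if j == i.+1 :> nat then p i else 0)).
have detT : \det T = 1.
  rewrite -det_tr det_trig.
    apply: big1 => i _; rewrite !mxE eqxx (_ : (i == i.+1 :> nat) = false).
      by rewrite subr0.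
    by apply/negbTE; rewrite neq_ltn ltnSn.
  apply/is_trig_mxP => i j lt_ij; rewrite !mxE.
  have ne1 : (j == i) = false.
    by apply/negbTE; rewrite -val_eqE /=; move: lt_ij; clear; lia.
  have ne2 : (i == j.+1 :> nat) = false.
    by apply/negbTE; move: lt_ij; clear; lia.
  by rewrite ne1 ne2 subrr.
set M := (X in \det X = _); set M2 := (X in _ = \det X).
suff <- : T *m M = M2 by rewrite det_mulmx detT mul1r.
apply/matrixP => i j; rewrite mxE [RHS]mxE row_expansion zk.
have -> : l i - m j - l i + l i.+1 = l i.+1 - m j by clear; lia.
transitivity (\sum_(j0 < k) ((i == j0)%:R * hF' (l j0 - m j)
   - (if j0 == i.+1 :> nat then p i * hF' (l j0 - m j) else 0))).
  apply: eq_bigr => j0 _; rewrite !mxE mulrBl; congr (_ - _).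
  by case: ifP; rewrite ?mul0r.
rewrite sumrB; congr (_ - _).
  rewrite (bigD1 i) //= eqxx mul1r big1 ?addr0 // => j0.
  by rewrite eq_sym => /negPf->; rewrite mul0r.
rewrite -big_mkcond /=; case: (ltnP i.+1 k) => [lt_i|le_i].
  by rewrite (big_pred1 (Ordinal lt_i)).
rewrite big1 => [|j0 /eqP eq_j0]; last first.
  by have := ltn_ord j0; rewrite eq_j0 ltnNge le_i.
rewrite /hF' complete_neg ?raddf0 ?mulr0 //.
rewrite /l nth_default // /m; have := ltn_ord j; move: le_i; clear; lia.
Qed.

Definition dropped (f : {ffun 'I_k -> 'I_n}) : seq nat :=
  [seq (la`[i] - f i)%N | i : 'I_k <- enum 'I_k].

Lemma nth_dropped f (i : 'I_k) : (dropped f)`[i] = (la`[i] - f i)%N.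
Proof. by rewrite (nth_map i) ?size_enum_ord // nth_ord_enum. Qed.

Lemma size_dropped f : size (dropped f) = k.
Proof. by rewrite size_map size_enum_ord. Qed.

Let okf (f : {ffun 'I_k -> 'I_n}) := [forall i : 'I_k, ok i (f i)].
Let inside (f : {ffun 'I_k -> 'I_n}) := [forall i : 'I_k, (f i + mu`[i] <= la`[i])%N].

Lemma drop_decreasing f (i i' : 'I_k) : okf f -> (i < i')%N ->
  l i' <= l i - (f i)%:Z.
Proof.
move=> /forallP/(_ i); rewrite /ok /l => okfi lt_i.
have le1 := sorted_geq_nth dla lt_i; have /sorted_geqP/(_ i) le2 := dla.
by move: okfi le1 le2 lt_i; case: z.1; clear; lia.
Qed.

(** If the row i0 of ka is shorter than that of mu, the rows from i0 on vanish in
    the columns up to i0. *)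
Lemma det_drop_outside f : okf f -> ~~ inside f ->
  \det (\matrix_(i < k, j < k) hF (l i - m j - (f i)%:Z)) = 0.
Proof.
move=> okff /forallPn[i0]; rewrite -ltnNge => lt_i0.
apply: (det_zero_block (i0 := i0)) => i j le_i le_j; rewrite mxE.
rewrite /hF complete_neg ?raddf0 //.
have le_m := sorted_geq_nth dmu le_j.
move: le_i; rewrite leq_eqVlt => /orP[/eqP/val_inj <-|lt_i].
  by rewrite /l /m; move: lt_i0 le_m le_j; clear; lia.
have := drop_decreasing okff lt_i.
by rewrite {2}/l /m; move: (l i) lt_i0 le_m le_j; clear; lia.
Qed.

(** A part of ka smaller than the next one can only differ from it by 1, and then
    the two rows have the same label. *)
Lemma det_drop_unsorted f : okf f -> inside f -> ~~ sorted geq (dropped f) ->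
  \det (\matrix_(i < k, j < k) hF (l i - m j - (f i)%:Z)) = 0.
Proof.
move=> okff /forallP inff nsort.
have [i lt_i] : exists i, ((dropped f)`[i] < (dropped f)`[i.+1])%N.
  apply/not_existsP => dec; case/negP: nsort; apply/sorted_geqP => i.
  by rewrite leqNgt; apply/negP/dec.
have lt_ik : (i.+1 < k)%N.
  by case: (ltnP i.+1 k) lt_i => // le_i; rewrite [X in (_ < X)%N]nth_default ?size_dropped.
pose i0 := Ordinal (ltnW lt_ik); pose i1 := Ordinal lt_ik.
apply: (@det_rows_eq _ _ _ i0 i1) => [|j].
  by rewrite -val_eqE /= neq_ltn ltnSn.
rewrite !mxE; congr hF.
have := drop_decreasing (i := i0) (i' := i1) okff (ltnSn _).
move: lt_i; rewrite (nth_dropped f i0) (nth_dropped f i1) /l /=.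
have := inff i0; have := inff i1; have /sorted_geqP/(_ i) le2 := dla.
by move: le2; clear; lia.
Qed.

Lemma dropped_strip f : okf f -> inside f -> sorted geq (dropped f) ->
  [/\ skew_pair (dropped f) mu, strip_step z.1 la (dropped f)
    & (sumn la - sumn (dropped f))%N = (\sum_i f i)%N].
Proof.
move=> /forallP okff /forallP inff dec.
have nthE i : (i < k)%N -> exists2 i' : 'I_k, i = i' & (dropped f)`[i] = (la`[i] - f i')%N.
  by move=> lt_i; exists (Ordinal lt_i); rewrite // -(nth_dropped f (Ordinal lt_i)).
have out i : (k <= i)%N -> [/\ la`[i] = 0, mu`[i] = 0 & (dropped f)`[i] = 0]%N.
  by move=> le_i; rewrite !nth_default ?size_dropped ?sz_mu.
have spk : skew_pair (dropped f) mu.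
  apply/skew_pairP; rewrite size_dropped; split=> // i.
  case: (ltnP i k) => [/nthE[i' -> ->]|/out[_ -> ->]] //.
  by have := inff i'; clear; lia.
have spl : skew_pair la (dropped f).
  apply/skew_pairP; rewrite size_dropped; split=> // i.
  case: (ltnP i k) => [/nthE[i' -> ->]|/out[-> _ ->]] //.
  exact: leq_subr.
split=> //.
  apply/strip_stepP; split=> // i; have /sorted_geqP/(_ i) le2 := dla.
  case: (ltnP i k) => [/nthE[i' eq_i ->]|/out[la0 _ ->]]; last first.
    by move: le2; rewrite la0; case: z.1.
  by have := okff i'; rewrite /ok -eq_i; move: le2; case: z.1; clear; lia.
rewrite (skew_pair_sum spl) addKn; apply: eq_bigr => i _.
rewrite nth_dropped subKn //; have := inff i; clear; lia.
Qed.

Lemma restrict_jacobi_trudi_step :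
  restrict (predU1 z F) (jacobi_trudi la mu) =
    \sum_(ka <- candidates k (head 0%N la)
       | skew_pair ka mu && strip_step z.1 la ka)
      power z (sumn la - sumn ka)%N * restrict F (jacobi_trudi ka mu).
Proof.
rewrite restrict_jacobi_trudi (ldet_labels hF') // det_row_reduction.
rewrite (det_sum_rows _ (fun i d j => hF (l i - m j - d%:Z))).
pose Q f := [&& okf f, inside f & sorted geq (dropped f)].
pose G ka := power z (sumn la - sumn ka)%N * restrict F (jacobi_trudi ka mu).
transitivity (\sum_(f | Q f) G (dropped f)).
  rewrite [RHS]big_mkcond; apply: eq_bigr => f _; rewrite /Q.
  case: (boolP (okf f)) => [okff|/forallPn[i nok]]; last first.
    by rewrite (bigD1 i) //= (negPf nok) !mul0r.
  case: (boolP (inside f)) => [inff|ninf]; last by rewrite det_drop_outside // mulr0.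
  case: (boolP (sorted _ _)) => [dec|ndec]; last by rewrite det_drop_unsorted // mulr0.
  have [spk _ eq_sum] := dropped_strip okff inff dec.
  rewrite /G eq_sum -power_prod; congr (_ * _).
    by apply: eq_bigr => i _; rewrite (forallP okff).
  rewrite restrict_jacobi_trudi (ldet_labels hF) ?size_dropped //.
  congr (\det _); apply/matrixP => i j; rewrite !mxE nth_dropped; congr hF.
  by have := forallP inff i; rewrite /l; clear; lia.
rewrite -[RHS]big_filter -[LHS]big_filter /index_enum -enumT.
rewrite -[LHS](big_map dropped xpredT G).
apply: perm_big; apply: uniq_perm.
- rewrite map_inj_in_uniq ?filter_uniq -?enumT ?enum_uniq // => f g.
  rewrite !mem_filter => /andP[/and3P[_ /forallP inf1 _] _].
  move=> /andP[/and3P[_ /forallP inf2 _] _] eq_fg.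
  apply/ffunP => i; apply: val_inj; have := congr1 (fun s => s`[i]) eq_fg.
  by rewrite /= !nth_dropped; have := inf1 i; have := inf2 i; clear; lia.
- by rewrite filter_uniq ?candidates_uniq.
move=> ka; apply/mapP/idP => [[f]|].
  rewrite mem_filter => /andP[/and3P[okff inff dec] _] ->.
  have [spk stp _] := dropped_strip okff inff dec.
  rewrite mem_filter spk stp /=; case/strip_stepP: stp => spl _.
  exact: skew_pair_candidate spl (leqnn _).
rewrite mem_filter => /andP[/andP[spk /strip_stepP[spl stp]] _].
have [_ dka szk le1] := skew_pairP _ _ spl.
have [_ _ _ le2] := skew_pairP _ _ spk.
have lt_n i : (la`[i] - ka`[i] < n)%N.
  have := sorted_geq_nth dla (leq0n i); rewrite nth0 /n; clear; lia.
pose f : {ffun 'I_k -> 'I_n} := [ffun i : 'I_k => Ordinal (lt_n i)].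
have eq_ka : ka = dropped f.
  apply: (@eq_from_nth _ 0%N); rewrite ?size_dropped // szk => i lt_i.
  rewrite (nth_dropped f (Ordinal lt_i)) ffunE /= subKn //.
exists f => //.
rewrite mem_filter [X in _ && X](_ : _ = true) ?andbT; last by rewrite unlock mem_enum.
rewrite /Q -eq_ka dka andbT.
apply/andP; split; apply/forallP => i; rewrite ffunE /=.
  have := stp i; have /sorted_geqP/(_ i) := dla; have := le1 i.
  by rewrite /ok; case: z.1; clear; lia.
by have := le1 i; have := le2 i; clear; lia.
Qed.
End JacobiTrudiStep.

(** * The Jacobi-Trudi formula and ribbons *)

Section JacobiTrudiTheorem.
Implicit Types (la mu nu ka : seq nat) (m : {mset variable}) (z : variable).
Local Notation "la `[ i ]" := (nth 0%N la i) (at level 2, format "la `[ i ]").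

Lemma complete0 : complete 0 = 1.
Proof.
apply/funext => m; rewrite completeE -[RHS]/((m == mset0)%:R); congr (_%:R).
have -> : (0 == (size (enum_mset m))%:Z) = (m == mset0).
  rewrite eq_sym -[0]/(0%N%:Z) eqz_nat size_eq0; apply/eqP/eqP => [m0|->].
    by apply/msetP => x; rewrite -count_mem_mset m0 mset0E.
  exact: enum_mset0.
have [->|_] := eqVneq m mset0; last by [].
by rewrite asboolT // => x _; rewrite mset0E.
Qed.

Lemma restrict_none (f : series variable) :
  restrict xpred0 f = fun m => if m == mset0 then f mset0 else 0.
Proof.
apply/funext => m; rewrite restrictE; have [->|neq] := eqVneq m mset0.
  by rewrite enum_mset0.
rewrite ifF //; apply: contra_neqF neq => /all_msetP no.
by apply/msetP => x; apply/eqP; rewrite mset0E mset_eq0; apply/negP => /no.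
Qed.

Lemma restrict_none_complete n : restrict xpred0 (complete n) = (n == 0)%:R.
Proof.
have [->|n_neq0] := eqVneq n 0; first by rewrite complete0 rmorph1.
rewrite restrict_none; apply/funext => m; rewrite completeE enum_mset0.
by rewrite -[0%N%:Z]/(0 : int) (negPf n_neq0) if_same.
Qed.

(** Without variables, h(n) is 1 if n = 0 and 0 otherwise. *)
Lemma jacobi_trudi_base la mu : skew_pair la mu ->
  restrict xpred0 (jacobi_trudi la mu) = (la == mu)%:R.
Proof.
move=> /skew_pairP[dla dmu sz le_mu]; rewrite restrict_jacobi_trudi.
rewrite /ldet size_labels; have [->|neq] := eqVneq la mu.
  rewrite -[RHS](det1 _ (size mu)); congr (\det _); apply/matrixP => i j.
  rewrite !mxE restrict_none_complete !nth_labels //; congr (_%:R).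
  rewrite -val_eqE /=.
  have : (i <= j)%N -> (mu`[j] <= mu`[i])%N by apply: sorted_geq_nth.
  have : (j <= i)%N -> (mu`[i] <= mu`[j])%N by apply: sorted_geq_nth.
  by clear; lia.
have [i0 lt_i0] : exists i, (mu`[i] < la`[i])%N.
  apply/not_existsP => no; case/eqP: neq.
  apply: (@eq_from_nth _ 0%N) => // i _; apply/eqP.
  by rewrite eqn_leq le_mu andbT leqNgt; apply/negP/no.
have lt_ik : (i0 < size la)%N.
  by case: (ltnP i0 (size la)) lt_i0 => // le_i; rewrite [X in (_ < X)%N]nth_default.
rewrite -det_tr; apply: (det_zero_block (i0 := Ordinal lt_ik)) => i j /= le_i le_j.
rewrite !mxE restrict_none_complete !nth_labels ?sz //.
have := sorted_geq_nth dmu le_i; have := sorted_geq_nth dla le_j.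
case: eqP => //; move: lt_i0 le_i le_j; clear; lia.
Qed.

Lemma super_schur_restricted (zs : seq variable) :
    pairwise (fun z x => variable_lt x z) zs ->
  forall la mu, skew_pair la mu ->
    restrict (fun x => x \in zs) (super_schur la mu)
      = restrict (fun x => x \in zs) (jacobi_trudi la mu).
Proof.
elim: zs => [_ la mu sp|z zs IHzs /andP[/allP lt_z pw] la mu sp].
  rewrite -[fun x => _]/(xpred0 : pred variable) jacobi_trudi_base //.
  rewrite restrict_none super_schur0 //; apply/funext => m.
  case: (la == mu); last by rewrite if_same.
  by rewrite -[RHS]/((m == mset0)%:R); case: ifP.
have nz : z \notin zs.
  by apply/negP => /lt_z; rewrite /variable_lt eqxx ltxx andbF orbF; case: z.1.
rewrite -[fun x => _]/(predU1 z (fun x => x \in zs) : pred variable).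
rewrite restrict_super_step // restrict_jacobi_trudi_step //.
by apply: eq_bigr => ka /andP[spk _]; rewrite IHzs.
Qed.

(** The largest variable comes first, as required by the induction of
    [super_schur_restricted]. *)
Lemma variable_enum (s : seq variable) : exists2 zs,
  pairwise (fun z x => variable_lt x z) zs & {subset s <= zs}.
Proof.
pose ge (x y : variable) := (x == y) || variable_lt y x.
have lt_tot x y : (x == y) || variable_lt y x || variable_lt x y.
  case: x y => [x1 x2] [y1 y2]; rewrite /variable_lt -pair_eqE /= /pair_eq /=.
  by case: x1; case: y1 => //=; case: ltgtP.
have ge_total : total ge.
  move=> x y; have := lt_tot x y; rewrite /ge eq_sym.
  by case: (y == x) => //=.
have ge_trans : transitive ge.
  move=> [y1 y2] [x1 x2] [z1 z2]; rewrite /ge /variable_lt -!pair_eqE /= /pair_eq /=.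
  by case: x1; case: y1; case: z1 => //=; clear; lia.
exists (sort ge (undup s)); last by move=> x xs; rewrite mem_sort mem_undup.
have := sort_sorted ge_total (undup s); rewrite (sorted_pairwise ge_trans).
have := undup_uniq s; rewrite -(sort_uniq ge) uniq_pairwise => u p.
have : pairwise [rel x y | (x != y) && ge x y] (sort ge (undup s)).
  by rewrite pairwise_relI u p.
by apply: sub_pairwise => x y /=; rewrite /ge; case: (x == y).
Qed.

(** A coefficient only sees the variables that occur in its monomial. *)
Theorem super_jacobi_trudi la mu : skew_pair la mu ->
  super_schur la mu = jacobi_trudi la mu.
Proof.
move=> sp; apply/funext => m.
have [zs pw sub] := variable_enum (enum_mset m).
have allm : all (fun x => x \in zs) (enum_mset m) by apply/allP.
have := congr1 (fun f => f m) (super_schur_restricted pw sp).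
by rewrite /= !restrictE allm.
Qed.
End JacobiTrudiTheorem.

Section Ribbons.
Implicit Types (la mu : seq nat) (w : seq bool).
Local Notation "la `[ i ]" := (nth 0%N la i) (at level 2, format "la `[ i ]").

Definition ribbon_schur w : series variable :=
  super_schur (ribbon w).1 (ribbon w).2.

(** The inequality b < a says that the top row is not empty; the next step needs
    it, as going up sets the new row over the last box of the top row. *)
Lemma ribbonP w : exists a b la mu, [/\ ribbon w = (a :: la, b :: mu),
  (b < a)%N & skew_pair (a :: la) (b :: mu)].
Proof.
elim/last_ind: w => [|w up [a [b [la [mu [eq_w lt_ba sp]]]]]].
  by exists 1%N, 0%N, [::], [::].
rewrite /ribbon -cats1 foldl_cat -/(ribbon w) eq_w /extend_ribbon /=.
have /and3P[/= pla pmu all_le] := sp.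
case: up.
  exists a, a.-1, (a :: la), (b :: mu); split=> //.
    by move: lt_ba; clear; lia.
  apply/and3P; split; rewrite /= ?pla ?pmu ?andbT //.
  - by move: lt_ba; clear; rewrite /geq /=; lia.
  - by move: lt_ba all_le; clear; rewrite /=; case: (all2 _ _ _); lia.
exists a.+1, b, la, mu; split=> //; first exact: ltnW.
apply/and3P; split=> //=.
  by case: (la) pla => //= c s /andP[le_ca ->]; rewrite andbT (leq_trans le_ca).
by move: all_le; rewrite /= => /andP[le_ba ->]; rewrite andbT leqW.
Qed.

Lemma ribbon_right w n a la mu : ribbon w = (a :: la, mu) ->
  ribbon (w ++ nseq n false) = ((a + n)%N :: la, mu).
Proof.
move=> eq_w; rewrite /ribbon foldl_cat -/(ribbon w) eq_w {eq_w w}.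
elim: n a => [|n IHn] a; first by rewrite addn0.
by rewrite /= IHn addSnnS.
Qed.

Lemma ribbon_up w a la mu : ribbon w = (a :: la, mu) ->
  ribbon (rcons w true) = (a :: a :: la, a.-1 :: mu).
Proof. by move=> eq_w; rewrite /ribbon -cats1 foldl_cat -/(ribbon w) eq_w. Qed.

Lemma labels_cons x la : labels (x :: la) = x%:Z :: [seq y - 1 | y <- labels la].
Proof.
rewrite /labels /= subr0; congr (_ :: _); rewrite -map_comp.
rewrite -[1%N]/(1 + 0)%N iotaDl -map_comp; apply: eq_map => i /=.
by rewrite PoszD opprD addrA addrAC.
Qed.

Lemma ldet_shift (A : comNzRingType) (g : int -> A) c rs cs : size rs = size cs ->
  ldet (fun a b => g (a - b)) [seq y - c | y <- rs] [seq y - c | y <- cs]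
    = ldet (fun a b => g (a - b)) rs cs.
Proof.
move=> sz; rewrite /ldet size_map; congr (\det _).
apply/matrixP => i j; rewrite !mxE !(nth_map 0) -?sz //.
by congr g; rewrite opprB addrA subrK.
Qed.

(** Laplace expansion along a column whose entries vanish below the second row. *)
Lemma ldet_two_in_column (A : comNzRingType) (g : int -> int -> A) x y z rs cs :
    (forall a, a \in rs -> g a z = 0) ->
  ldet g (x :: y :: rs) (z :: cs)
    = g x z * ldet g (y :: rs) cs - g y z * ldet g (x :: rs) cs.
Proof.
move=> g0; rewrite /ldet (expand_det_col _ ord0) /= !big_ord_recl big1 => [|i _].
  rewrite addr0 !mxE /=; congr (_ * _ + _).
    rewrite /cofactor expr0 mul1r; congr (\det _).
    by apply/matrixP => i j; rewrite !mxE /=.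
  rewrite /cofactor /= expr1 mulN1r mulrN; congr (- (_ * \det _)).
  by apply/matrixP => -[[|i] lt_i] j; rewrite !mxE /= ?add0n.
by rewrite !mxE /= g0 ?mul0r //; apply: mem_nth; apply: ltn_ord.
Qed.

Lemma ribbon_schur_right n : ribbon_schur (nseq n false) = complete n.+1.
Proof.
rewrite /ribbon_schur (@ribbon_right [::] n 1%N [::] [:: 0%N]) //= add1n.
rewrite super_jacobi_trudi /jacobi_trudi /labels /ldet //=.
by rewrite det_mx11 mxE /= !subr0.
Qed.

(** In the first column of the Jacobi-Trudi determinant of the left-hand side, the
    top entry is h(n+1), the second one is h(0) = 1 and the others vanish since
    their index is negative.  The minor of the first entry is the determinant
    of w, that of the second one is the determinant of w followed by n+1 steps
    to the right. *)
Lemma ribbon_schur_up w n :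
  ribbon_schur (w ++ true :: nseq n false)
    = ribbon_schur w * complete n.+1 - ribbon_schur (w ++ nseq n.+1 false).
Proof.
have [a [b [la [mu [eq_w lt_ba sp]]]]] := ribbonP w.
have [a1 [b1 [la1 [mu1 [eq1 _ sp1]]]]] := ribbonP (w ++ true :: nseq n false).
have [a2 [b2 [la2 [mu2 [eq2 _ sp2]]]]] := ribbonP (w ++ nseq n.+1 false).
rewrite /ribbon_schur eq1 eq2 eq_w /= !super_jacobi_trudi //.
move: eq1 eq2; rewrite -cat_rcons (ribbon_right _ (ribbon_up eq_w)).
rewrite (ribbon_right _ eq_w) => -[<- <- <- <-] [<- <- <- <-].
move=> {sp1 sp2 a1 b1 la1 mu1 a2 b2 la2 mu2}.
have sz : size mu = size la by case/skew_pairP: sp => _ _ [].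
pose g (x y : int) := complete (x - y).
rewrite /jacobi_trudi.
have eqL : [seq y - 1 | y <- labels (a :: la)]
    = a%:Z - 1 :: [seq y - 1 | y <- [seq y - 1 | y <- labels la]].
  by rewrite labels_cons.
have a1 : (a.-1)%:Z = a%:Z - 1 by move: lt_ba; clear; lia.
rewrite {1}labels_cons eqL labels_cons.
rewrite (ldet_two_in_column (g := g)); last first.
  move=> c /mapP[_ /mapP[_ /mapP[i _ ->] ->] ->]; apply: complete_neg.
  have /skew_pairP[/sorted_geq_nth/(_ (leq0n i.+1)) /=] := sp.
  by rewrite a1; clear; lia.
have g1 : g (a%:Z - 1) (a.-1)%:Z = 1 by rewrite /g a1 subrr complete0.
rewrite g1 mul1r -eqL.
congr (_ - _).
  rewrite mulrC (ldet_shift complete) ?size_labels /= ?sz //; congr (_ * _).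
  by rewrite /g; congr complete; move: lt_ba; clear; lia.
rewrite -(ldet_shift complete 1); last by rewrite !size_labels /= sz.
congr (ldet _ _ _); rewrite labels_cons /=; congr (_ :: _).
by clear; lia.
Qed.
End Ribbons.

(** * Turning one diagonal of the cutting strip *)

Section CuttingMatrix.
Variable phi : int -> bool.
Implicit Types (c a f : int).

(** The word of the cutting strip from the content a on, for the directions
    phi on the contents less than c and right on the others. *)
Definition letters c a n : seq bool :=
  [seq phi (a + x%:Z) && (a + x%:Z < c) | x <- iota 0 n].

(** The matrix S: its columns are labelled by one more than the content of the
    last box, so that the empty strip is on the diagonal. *)
Definition segment c a f : series variable :=
  if f < a then 0 else if f == a then 1
  else ribbon_schur (letters c a `|f - a|%N.-1).

Lemma segment_lt c a f : f < a -> segment c a f = 0.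
Proof. by rewrite /segment => ->. Qed.

Lemma segmentxx c a : segment c a a = 1.
Proof. by rewrite /segment ltxx eqxx. Qed.

Lemma segment_gt c a n : segment c a (a + n.+1%:Z) = ribbon_schur (letters c a n).
Proof.
rewrite /segment ifF; last by apply/negbTE; clear; lia.
rewrite ifF; last by apply/negbTE; clear; lia.
by congr (ribbon_schur (letters _ _ _)); clear; lia.
Qed.

Lemma eq_letters c c' a n :
    (forall x, (x < n)%N -> phi (a + x%:Z) && (a + x%:Z < c)
        = phi (a + x%:Z) && (a + x%:Z < c')) ->
  letters c a n = letters c' a n.
Proof. by move=> eqx; apply/eq_in_map => x; rewrite mem_iota => /eqx. Qed.

Lemma eq_segment c c' a f :
    (forall x, (a <= x)%R -> x + 1 < f -> phi x && (x < c) = phi x && (x < c')) ->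
  segment c a f = segment c' a f.
Proof.
move=> eqx; rewrite /segment; case: ltP => // le_af; case: eqP => // neq.
congr ribbon_schur; apply: eq_letters => x lt_x; apply: eqx.
  by clear; lia.
by move: lt_x le_af neq; clear; lia.
Qed.

Lemma letters_right c a n : c <= a -> letters c a n = nseq n false.
Proof.
move=> le_ca; rewrite /letters; apply: (@eq_from_nth _ false).
  by rewrite size_map size_iota size_nseq.
move=> x; rewrite size_map size_iota => lt_x.
rewrite (nth_map 0%N) ?size_iota // nth_iota // nth_nseq lt_x add0n.
by apply/negbTE; rewrite negb_and; apply/orP; right; move: le_ca; clear; lia.
Qed.

Lemma segment_complete c a f : c <= a -> segment c a f = complete (f - a).
Proof.
move=> le_ca; case: (ltrgtP f a) => [lt_fa|lt_af|->].
- by rewrite segment_lt // complete_neg //; move: lt_fa; clear; lia.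
- have -> : f = a + `|f - a|%N.-1.+1%:Z by move: lt_af; clear; lia.
  rewrite segment_gt letters_right // ribbon_schur_right; congr complete.
  by clear; lia.
by rewrite segmentxx subrr complete0.
Qed.

Lemma segment_straight c : ~~ phi c -> segment (c + 1) =2 segment c.
Proof.
move=> nphi a f; apply: eq_segment => x _ _; case: (x =P c) => [->|/eqP neq].
  by rewrite (negPf nphi).
by congr andb; move: neq; clear; lia.
Qed.

(** The ribbon relation at the box of content c. *)
Lemma segment_turn c a f : phi c -> a <= c -> c + 1 < f ->
  segment (c + 1) a f
    = segment c a (c + 1) * segment c (c + 1) f - segment c a f.
Proof.
move=> phic le_ac lt_cf.
have [d def_c] : exists d : nat, c = a + d%:Z.
  by exists `|c - a|%N; move: le_ac; clear; lia.
have [n def_f] : exists n : nat, f = c + 1 + n.+1%:Z.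
  by exists `|(f - c - 1)%R|%N.-1; move: lt_cf; clear; lia.
have ef : f = a + (d + n.+1)%N.+1%:Z by rewrite def_f def_c; clear; lia.
rewrite (segment_complete _ (a := c + 1)); last by clear; lia.
have er : c + 1 = a + d.+1%:Z by rewrite def_c; clear; lia.
rewrite {2}er ef !segment_gt.
have -> : a + (d + n.+1)%N.+1%:Z - (c + 1) = n.+1 by rewrite def_c; clear; lia.
have -> : letters (c + 1) a (d + n.+1) = letters c a d ++ true :: nseq n false.
  rewrite /letters iotaD map_cat /= add0n -def_c phic.
  have -> : c < c + 1 by clear; lia.
  congr (_ ++ true :: _); first by apply: eq_letters => x lt_x;
    congr andb; rewrite def_c; move: lt_x; clear; lia.
  apply: (@eq_from_nth _ false); rewrite size_map size_iota ?size_nseq //.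
  move=> x lt_x; rewrite (nth_map 0%N) ?size_iota // nth_iota // nth_nseq lt_x.
  by apply/negbTE; rewrite negb_and; apply/orP; right; rewrite def_c; clear; lia.
have -> : letters c a (d + n.+1) = letters c a d ++ nseq n.+1 false.
  rewrite /letters iotaD map_cat; congr (_ ++ _).
  apply: (@eq_from_nth _ false); rewrite size_map size_iota ?size_nseq //.
  move=> x lt_x; rewrite (nth_map 0%N) ?size_iota // nth_iota // nth_nseq lt_x.
  by apply/negbTE; rewrite negb_and; apply/orP; right; rewrite def_c; clear; lia.
exact: ribbon_schur_up.
Qed.

Section Turn.
Variable c : int.
Hypothesis phic : phi c.
Local Notation r := (c + 1).
Local Notation w := (segment c).
Local Notation w' := (segment (c + 1)).

(** Conjugating by these signs turns the ribbon relation into a pivot. *)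
Definition side (x : int) : series variable := if r <= x then -1 else 1.

Lemma sideK x : side x * side x = 1.
Proof. by rewrite /side; case: ifP => _; rewrite ?mulr1 ?mulrNN ?mulr1. Qed.

Definition pivoted a f : series variable := side a * w' a f * side f.

Lemma segment_pivoted a f : w' a f = side a * pivoted a f * side f.
Proof.
rewrite /pivoted; have := sideK a; have := sideK f.
move: (side a) (side f) (w' a f) => x y v yy xx.
by transitivity ((x * x) * v * (y * y)); [rewrite xx yy mul1r mulr1|ring].
Qed.

Lemma pivoted_rr : pivoted r r = 1.
Proof. by rewrite /pivoted segmentxx mulr1 sideK. Qed.

Lemma pivoted_row f : f != r -> pivoted r f = w r f.
Proof.
move=> neq_f; rewrite /pivoted; case: (ltP f r) => [lt_fr|le_rf].
  by rewrite !segment_lt // mulr0 mul0r.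
rewrite /side lexx le_rf !segment_complete; last 1 first.
- by clear; lia.
- by rewrite mulN1r mulrN1 opprK.
by clear; lia.
Qed.

Lemma pivoted_col a : a != r -> pivoted a r = - w a r.
Proof.
move=> neq_a; rewrite /pivoted; case: (ltP r a) => [lt_ra|le_ar].
  by rewrite !segment_lt // mulr0 mul0r oppr0.
have n_ra : (r <= a) = false by move: neq_a le_ar; clear; lia.
rewrite /side lexx n_ra mul1r mulrN1; congr (- _); apply: eq_segment => x _ lt_x.
by congr andb; move: lt_x; clear; lia.
Qed.

(** The only substantial case is a < r < f, which is [segment_turn]; in the
    others the product vanishes and the two segments do not see the turn. *)
Lemma pivotedE a f : a != r -> f != r ->
  pivoted a f = w a f - w a r * w r f.
Proof.
move=> neq_a neq_f; rewrite /pivoted /side.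
case: (ltP r a) => [lt_ra|le_ar].
  rewrite (segment_lt c lt_ra) mul0r subr0 (ltW lt_ra).
  case: (ltP f r) => [lt_fr|le_rf].
    by rewrite !segment_lt ?mulr0 ?mul0r //; apply: lt_trans lt_ra.
  rewrite mulN1r mulrN1 opprK; apply: eq_segment => x le_ax _.
  by congr andb; move: le_ax lt_ra; clear; lia.
have n_ra : (r <= a) = false by move: neq_a le_ar; clear; lia.
rewrite n_ra mul1r; case: (ltP f r) => [lt_fr|le_rf].
  rewrite (segment_lt c lt_fr) mulr0 subr0 mulr1; apply: eq_segment => x _ lt_x.
  by congr andb; move: lt_x lt_fr; clear; lia.
rewrite mulrN1 segment_turn // ?opprB //.
  by move: n_ra; clear; lia.
by move: neq_f le_rf; clear; lia.
Qed.

Lemma prod_side (s : seq int) :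
  \prod_(x <- s) side x = (-1) ^+ count (fun x : int => r <= x) s.
Proof.
elim: s => [|x s IHs] /=; first by rewrite big_nil.
by rewrite big_cons exprD IHs {1}/side; case: (r <= x).
Qed.

(** The number k is half the total number of changes of sign on both sides. *)
Lemma sign_parity (R : pzRingType) k n n' (x : R) : (n + n' = k + k)%N ->
  (-1) ^+ n * x = (-1) ^+ n' * x.
Proof.
move=> /(congr1 odd); rewrite !oddD addbb => eq_n.
by rewrite -[in LHS]signr_odd -[in RHS]signr_odd -[odd n](addbK (odd n')) eq_n.
Qed.

Lemma ldet_pivoted rs cs : size rs = size cs ->
  ldet w' rs cs
    = (-1) ^+ (count (fun x : int => (r <= x)%R) rs
        + count (fun x : int => (r <= x)%R) cs)%N
      * ldet pivoted rs cs.
Proof.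
move=> sz; rewrite exprD -!prod_side; apply: etrans (ldet_scale side side pivoted sz).
by apply: (eq_ldet sz) => a f _ _; apply: segment_pivoted.
Qed.

(** P and Q are the starts and the ends of the strips that end before the
    diagonal c; A lists the starts of the strips that cross it, from top left to
    bottom right; G and H are the starts and the ends of the later rows.  There
    are four cases, according to whether one of the numbers m_j and whether one
    of the numbers l_i equals r = c + 1.  Turning up makes the strips of A climb
    by one row, so that a strip starts at r when no row ends there, and the
    first strip of A ends when no row starts there. *)
Variables (P Q A G H : seq int).
Hypothesis szPQ : size P = size Q.
Hypothesis P_lt : all (fun x => x < r) P.
Hypothesis Q_lt : all (fun x => x < r) Q.
Hypothesis A_lt : all (fun x => x < r) A.
Hypothesis G_gt : all (fun x => r < x) G.
Hypothesis H_gt : all (fun x => r < x) H.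

Let nin_lt (s : seq int) : all (fun x => x < r) s -> r \notin s.
Proof. by move=> /allP lts; apply/negP => /lts; rewrite ltxx. Qed.
Let nin_gt (s : seq int) : all (fun x => r < x) s -> r \notin s.
Proof. by move=> /allP lts; apply/negP => /lts; rewrite ltxx. Qed.

Let nin_rows : r \notin P ++ G ++ A.
Proof. by rewrite !mem_cat !negb_or (nin_lt P_lt) (nin_lt A_lt) (nin_gt G_gt). Qed.
Let nin_cols : r \notin Q ++ H.
Proof. by rewrite mem_cat negb_or (nin_lt Q_lt) (nin_gt H_gt). Qed.

Let count_lt (s : seq int) : all (fun x => x < r) s -> count (fun x : int => r <= x) s = 0%N.
Proof.
move=> /allP lts; apply/eqP; rewrite -leqn0 leqNgt -has_count.
by apply/hasPn => x /lts; rewrite ltNge.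
Qed.
Let count_gt (s : seq int) : all (fun x => r < x) s -> count (fun x : int => r <= x) s = size s.
Proof. by move=> gts; apply/eqP; rewrite -all_count; apply: sub_all gts => x /ltW. Qed.

Let countE := (count_lt P_lt, count_lt Q_lt, count_lt A_lt, count_gt G_gt,
  count_gt H_gt).

Lemma turn_start_end : (size G + size A = size H)%N ->
  ldet w (P ++ G ++ r :: A) (Q ++ rcons H r) = ldet w' (P ++ G ++ A) (Q ++ H).
Proof.
move=> sz; rewrite catA ldet_row_move -cats1 catA ldet_col_move; last first.
  by rewrite /= !size_cat /=; move: sz szPQ; clear; lia.
rewrite cats0 -catA (pivot_in_in (segmentxx c r) pivotedE) //; last first.
  by rewrite !size_cat; move: sz szPQ; clear; lia.
rewrite ldet_pivoted; last by rewrite !size_cat; move: sz szPQ; clear; lia.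
rewrite mulrA -exprD; apply: (sign_parity (k := (size P + size G + size H)%N)).
rewrite !count_cat !countE !size_cat.
by move: szPQ; clear; lia.
Qed.

Lemma turn_end_start a : a < r -> (size H = (size G + size A).+1)%N ->
  ldet w (P ++ G ++ a :: A) (Q ++ H)
    = ldet w' ((a :: P) ++ G ++ rcons A r) ((r :: Q) ++ H).
Proof.
move=> lt_a sz; have neq_a : r != a by rewrite gt_eqF.
rewrite catA ldet_row_move -catA.
rewrite -cats1 2![in RHS]catA ldet_row_move cats0 [in RHS]ldet_pivoted; last first.
  by rewrite /= !size_cat /= ?size_cat; move: sz szPQ; clear; lia.
rewrite /= (pivot_out_out pivoted_rr pivoted_row pivoted_col pivotedE); last 3 first.
- by rewrite /= !size_cat; move: sz szPQ; clear; lia.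
- by rewrite inE negb_or neq_a -catA.
- exact: nin_cols.
rewrite -catA mulrA -exprD; apply: (sign_parity (k := (size P + size G + size G + size A + 2)%N)).
rewrite /= !count_cat !countE lexx leNgt lt_a !size_cat.
by move: sz szPQ; clear; lia.
Qed.

Lemma turn_start : (size H = (size G + size A).+1)%N ->
  ldet w (P ++ G ++ r :: A) (Q ++ H) = ldet w' (P ++ G ++ rcons A r) (Q ++ H).
Proof.
move=> sz; rewrite catA ldet_row_move -catA.
rewrite -cats1 2![in RHS]catA ldet_row_move cats0 -catA [in RHS]ldet_pivoted; last first.
  by rewrite /= !size_cat /= ?size_cat; move: sz szPQ; clear; lia.
rewrite (pivot_in_out pivoted_row pivotedE) //; last first.
  by rewrite /= !size_cat; move: sz szPQ; clear; lia.
rewrite mulrA -exprD; apply: (sign_parity (k := (size P + size G + size G + size A + 1)%N)).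
rewrite /= !count_cat !countE lexx !size_cat.
by move: sz szPQ; clear; lia.
Qed.

Lemma turn_end a : a < r -> (size H = size G + size A)%N ->
  ldet w (P ++ G ++ a :: A) (Q ++ rcons H r)
    = ldet w' ((a :: P) ++ G ++ A) ((r :: Q) ++ H).
Proof.
move=> lt_a sz; have neq_a : r != a by rewrite gt_eqF.
rewrite catA ldet_row_move -catA -cats1 (catA Q) ldet_col_move; last first.
  by rewrite /= !size_cat /=; move: sz szPQ; clear; lia.
rewrite cats0 [in RHS]ldet_pivoted; last first.
  by rewrite /= !size_cat /= ?size_cat; move: sz szPQ; clear; lia.
rewrite /= (pivot_out_in pivoted_col pivotedE); last 3 first.
- by rewrite /= !size_cat; move: sz szPQ; clear; lia.
- by rewrite inE negb_or neq_a.
- exact: nin_cols.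
rewrite [RHS]mulrN -[RHS]mulN1r [RHS]mulrA -exprS mulrA -exprD.
apply: (sign_parity (k := (size P + size G + size H + 1)%N)).
rewrite /= !count_cat !countE lexx leNgt lt_a !size_cat.
by move: sz szPQ; clear; lia.
Qed.
End Turn.
End CuttingMatrix.

(** * Strips and connected diagrams *)

Section Geometry.
Implicit Types (la mu : seq nat) (D B th : {fset box}) (b c d e : box).
Local Notation "la `[ i ]" := (nth 0%N la i) (at level 2, format "la `[ i ]").

Lemma content_box_at i j : content (box_at i j) = j%:Z - i%:Z.
Proof. by rewrite /content /=; clear; lia. Qed.

Lemma content_right b : content (right_of b) = content b + 1.
Proof. by rewrite /content /=; clear; lia. Qed.
Lemma content_above b : content (above b) = content b + 1.
Proof. by rewrite /content /=; clear; lia. Qed.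
Lemma content_left b : content (left_of b) = content b - 1.
Proof. by rewrite /content /=; clear; lia. Qed.
Lemma content_below b : content (below b) = content b - 1.
Proof. by rewrite /content /=; clear; lia. Qed.

Lemma right_ofK : cancel right_of left_of.
Proof. by case=> i j; congr pair => /=; clear; lia. Qed.
Lemma left_ofK : cancel left_of right_of.
Proof. by case=> i j; congr pair => /=; clear; lia. Qed.
Lemma aboveK : cancel above below.
Proof. by case=> i j; congr pair => /=; clear; lia. Qed.
Lemma belowK : cancel below above.
Proof. by case=> i j; congr pair => /=; clear; lia. Qed.

Lemma right_of_box_at i j : right_of (box_at i j) = box_at i j.+1.
Proof. by congr pair => /=; clear; lia. Qed.
Lemma below_box_at i j : below (box_at i j) = box_at i.+1 j.
Proof. by congr pair => /=; clear; lia. Qed.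

Lemma diagram_convex la mu i j i' j' i2 j2 : skew_pair la mu ->
    box_at i j \in diagram la mu -> box_at i' j' \in diagram la mu ->
    (i <= i2 <= i')%N -> (j <= j2 <= j')%N ->
  box_at i2 j2 \in diagram la mu.
Proof.
case/skew_pairP=> dla dmu _ _; rewrite !in_diagram => h h' /andP[l1 l2] /andP[l3 l4].
have := sorted_geq_nth dla l2; have := sorted_geq_nth dmu l1.
by move: h h' l3 l4; clear; lia.
Qed.

Lemma adjacent_sym : symmetric adjacent.
Proof.
move=> b c; rewrite /adjacent !inE; apply/idP/idP.
  by case/or4P=> /eqP->; rewrite ?right_ofK ?left_ofK ?aboveK ?belowK eqxx ?orbT.
by case/or4P=> /eqP->; rewrite ?right_ofK ?left_ofK ?aboveK ?belowK eqxx ?orbT.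
Qed.

Lemma linked_sym D : symmetric (@linked D).
Proof. by apply: sym_connect_sym => b c; rewrite /= adjacent_sym. Qed.

Lemma adjacent_step b c : adjacent b c -> content b < content c ->
  c = right_of b \/ c = above b.
Proof.
rewrite /adjacent !inE => /or4P[]/eqP->; [by left| |by right|].
  by rewrite content_left; clear; lia.
by rewrite content_below; clear; lia.
Qed.

(** Contents change by 1 along a path, which gives an intermediate value
    property. *)
Lemma linked_crossing D (b c : D) x : linked b c ->
    content (val b) <= x < content (val c) ->
  exists d e : D, [/\ linked b d, linked b e, content (val d) = x,
    content (val e) = x + 1 & val e = right_of (val d) \/ val e = above (val d)].
Proof.
case/connectP=> p; elim: p b => [|b' p IHp] b /=.
  by move=> _ ->; clear; lia.
case/andP=> adj path_p def_c /andP[le_bx lt_xc].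
have lbb' : linked b b' by apply: connect1.
case: (leP (content (val b')) x) => [le_b'|lt_b'].
  have [|d [e [l1 l2 cd ce de]]] := IHp b' path_p def_c; first by rewrite le_b'.
  by exists d, e; split=> //; apply: (connect_trans lbb').
have lt_bb' : content (val b) < content (val b') by apply: le_lt_trans lt_b'.
have := adjacent_step adj lt_bb' => eq_b'.
have ct : content (val b') = content (val b) + 1.
  by case: eq_b' => e; rewrite /= e ?content_right ?content_above.
exists b, b'; split; [exact: connect0|exact: lbb'| | |exact: eq_b'].
  by move: ct le_bx lt_b' => /=; clear; lia.
by move: ct le_bx lt_b' => /=; clear; lia.
Qed.

(** Follow the row of the first box, then the column of the second one. *)
Lemma linked_comparable la mu i j i' j' (D := diagram la mu)
    (bD : box_at i j \in D) (cD : box_at i' j' \in D) : skew_pair la mu ->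
  (i <= i')%N -> (j <= j')%N -> linked [` bD] [` cD].
Proof.
move=> sp le_i le_j.
have row n : forall (j2 : nat) (eD : box_at i j2 \in D), j2 = (j + n)%N ->
    (j2 <= j')%N -> linked [` bD] [` eD].
  elim: n => [|n IHn] j2 eD ej le_j2.
    have -> : [` eD] = [` bD] by apply: val_inj => /=; rewrite ej addn0.
    exact: connect0.
  have dD : box_at i (j + n) \in D.
    apply: (diagram_convex sp bD cD); first by rewrite leqnn.
    by move: le_j2; rewrite ej; clear; lia.
  apply: (connect_trans (IHn _ dD erefl _)); first by move: le_j2; rewrite ej; clear; lia.
  apply: connect1; rewrite /adjacent /= !inE right_of_box_at ej addnS.
  by rewrite eqxx.
have eD : box_at i j' \in D.
  by apply: (diagram_convex sp bD cD); rewrite ?leqnn ?le_i ?le_j.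
apply: (connect_trans (row (j' - j)%N j' eD _ (leqnn _))); first by rewrite subnKC.
have col n : forall (i2 : nat) (dD : box_at i2 j' \in D), i2 = (i + n)%N ->
    (i2 <= i')%N -> linked [` eD] [` dD].
  elim: n => [|n IHn] i2 dD ei le_i2.
    have -> : [` dD] = [` eD] by apply: val_inj => /=; rewrite ei addn0.
    exact: connect0.
  have fD : box_at (i + n) j' \in D.
    apply: (diagram_convex sp bD cD); last by rewrite le_j leqnn.
    by move: le_i2; rewrite ei; clear; lia.
  apply: (connect_trans (IHn _ fD erefl _)); first by move: le_i2; rewrite ei; clear; lia.
  apply: connect1; rewrite /adjacent /= !inE below_box_at ei addnS.
  by rewrite eqxx !orbT.
by apply: (col (i' - i)%N); rewrite ?subnKC.
Qed.

(** Two boxes on the same diagonal or on consecutive ones are comparable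
    coordinatewise, either in this order or in the opposite one. *)
Lemma linked_close la mu (D := diagram la mu) (b c : D) : skew_pair la mu ->
  content (val b) <= content (val c) <= content (val b) + 1 -> linked b c.
Proof.
move=> sp; case: b c => [b bD] [c cD] /=.
case/diagramP: (bD) => i [j [eb _]]; case/diagramP: (cD) => i' [j' [ec _]].
subst b c; rewrite !(content_box_at i j, content_box_at i' j') => h.
case: (leqP i i') => [le_i|/ltnW le_i].
  apply: (linked_comparable _ _ sp le_i); move: h le_i; clear; lia.
rewrite linked_sym; case: (leqP j' j) => [le_j|lt_j].
  exact: (linked_comparable _ _ sp le_i le_j).
have ei : i' = i by move: h le_i lt_j; clear; lia.
move: cD h; rewrite ei => cD h; rewrite linked_sym.
exact: (linked_comparable _ _ sp (leqnn _) (ltnW lt_j)).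
Qed.

Section Strip.
Variable th : {fset box}.
Hypothesis stripT : is_strip th.

(** Two boxes of a strip on the same diagonal would enclose a square. *)
Lemma strip_content_inj : {in th &, injective content}.
Proof.
case: stripT => _ [la [mu [sp eth]]] _ nosq.
have aux b c : b \in th -> c \in th -> content b = content c -> b.1 < c.1 -> False.
  move=> bT cT ec lt_bc; case/negP: nosq; apply/existsP; exists [` bT] => /=.
  have bD : b \in diagram la mu by rewrite -eth.
  have cD : c \in diagram la mu by rewrite -eth.
  move: ec lt_bc; rewrite eth {bT cT}.
  have := cD; have := bD; case/diagramP: bD => i [j [-> _]] bD.
  case/diagramP: cD => i' [j' [-> _]] cD.
  rewrite (content_box_at i j) (content_box_at i' j') /= ltz_nat ltnS => ec lt_i.
  have lt_j : (j < j')%N by move: ec lt_i; clear; lia.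
  rewrite (right_of_box_at i j) (below_box_at i j) (right_of_box_at i.+1 j).
  by apply/and3P; split; apply: (diagram_convex sp bD cD);
    move: lt_i lt_j; clear; lia.
move=> b c bT cT ec; have := aux b c bT cT ec; have := aux c b cT bT (esym ec).
case: b c ec {bT cT} => [b1 b2] [c1 c2]; rewrite /content /= => ec n1 n2.
case: (ltgtP b1 c1) => [/n2|/n1|e1] //; congr pair => //.
by move: ec e1; clear; lia.
Qed.

Lemma strip_crossing b c : b \in th -> c \in th -> content b < content c ->
  exists2 e, e \in th & content e = content b + 1 /\ (e = right_of b \/ e = above b).
Proof.
move=> bT cT lt_bc; have [_ _ /forallP/(_ [` bT])/forallP/(_ [` cT]) lnk _] := stripT.
have [|[d dT] [[e eT] [_ _ /= cd ce de]]] := linked_crossing lnk (x := content b).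
  by rewrite /= lexx.
by have <- := strip_content_inj dT bT cd; exists e; rewrite // cd.
Qed.

Let s := strip_boxes th.

Lemma mem_strip_boxes : s =i th.
Proof. by move=> b; rewrite mem_sort. Qed.

Lemma strip_boxes_sorted : sorted (fun b c => content b < content c) s.
Proof.
have u : uniq s by rewrite sort_uniq fset_uniq.
have := sort_sorted (fun b c : box => le_total (content b) (content c)) (enum_fset th).
rewrite -/s.
have trle : transitive (fun b c : box => content b <= content c).
  by move=> ? ? ?; apply: le_trans.
have trlt : transitive (fun b c : box => content b < content c).
  by move=> ? ? ?; apply: lt_trans.
rewrite (sorted_pairwise trle) (sorted_pairwise trlt).
move=> pw; have : pairwise [rel b c | (b != c) && (content b <= content c)] s.
  by rewrite pairwise_relI -uniq_pairwise u pw.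
move=> pw'; apply: (@sub_in_pairwise _ (mem s) _ _ _ s _ pw'); last exact/allP.
move=> b c bs cs /= /andP[neq le_bc].
rewrite lt_neqAle le_bc andbT; apply: contra_neq neq; apply: strip_content_inj.
  by rewrite -mem_strip_boxes.
by rewrite -mem_strip_boxes.
Qed.

Lemma strip_boxes_nil : s != [::].
Proof.
case: stripT => /fset0Pn[b bT] _ _ _; apply/eqP => s0.
by have := mem_strip_boxes b; rewrite s0 bT.
Qed.

Lemma nth_strip_lt x0 i j : (i < j < size s)%N -> content (nth x0 s i) < content (nth x0 s j).
Proof.
case/andP=> lt_ij lt_j; have tr : transitive (fun b c : box => content b < content c).
  by move=> ? ? ?; apply: lt_trans.
apply: (sorted_ltn_nth tr x0 strip_boxes_sorted) => //.
by rewrite inE; apply: ltn_trans lt_j.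
Qed.

Lemma start_box_in : start_box th \in th.
Proof.
rewrite -mem_strip_boxes /start_box -/s; case: (s) strip_boxes_nil => //= b l _.
exact: mem_head.
Qed.

Lemma end_box_in : end_box th \in th.
Proof.
rewrite -mem_strip_boxes /end_box -/s; case: (s) strip_boxes_nil => //= b l _.
exact: mem_last.
Qed.

Lemma strip_content_bounds b : b \in th -> p_content th <= content b <= q_content th.
Proof.
rewrite -mem_strip_boxes => bs; have lt_i : (index b s < size s)%N by rewrite index_mem.
rewrite /p_content /q_content /start_box /end_box -/s -nth0 -nth_last.
have -> : content b = content (nth (0, 0) s (index b s)) by rewrite nth_index.
apply/andP; split.
  case: (posnP (index b s)) => [->|gt0]; first by [].
  by apply/ltW/nth_strip_lt; rewrite gt0.
case: (ltngtP (index b s) (size s).-1) => [lt|gt|->]; last by [].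
  by apply/ltW/nth_strip_lt; rewrite lt ltn_predL (leq_trans _ lt_i).
by move: lt_i gt; clear; lia.
Qed.

Lemma end_box_eq b : b \in th -> (b == end_box th) = (content b == q_content th).
Proof.
move=> bT; apply/eqP/eqP => [->//|ec].
by apply: strip_content_inj => //; apply: end_box_in.
Qed.

(** By connectedness, the next content is attained, at an adjacent box. *)
Lemma next_boxP b : b \in th -> b != end_box th ->
  next_box th b \in th /\ (next_box th b = right_of b \/ next_box th b = above b).
Proof.
move=> bT neq; have lt_q : content b < q_content th.
  rewrite lt_neqAle -end_box_eq // neq.
  by case/andP: (strip_content_bounds bT).
have [e eT [ce de]] := strip_crossing bT end_box_in lt_q.
suff -> : next_box th b = e by [].
rewrite /next_box -/s; have bs : b \in s by rewrite mem_strip_boxes.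
have es : e \in s by rewrite mem_strip_boxes.
have lt_be : (index b s < index e s)%N.
  rewrite ltnNge; apply/negP => le_eb; move: ce.
  move: le_eb; rewrite leq_eqVlt => /orP[/eqP eq_i|lt].
    by rewrite -(nth_index b es) eq_i nth_index //; clear; lia.
  have := nth_strip_lt b (i := index e s) (j := index b s).
  by rewrite lt index_mem bs !nth_index // => /(_ isT); clear; lia.
rewrite -[RHS](nth_index b es); congr nth; apply/eqP.
rewrite eqn_leq lt_be /= leqNgt; apply/negP => lt.
have lt_e : (index e s < size s)%N by rewrite index_mem.
have h1 := nth_strip_lt b (i := index b s) (j := (index b s).+1).
have h2 := nth_strip_lt b (i := (index b s).+1) (j := index e s).
move: h1 h2; rewrite !ltnSn lt lt_e (ltn_trans lt lt_e) !nth_index // => /(_ isT) h1 /(_ isT).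
by move: h1; rewrite ce; clear; lia.
Qed.

Lemma next_box_content b : b \in th -> b != end_box th ->
  content (next_box th b) = content b + 1.
Proof.
by move=> bT neq; have [_ [] ->] := next_boxP bT neq;
  rewrite ?content_right ?content_above.
Qed.

Lemma prev_boxP b : b \in th -> b != start_box th ->
  exists2 d, d \in th & d != end_box th /\ next_box th d = b.
Proof.
move=> bT neq; have lt_p : p_content th < content b.
  rewrite lt_neqAle; case/andP: (strip_content_bounds bT) => -> _; rewrite andbT.
  apply: contra_neq neq => ec; apply: strip_content_inj => //.
  exact: start_box_in.
have [_ _ /forallP/(_ [` start_box_in])/forallP/(_ [` bT]) lnk _] := stripT.
have [|[d dT] [e [_ _ /= cd _ _]]] := linked_crossing lnk (x := content b - 1).
  by rewrite /= -/(p_content th); move: lt_p; clear; lia.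
have neq_d : d != end_box th.
  rewrite end_box_eq // cd; have /andP[_] := strip_content_bounds bT.
  by clear; lia.
exists d => //; split=> //; apply: strip_content_inj => //.
  by have [] := next_boxP dT neq_d.
by rewrite next_box_content // cd subrK.
Qed.
End Strip.
End Geometry.

(** * The nested property *)

Section OutsideDecomposition.
Variables (la mu : seq nat) (Pi : {fset {fset box}}).
Let D := diagram la mu.
Hypothesis sp : skew_pair la mu.
Hypothesis dec : outside_decomposition D Pi.
Implicit Types (th B : {fset box}) (b d x : box).

Lemma decomposition_strip th : th \in Pi -> is_strip th.
Proof. by case: dec => _ _ out /out[]. Qed.

Lemma mem_decomposition b : reflect (exists2 th, th \in Pi & b \in th) (b \in D).
Proof.
case: dec => _ <- _; apply: (iffP (bigfcupP _ _ _ _)) => -[th].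
  by rewrite andbT; exists th.
by move=> thP bT; exists th; rewrite ?thP.
Qed.

Lemma strip_sub th b : th \in Pi -> b \in th -> b \in D.
Proof. by move=> thP bT; apply/mem_decomposition; exists th. Qed.

Lemma strip_unique th th' b : th \in Pi -> th' \in Pi -> b \in th -> b \in th' ->
  th = th'.
Proof.
case: dec => /trivIfsetP triv _ _ thP thP' bT bT'; apply/eqP.
apply: contraT => neq; have /fdisjointP/(_ b bT) := triv _ _ thP thP' neq.
by rewrite bT'.
Qed.

Lemma start_on_boundary th : th \in Pi ->
  (left_of (start_box th) \notin D) || (below (start_box th) \notin D).
Proof. by case: dec => _ _ out /out[]. Qed.

Lemma end_on_boundary th : th \in Pi ->
  (right_of (end_box th) \notin D) || (above (end_box th) \notin D).
Proof. by case: dec => _ _ out /out[]. Qed.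

(** The direction given by convention to an ending box points out of the diagram,
    so a box goes towards its successor in the strip whenever the neighbour in
    its direction is in the diagram, and ends its strip otherwise. *)
Lemma goes_upP th b : th \in Pi -> b \in th ->
  if goes_up D th b then
    if above b \in D then b != end_box th /\ above b \in th else b == end_box th
  else if right_of b \in D then b != end_box th /\ right_of b \in th
  else b == end_box th.
Proof.
move=> thP bT; have stT := decomposition_strip thP.
rewrite /goes_up; have [eb|neq] := eqVneq b (end_box th).
  case: ifPn => [/negPf-> //|]; rewrite negbK => aD.
  have := end_on_boundary thP; rewrite -eb aD orbF => /negPf->.
  by [].
have [nT nE] := next_boxP stT bT neq; have nD := strip_sub thP nT.
case: ifPn => [/eqP e|ne]; first by rewrite -e nD.
by case: nE => e; [rewrite -e nD|rewrite e eqxx in ne].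
Qed.

Lemma predecessor th x : th \in Pi -> x \in th -> x != start_box th ->
  (left_of x \in th /\ goes_up D th (left_of x) = false)
  \/ (below x \in th /\ goes_up D th (below x)).
Proof.
move=> thP xT neq; have stT := decomposition_strip thP.
have [d dT [dE nd]] := prev_boxP stT xT neq.
have [_ [] e] := next_boxP stT dT dE.
  have ed : left_of x = d by rewrite -nd e right_ofK.
  left; rewrite ed; split=> //; rewrite /goes_up (negPf dE) e.
  apply/eqP; case: (d) => i j [] /eqP; clear; lia.
have ed : below x = d by rewrite -nd e aboveK.
by right; rewrite ed; split=> //; rewrite /goes_up (negPf dE) e.
Qed.

(** Let x be the box to the right of the first one and above the second one.  If
    the first goes right and the second goes up, both lead to x.  If the first
    goes up and the second goes right, then x has no predecessor in its strip;
    but it is not a starting box, since its left and lower neighbours are in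
    the diagram. *)
Lemma nested_step i j th th' : th \in Pi -> th' \in Pi ->
    box_at i j \in th -> box_at i.+1 j.+1 \in th' ->
  goes_up D th (box_at i j) = goes_up D th' (box_at i.+1 j.+1).
Proof.
move=> thP thP' bT bT'.
set b := box_at i j in bT *; set b' := box_at i.+1 j.+1 in bT' *.
pose x := box_at i j.+1.
have rb : right_of b = x by rewrite right_of_box_at.
have ab : above b' = x by rewrite -[RHS]belowK below_box_at.
have bD := strip_sub thP bT; have bD' := strip_sub thP' bT'.
have xD : x \in D by apply: (diagram_convex sp bD bD'); clear; lia.
have := goes_upP thP bT; have := goes_upP thP' bT'; rewrite rb ab xD.
case up: (goes_up D th b); case up': (goes_up D th' b') => //; last first.
  move=> [_ xT'] [_ xT]; have eth := strip_unique thP thP' xT xT'; subst th'.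
  have : b = b'.
    apply: (strip_content_inj (decomposition_strip thP)) => //.
  by move/box_atI => []; clear; lia.
move=> _ _; have /mem_decomposition[th2 thP2 xT2] := xD.
have lx : left_of x = b by rewrite -rb right_ofK.
have bx : below x = b' by rewrite -ab aboveK.
have neq : x != start_box th2.
  apply/eqP => ex; have := start_on_boundary thP2.
  by rewrite -ex lx bx bD bD'.
have [] := predecessor thP2 xT2 neq; rewrite ?lx ?bx => -[bT2 up2].
  by have e := strip_unique thP thP2 bT bT2; rewrite e up2 in up.
by have e := strip_unique thP' thP2 bT' bT2; rewrite e up2 in up'.
Qed.

Lemma nested th th' b b' : th \in Pi -> th' \in Pi -> b \in th -> b' \in th' ->
  content b = content b' -> goes_up D th b = goes_up D th' b'.
Proof.
have main n : forall i j th th', th \in Pi -> th' \in Pi -> box_at i j \in th ->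
    box_at (i + n) (j + n) \in th' ->
    goes_up D th (box_at i j) = goes_up D th' (box_at (i + n) (j + n)).
  elim: n => [|n IHn] i j t t' tP tP' bT bT'.
    by rewrite !addn0 in bT' *; rewrite (strip_unique tP tP' bT bT').
  have bD := strip_sub tP bT; have bD' := strip_sub tP' bT'.
  have cD : box_at (i + n) (j + n) \in D.
    by apply: (diagram_convex sp bD bD'); clear; lia.
  have /mem_decomposition[t2 tP2 cT] := cD.
  rewrite (IHn _ _ _ _ tP tP2 bT cT); rewrite !addnS in bT' *.
  exact: nested_step.
move=> thP thP' bT bT'; have bD := strip_sub thP bT; have bD' := strip_sub thP' bT'.
case/diagramP: bD bT => i [j [-> _]] bT; case/diagramP: bD' bT' => i' [j' [-> _]] bT'.
rewrite (content_box_at i j) (content_box_at i' j') => ec.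
case: (leqP i i') => le_i.
  have [n [ei ej]] : exists n, i' = (i + n)%N /\ j' = (j + n)%N.
    by exists (i' - i)%N; move: le_i ec; clear; lia.
  by rewrite ei ej in bT' *; apply: main.
have [n [ei ej]] : exists n, i = (i' + n)%N /\ j = (j' + n)%N.
  by exists (i - i')%N; move: le_i ec; clear; lia.
by rewrite ei ej in bT *; apply/esym/main.
Qed.

(** On a missing diagonal, the direction is chosen so that no empty strip is
    created: going right would create one when an empty row starts and ends at
    the content c + 1, and going up when none starts or ends there. *)
Definition direction (c : int) : bool :=
  if c \in [seq content b | b <- enum_fset D] then diagonal_goes_up D Pi c
  else (c + 1 \in labels mu) && (c + 1 \in labels la).

Lemma diagonal_goes_upE th b : th \in Pi -> b \in th ->
  diagonal_goes_up D Pi (content b) = goes_up D th b.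
Proof.
move=> thP bT; apply/existsP/idP => [[[t tP] /existsP[[d dT] /= /andP[/eqP ec up]]]|up].
  by rewrite (nested thP tP bT dT).
exists [` thP]; apply/existsP; exists [` bT] => /=.
by rewrite eqxx.
Qed.

Lemma directionE th b : th \in Pi -> b \in th ->
  direction (content b) = goes_up D th b.
Proof.
move=> thP bT; rewrite /direction map_f ?(strip_sub thP bT) //.
exact: diagonal_goes_upE.
Qed.

Lemma start_after_right th x : th \in Pi -> x \in th ->
  ~~ direction (content x - 1) -> left_of x \notin D -> x = start_box th.
Proof.
move=> thP xT dir lD; apply/eqP; apply: contraNT lD => neq.
have [[lT _]|[bT up]] := predecessor thP xT neq; first exact: strip_sub lT.
by rewrite -(content_below x) (directionE thP bT) up in dir.
Qed.

Lemma start_after_up th x : th \in Pi -> x \in th ->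
  direction (content x - 1) -> below x \notin D -> x = start_box th.
Proof.
move=> thP xT dir bD; apply/eqP; apply: contraNT bD => neq.
have [[lT up]|[bT _]] := predecessor thP xT neq; last exact: strip_sub bT.
by rewrite -(content_left x) (directionE thP lT) up in dir.
Qed.
End OutsideDecomposition.

(** * Splitting into blocks *)

Section Blocks.
Variables (la mu : seq nat) (Pi : {fset {fset box}}).
Let D := diagram la mu.
Hypothesis sp : skew_pair la mu.
Hypothesis dec : outside_decomposition D Pi.
Implicit Types (th B : {fset box}) (b c d x : box).

Local Notation phi := (direction la mu Pi).
Local Notation top := ((head 0%N la)%:Z).
Local Notation S := (segment phi top).

Lemma mem_component B0 x (P : pred D) : B0 = [fset val c | c : D & P c] ->
  (x \in B0) = [exists c : D, P c && (val c == x)].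
Proof.
move=> ->; apply/imfsetP/existsP => [[c /= Pc ->]|[c /andP[Pc /eqP <-]]].
  by exists c; rewrite eqxx andbT.
by exists c.
Qed.

Lemma blocksP B : B \in blocks D -> exists b : D,
  (forall c : D, (val c \in B) = linked b c) /\ (forall x, x \in B -> x \in D).
Proof.
case/imfsetP=> b _ eB; exists b; split=> [c|x].
  rewrite (mem_component _ eB); apply/existsP/idP => [[c' /andP[lk /eqP ec]]|lk].
    by have <- : c' = c by apply: val_inj.
  by exists c; rewrite lk eqxx.
by rewrite (mem_component _ eB) => /existsP[c /andP[_ /eqP <-]]; apply: valP.
Qed.

Lemma block_sub B x : B \in blocks D -> x \in B -> x \in D.
Proof. by case/blocksP=> b [_ subD] /subD. Qed.

Lemma block_linked B (c d : D) : B \in blocks D -> val c \in B ->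
  (val d \in B) = linked c d.
Proof.
case/blocksP=> b [inB _]; rewrite !inB => lbc.
have sym : connect_sym (fun b c : D => adjacent (val b) (val c)) by exact: linked_sym.
apply/idP/idP => [lbd|lcd]; last exact: connect_trans lbc lcd.
by apply: connect_trans lbd; rewrite -/(linked _ _) linked_sym.
Qed.

Lemma mem_block b : b \in D -> exists2 B, B \in blocks D & b \in B.
Proof.
move=> bD; exists [fset val c | c : D & linked [` bD] c].
  by apply/imfsetP; exists [` bD].
by apply/imfsetP; exists [` bD] => //; apply: connect0.
Qed.

Lemma block_unique B B' b : B \in blocks D -> B' \in blocks D ->
  b \in B -> b \in B' -> B = B'.
Proof.
move=> bB bB' inB inB'; have bD := block_sub bB inB.
apply/fsetP => x; apply/idP/idP => xB.
  have xD := block_sub bB xB.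
  by rewrite -[x]/(val [` xD]) (@block_linked B' [` bD]) // -(@block_linked B).
have xD := block_sub bB' xB.
by rewrite -[x]/(val [` xD]) (@block_linked B [` bD]) // -(@block_linked B').
Qed.

(** Hence two blocks are separated by a missing diagonal. *)
Lemma block_close B b c : B \in blocks D -> b \in B -> c \in D ->
  content b <= content c + 1 -> content c <= content b + 1 -> c \in B.
Proof.
move=> bB inB cD le1 le2; have bD := block_sub bB inB.
rewrite -[c]/(val [` cD]) (@block_linked B [` bD]) //.
case: (leP (content b) (content c)) => [le|/ltW le].
  by apply: (linked_close sp); rewrite /= le.
by rewrite linked_sym; apply: (linked_close sp); rewrite /= le.
Qed.

Lemma block_contents B b c (n : int) : B \in blocks D -> b \in B -> c \in B ->
  content b <= n <= content c -> exists2 d, d \in B & content d = n.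
Proof.
move=> bB inB inC /andP[le1]; rewrite le_eqVlt => /orP[/eqP->|lt]; first by exists c.
have bD := block_sub bB inB; have cD := block_sub bB inC.
have lk : linked [` bD] [` cD] by rewrite -(@block_linked B).
have [|d [e [ld _ cd _ _]]] := linked_crossing lk (x := n); first by rewrite /= le1.
by exists (val d) => //; rewrite (@block_linked B [` bD]).
Qed.

(** The contents of a block form an interval, so two blocks are comparable. *)
Lemma blocks_apart B B' b b' d d' : B \in blocks D -> B' \in blocks D ->
    b \in B -> b' \in B' -> B != B' -> content b < content b' ->
    d \in B -> d' \in B' ->
  content d + 1 < content d'.
Proof.
move=> bB bB' inb inb' neq lt_bb' ind ind'.
have far c c' : c \in B -> c' \in B' ->
    content c + 1 < content c' \/ content c' + 1 < content c.
  move=> cB cB'; case: (ltP (content c + 1) (content c')) => [|le1]; first by left.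
  case: (ltP (content c' + 1) (content c)) => [|le2]; first by right.
  case/eqP: neq; apply: (block_unique bB bB' _ cB').
  exact: block_close bB cB (block_sub bB' cB') le2 le1.
have lt_bd' : content b < content d'.
  case: (ltP (content b) (content d')) => // le.
  have [|e eB' ce] := block_contents (n := content b) bB' ind' inb'.
    by rewrite le ltW.
  by have [] := far b e inb eB'; rewrite ce; clear; lia.
case: (ltP (content d) (content d')) => [lt|le].
  by have [//|] := far d d' ind ind'; move: lt; clear; lia.
have [|e eB ce] := block_contents (n := content d') bB inb ind.
  by rewrite le ltW.
by have [] := far e d' eB ind'; rewrite ce; clear; lia.
Qed.

Lemma linked_subset (th : {fset box}) (b c : th) : {subset th <= D} ->
  linked b c -> forall (bD : val b \in D) (cD : val c \in D), linked [` bD] [` cD].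
Proof.
move=> sub /connectP[p]; elim: p b => [|d p IHp] b /=.
  move=> _ -> bD cD; have -> : [` bD] = [` cD] by apply: val_inj.
  exact: connect0.
case/andP=> adj path_p def_c bD cD; have dD := sub _ (valP d).
apply: (connect_trans (connect1 _) (IHp d path_p def_c dD cD)).
exact: adj.
Qed.

Lemma strip_in_block B th b : B \in blocks D -> th \in Pi -> b \in th -> b \in B ->
  (th `<=` B)%fset.
Proof.
move=> bB thP bT inB; apply/fsubsetP => c cT.
have bD := block_sub bB inB; have cD := strip_sub dec thP cT.
rewrite -[c]/(val [` cD]) (@block_linked B [` bD]) //.
have [_ _ /forallP/(_ [` bT])/forallP/(_ [` cT]) lk _] := decomposition_strip dec thP.
by apply: (linked_subset _ lk) => x; apply: (strip_sub dec).
Qed.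

Definition block_strips B : {fset {fset box}} := [fset th in Pi | (th `<=` B)%fset]%fset.

Lemma mem_block_strips B th : (th \in block_strips B) = (th \in Pi) && (th `<=` B)%fset.
Proof. by rewrite !inE. Qed.

Lemma goes_up_block B th b : B \in blocks D -> b \in B ->
  goes_up B th b = goes_up D th b.
Proof.
move=> bB inB; rewrite /goes_up; case: ifP => // _; congr (~~ _).
apply/idP/idP => [/(block_sub bB) //|aD].
by apply: (block_close bB inB aD); rewrite content_above; clear; lia.
Qed.

Lemma block_direction B b : B \in blocks D -> b \in B ->
  diagonal_goes_up B (block_strips B) (content b) = phi (content b).
Proof.
move=> bB inB; have /(mem_decomposition dec)[th thP bT] := block_sub bB inB.
have thB : th \in block_strips B by rewrite mem_block_strips thP (strip_in_block bB thP bT).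
rewrite (directionE sp dec thP bT).
apply/existsP/idP => [[[t tB] /existsP[[d dT] /= /andP[/eqP ec]]]|up].
  have := tB; rewrite mem_block_strips => /andP[tP /fsubsetP tsub].
  by rewrite (goes_up_block _ bB (tsub _ dT)) (nested sp dec tP thP dT bT).
exists [` thB]; apply/existsP; exists [` bT] => /=.
by rewrite eqxx goes_up_block.
Qed.

(** The diagonals of a block form an interval of integers, in which indices
    and contents differ by a constant. *)
Section Interval.
Variable s : seq int.
Hypothesis s_sorted : sorted <%R s.
Hypothesis s_full : forall x y z : int, x \in s -> z \in s -> x <= y <= z -> y \in s.

Lemma index_succ (x : int) : x \in s -> x + 1 \in s -> index (x + 1) s = (index x s).+1.
Proof.
move=> xs xs1; apply/eqP; rewrite eqn_leq; apply/andP; split; last first.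
  rewrite ltnNge; apply/negP => le_i.
  have := sorted_leq_index le_trans lexx (sub_sorted (@ltW _ _) s_sorted)
    (x + 1) x xs1 xs le_i.
  by clear; lia.
rewrite leqNgt; apply/negP => lt_i.
have lt2 : (index (x + 1)%R s < size s)%N by rewrite index_mem.
pose y := s`_((index x s).+1).
have h1 : s`_(index x s) < y.
  by apply: (sorted_ltn_nth lt_trans) => //; rewrite inE ?(ltn_trans lt_i) ?index_mem.
have h2 : y < s`_(index (x + 1) s).
  by apply: (sorted_ltn_nth lt_trans) => //; rewrite inE ?(ltn_trans lt_i).
by move: h1 h2; rewrite !nth_index //; clear; lia.
Qed.

Lemma index_add (x : int) n : x \in s -> x + n%:Z \in s -> index (x + n%:Z) s = (index x s + n)%N.
Proof.
move=> xs; elim: n => [|n IHn] xn; first by rewrite addr0 addn0.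
have xn' : x + n%:Z \in s by apply: (s_full xs xn); clear; lia.
have e : x + n.+1%:Z = x + n%:Z + 1 by clear; lia.
by rewrite e index_succ -?e // IHn // addnS.
Qed.

Lemma interval_slice (x : int) n : x \in s -> x + n%:Z \in s ->
  drop (index x s) (take (index (x + n%:Z) s) s) = [seq x + k%:Z | k <- iota 0 n].
Proof.
move=> xs xn; have ei := index_add xs xn.
have lt_i : (index (x + n%:Z)%R s < size s)%N by rewrite index_mem.
apply: (@eq_from_nth _ 0).
  by rewrite size_drop size_take lt_i ei addKn size_map size_iota.
move=> k; rewrite size_drop size_take lt_i ei addKn => lt_k.
rewrite nth_drop nth_take ?ltn_add2l // (nth_map 0%N) ?size_iota // nth_iota // add0n.
have xk : x + k%:Z \in s by apply: (s_full xs xn); move: lt_k; clear; lia.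
by rewrite -index_add // nth_index.
Qed.
End Interval.

Lemma mem_diagonals B (n : int) :
  (n \in diagonals B) = (n \in [seq content b | b <- enum_fset B]).
Proof. by rewrite mem_sort mem_undup. Qed.

(** The segments of the cutting strip of a block are segments of the common
    direction word of the whole diagram. *)
Lemma block_segment B b c : B \in blocks D -> b \in B -> c \in B ->
  segment_schur B (block_strips B) (content b) (content c)
    = S (content b) (content c + 1).
Proof.
move=> bB inb inc; rewrite /segment_schur; case: leP => [le|lt]; last first.
  rewrite /segment; case: ltP => [lt1|le1].
    by rewrite (_ : (_ == _) = false) //; apply/negbTE; move: lt1; clear; lia.
  have -> : content b = content c + 1 by move: lt le1; clear; lia.
  by rewrite eqxx.
have [n en] : exists n : nat, content c = content b + n%:Z.
  by exists `|content c - content b|%N; move: le; clear; lia.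
have -> : content c + 1 = content b + n.+1%:Z by rewrite en; clear; lia.
rewrite segment_gt; congr ribbon_schur; rewrite /cutting_segment /cutting_strip.
have s_sorted : sorted <%R (diagonals B).
  by rewrite /diagonals sort_lt_sorted undup_uniq.
have memD (x : int) : reflect (exists2 d, d \in B & content d = x) (x \in diagonals B).
  rewrite mem_diagonals; apply: (iffP mapP) => -[d dB e]; by exists d.
have s_full (x y z : int) : x \in diagonals B -> z \in diagonals B -> x <= y <= z ->
    y \in diagonals B.
  move=> /memD[d dB <-] /memD[e eB <-] yb; apply/memD.
  exact: block_contents bB dB eB yb.
have bs : content b \in diagonals B by apply/memD; exists b.
have cs : content c \in diagonals B by apply/memD; exists c.
rewrite -map_take -map_drop take_takel; last first.
  by rewrite -ltnS prednK ?index_mem //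
    (leq_ltn_trans _ (_ : index (content c) (diagonals B) < _)%N) // index_mem.
rewrite en (interval_slice s_sorted s_full) -?en // -map_comp; apply/eq_in_map => k.
rewrite mem_iota add0n => /andP[_ lt_k] /=.
have [|d dB cd] := block_contents (n := content b + k%:Z) bB inb inc.
  by rewrite en; move: lt_k; clear; lia.
have lt_top : content d < top.
  case/diagramP: (block_sub bB dB) => i [j [-> /andP[_ lt_j]]].
  have [dla _ _ _] := skew_pairP _ _ sp.
  have := sorted_geq_nth dla (leq0n i).
  by rewrite nth0 (content_box_at i j); move: lt_j; clear; lia.
by rewrite -cd lt_top andbT (block_direction bB dB).
Qed.

Definition strip_ends th : int * int := (p_content th, q_content th + 1).

Lemma block_determinantE B : B \in blocks D ->
  block_determinant B (block_strips B)
    = ldet S [seq p_content th | th <- ordered_strips (block_strips B)]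
             [seq q_content th + 1 | th <- ordered_strips (block_strips B)].
Proof.
move=> bB; rewrite ldet_tr ?size_map // /block_determinant /ldet size_map.
congr (\det _); apply/matrixP => i j; rewrite !mxE !(nth_map fset0) ?size_map //.
set os := ordered_strips _ in i j *.
have inB (k : 'I_(size os)) : nth fset0 os k \in block_strips B.
  have : nth fset0 os k \in os by apply: mem_nth.
  by rewrite mem_sort.
have := inB i; have := inB j; rewrite !mem_block_strips.
move: (nth fset0 os i) (nth fset0 os j) => t t' /andP[tP' /fsubsetP sub'] /andP[tP /fsubsetP sub].
apply: block_segment => //.
  by apply/sub'/start_box_in/(decomposition_strip dec).
by apply/sub/end_box_in/(decomposition_strip dec).
Qed.

(** The big determinant is block triangular. *)
Lemma ldet_flatten (w : int -> int -> series variable) (l : seq {fset box})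
    (rs cs : {fset box} -> seq int) :
    (forall B, size (rs B) = size (cs B)) ->
    pairwise (fun B B' => all (fun a => all (fun f => f < a) (cs B)) (rs B')) l ->
    (forall a f, f < a -> w a f = 0) ->
  \prod_(B <- l) ldet w (rs B) (cs B)
    = ldet w (flatten (map rs l)) (flatten (map cs l)).
Proof.
move=> sz pw w0; have szf l' : size (flatten (map rs l')) = size (flatten (map cs l')).
  by rewrite !size_flatten /shape -!map_comp; congr sumn; apply: eq_map.
elim: l pw => [_|B l IHl /andP[/allP sep pw]] /=.
  by rewrite big_nil /ldet det_mx00.
rewrite big_cons IHl // -ldet_block // => a f /flattenP[_ /mapP[B' B'l ->] aB'] fB.
by apply: w0; have /allP/(_ a aB')/allP/(_ f fB) := sep B' B'l.
Qed.

Definition block_key B : int := content (head (0, 0) (enum_fset B)).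

Lemma block_keyP B : B \in blocks D -> exists2 b, b \in B & content b = block_key B.
Proof.
case/blocksP=> b [inB _]; have bB : val b \in B by rewrite inB; apply: connect0.
exists (head (0, 0) (enum_fset B)) => //.
suff head_in (l : seq box) : val b \in l -> head (0, 0) l \in l.
  exact: (head_in (enum_fset B)).
by case: l => //= c l _; rewrite mem_head.
Qed.

Theorem hamel_goulden_ldet :
  hamel_goulden_determinant D Pi
    = ldet S [seq p_content th | th <- enum_fset Pi]
             [seq q_content th + 1 | th <- enum_fset Pi].
Proof.
pose le_key B B' := block_key B <= block_key B'.
pose l := sort le_key (enum_fset (blocks D)).
have memb B : (B \in l) = (B \in blocks D) by rewrite mem_sort.
have ul : uniq l by rewrite sort_uniq fset_uniq.
have apart B B' : B \in blocks D -> B' \in blocks D -> B != B' -> le_key B B' ->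
    forall b b', b \in B -> b' \in B' -> content b + 1 < content b'.
  move=> bB bB' neq le b b' inb inb'.
  have [c cB ec] := block_keyP bB; have [c' cB' ec'] := block_keyP bB'.
  apply: (blocks_apart bB bB' cB cB') => //.
  rewrite lt_neqAle ec ec' [_ <= _]le andbT; apply: contra_neq neq => ek.
  apply: (block_unique bB bB' _ cB').
  apply: (block_close bB cB (block_sub bB' cB')); rewrite ec ec' ek; clear; lia.
pose os B := ordered_strips (block_strips B).
pose rs B := [seq p_content th | th <- os B].
pose cs B := [seq q_content th + 1 | th <- os B].
have mem_os B th : (th \in os B) = (th \in Pi) && (th `<=` B)%fset.
  by rewrite mem_sort -mem_block_strips.
transitivity (\prod_(B <- l) ldet S (rs B) (cs B)).
  rewrite /hamel_goulden_determinant.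
  rewrite (perm_big l) /=; last by rewrite perm_sym perm_sort.
  by rewrite big_seq [RHS]big_seq; apply: eq_bigr => B; rewrite memb => /block_determinantE.
rewrite ldet_flatten; last 3 first.
- by move=> B; rewrite !size_map.
- have tr : transitive le_key by move=> ? ? ?; apply: le_trans.
  have tot : total le_key by move=> ? ?; apply: le_total.
  have := sort_sorted tot (enum_fset (blocks D)); rewrite -/l (sorted_pairwise tr) => pw.
  have pw' : pairwise [rel B B' | (B != B') && le_key B B'] l.
    by rewrite pairwise_relI -uniq_pairwise ul pw.
  apply: (@sub_in_pairwise _ (mem l) _ _ _ l _ pw'); last exact/allP.
  move=> B B' Bl Bl' /andP[neq le].
  have bB : B \in blocks D by rewrite -memb.
  have bB' : B' \in blocks D by rewrite -memb.
  apply/allP => _ /mapP[t' tB' ->]; apply/allP => _ /mapP[t tB ->].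
  move: tB tB'; rewrite !mem_os => /andP[tP /fsubsetP sub] /andP[tP' /fsubsetP sub'].
  apply: (apart _ _ bB bB' neq le).
    by apply/sub/end_box_in/(decomposition_strip dec).
  by apply/sub'/start_box_in/(decomposition_strip dec).
- by move=> a f; apply: segment_lt.
have -> : flatten (map rs l) = unzip1 (map strip_ends [seq th | B <- l, th <- os B]).
  rewrite /unzip1 -map_comp map_allpairs; congr flatten; apply: eq_map.
have -> : flatten (map cs l) = unzip2 (map strip_ends [seq th | B <- l, th <- os B]).
  rewrite /unzip2 -map_comp map_allpairs; congr flatten; apply: eq_map.
have -> : [seq p_content th | th <- enum_fset Pi] = unzip1 (map strip_ends (enum_fset Pi)).
  by rewrite /unzip1 -map_comp; apply: eq_map.
have -> : [seq q_content th + 1 | th <- enum_fset Pi] = unzip2 (map strip_ends (enum_fset Pi)).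
  by rewrite /unzip2 -map_comp; apply: eq_map.
apply/ldet_perm/perm_map/uniq_perm; rewrite ?fset_uniq //.
  apply: allpairs_uniq_dep => // [B _|].
    by rewrite sort_uniq fset_uniq.
  move=> _ _ /allpairsPdep[B [t [Bl tB ->]]] /allpairsPdep[B' [t' [Bl' tB' ->]]] /= e.
  subst t'; move: Bl Bl' tB tB'; rewrite !memb !mem_os => bB bB'.
  move=> /andP[tP /fsubsetP sub] /andP[_ /fsubsetP sub'].
  have bT := start_box_in (decomposition_strip dec tP).
  by have -> := block_unique bB bB' (sub _ bT) (sub' _ bT).
move=> t; apply/allpairsPdep/idP => [[B [t' [_ + ->]]]|tP].
  by rewrite mem_os => /andP[].
have bT := start_box_in (decomposition_strip dec tP).
have [B bB inB] := mem_block (strip_sub dec tP bT).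
exists B, t; split; rewrite ?memb // mem_os tP /=.
exact: strip_in_block bB tP bT inB.
Qed.
End Blocks.

(** * The sweep *)

Section PermutedPairs.
Variables (A : comNzRingType) (w : int -> int -> A).

Lemma ldet_perm_cat (s t : seq (int * int)) rs cs : size rs = size cs ->
    perm_eq s t ->
  ldet w (unzip1 s ++ rs) (unzip2 s ++ cs) = ldet w (unzip1 t ++ rs) (unzip2 t ++ cs).
Proof.
move=> sz st; have e1 u : unzip1 u ++ rs = unzip1 (u ++ zip rs cs).
  by rewrite /unzip1 map_cat -/(unzip1 (zip rs cs)) unzip1_zip ?sz.
have e2 u : unzip2 u ++ cs = unzip2 (u ++ zip rs cs).
  by rewrite /unzip2 map_cat -/(unzip2 (zip rs cs)) unzip2_zip ?sz.
by rewrite !e1 !e2; apply: ldet_perm; rewrite perm_cat2r.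
Qed.

Lemma ldet_rcons (s : seq (int * int)) rs cs a f : size rs = size cs ->
  ldet w (unzip1 s ++ rcons rs a) (unzip2 s ++ rcons cs f)
    = ldet w (unzip1 ((a, f) :: s) ++ rs) (unzip2 ((a, f) :: s) ++ cs).
Proof.
move=> sz; have e1 u : unzip1 u ++ rs = unzip1 (u ++ zip rs cs).
  by rewrite /unzip1 map_cat -/(unzip1 (zip rs cs)) unzip1_zip ?sz.
have e2 u : unzip2 u ++ cs = unzip2 (u ++ zip rs cs).
  by rewrite /unzip2 map_cat -/(unzip2 (zip rs cs)) unzip2_zip ?sz.
rewrite -!cats1 !catA !e1 !e2.
have -> : unzip1 (s ++ zip rs cs) ++ [:: a] = unzip1 ((s ++ zip rs cs) ++ [:: (a, f)]).
  by rewrite [RHS]/unzip1 map_cat.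
have -> : unzip2 (s ++ zip rs cs) ++ [:: f] = unzip2 ((s ++ zip rs cs) ++ [:: (a, f)]).
  by rewrite [RHS]/unzip2 map_cat.
by apply: ldet_perm; rewrite perm_catC.
Qed.
End PermutedPairs.

Section Sweep.
Variables (la mu : seq nat) (Pi : {fset {fset box}}).
Let D := diagram la mu.
Hypothesis sp : skew_pair la mu.
Hypothesis dec : outside_decomposition D Pi.
Implicit Types (th : {fset box}) (b d : box) (c : int) (i j n : nat).
Local Notation "s `[ i ]" := (nth 0%N s i) (at level 2, format "s `[ i ]").
Local Notation phi := (direction la mu Pi).
Local Notation k := (size la).

Let dla : sorted geq la. Proof. by case/skew_pairP: sp. Qed.
Let dmu : sorted geq mu. Proof. by case/skew_pairP: sp. Qed.
Let sz_mu : size mu = k. Proof. by case/skew_pairP: sp. Qed.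
Let le_mu i : (mu`[i] <= la`[i])%N. Proof. by case/skew_pairP: sp. Qed.

(** The number of rows whose label is larger than c.  For mu, these are the rows
    that have not started at the content c; for la, those that have not ended. *)
Definition above_cut ka c : nat := count (fun x : int => c < x) (labels ka).

Lemma above_cutE ka c i : sorted geq ka ->
  (i < above_cut ka c)%N = (i < size ka)%N && (c < (ka`[i])%:Z - i%:Z).
Proof.
move=> dka; rewrite /above_cut /labels count_map.
set P := preim _ _; have [lt_i|le_i] := ltnP i (size ka); last first.
  by apply/negbTE; rewrite -leqNgt (leq_trans (count_size _ _)) // size_iota.
have closed j : (0 <= j)%N -> (j.+1 < 0 + size ka)%N -> P j.+1 -> P j.
  by move=> _ _; rewrite /P /=; have /sorted_geqP/(_ j) := dka; clear; lia.
by have := count_prefix closed (j := i); rewrite !add0n lt_i => /(_ isT) <-.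
Qed.

Lemma above_cut_step ka c : sorted geq ka ->
  above_cut ka c = (above_cut ka (c + 1)%R + ((c + 1)%R \in labels ka))%N.
Proof.
move=> dka; have u : uniq (labels ka).
  rewrite map_inj_in_uniq ?iota_uniq // => i j _ _ e.
  have h1 : (i <= j)%N -> (ka`[j] <= ka`[i])%N by apply: sorted_geq_nth.
  have h2 : (j <= i)%N -> (ka`[i] <= ka`[j])%N by apply: sorted_geq_nth.
  by move: h1 h2 e; clear; lia.
rewrite -count_uniq_mem // /above_cut; elim: (labels ka) {u} => //= x s ->.
have -> : nat_of_bool (c < x) = ((c + 1 < x)%R + (x == c + 1)%R)%N by clear; lia.
by rewrite addnACA.
Qed.

(** The box of content c in row i, which may be outside the diagram. *)
Definition cell c i : box := (i.+1%:Z, i.+1%:Z + c).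

Lemma content_cell c i : content (cell c i) = c.
Proof. by rewrite /content /=; clear; lia. Qed.

Lemma right_of_cell c i : right_of (cell c i) = cell (c + 1) i.
Proof. by congr pair; rewrite /= addrA. Qed.

Lemma above_cell c i : above (cell c i.+1) = cell (c + 1) i.
Proof. by congr pair; rewrite /=; clear; lia. Qed.

Lemma cellP b : b \in D -> exists i, b = cell (content b) i.
Proof.
case/diagramP=> i [j [-> _]]; exists i; rewrite (content_box_at i j).
by congr pair; clear; lia.
Qed.

Lemma mem_cell c i :
  (cell c i \in D) = (above_cut mu c <= i < above_cut la c)%N.
Proof.
rewrite leqNgt !above_cutE // sz_mu; apply/diagramP/idP => [[i' [j [[ei ec] h]]]|].
  subst i'; have lt_i : (i < k)%N.
    by case: (ltnP i k) h => // le_i; rewrite [X in (_ < X)%N]nth_default // ltn0 andbF.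
  by rewrite lt_i /=; move: ec h; clear; lia.
case/andP=> n_mu /andP[lt_i lt_c]; rewrite lt_i /= in n_mu.
exists i, `|(i%:Z + c)%R|%N; split; last by move: n_mu lt_c; clear; lia.
by congr pair; move: n_mu; clear; lia.
Qed.

Definition start_content b : int :=
  if [pick th : Pi | b \in val th] is Some th then p_content (val th) else 0.

Lemma start_contentE th b : th \in Pi -> b \in th -> start_content b = p_content th.
Proof.
move=> thP bT; rewrite /start_content; case: pickP => [t bt|/(_ [` thP])]; last first.
  by rewrite /= bT.
by rewrite (strip_unique dec (valP t) thP bt bT).
Qed.

Lemma start_content_le b : b \in D -> start_content b <= content b.
Proof.
case/(mem_decomposition dec)=> th thP bT; rewrite (start_contentE thP bT).
by have /andP[] := strip_content_bounds (decomposition_strip dec thP) bT.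
Qed.

Section Step.
Variable c : int.
Local Notation r := (c + 1).

Lemma start_right i : ~~ phi c -> cell c i \in D -> cell r i \in D ->
  start_content (cell r i) = start_content (cell c i).
Proof.
move=> nphi cD rD; have /(mem_decomposition dec)[th thP cT] := cD.
have := goes_upP dec thP cT; rewrite -(directionE sp dec thP cT) content_cell.
rewrite (negPf nphi) right_of_cell -/D rD => -[_ rT].
by rewrite (start_contentE thP cT) (start_contentE thP rT).
Qed.

Lemma start_up i : phi c -> cell c i.+1 \in D -> cell r i \in D ->
  start_content (cell r i) = start_content (cell c i.+1).
Proof.
move=> phic cD rD; have /(mem_decomposition dec)[th thP cT] := cD.
have := goes_upP dec thP cT; rewrite -(directionE sp dec thP cT) content_cell.
rewrite phic above_cell -/D rD => -[_ rT].
by rewrite (start_contentE thP cT) (start_contentE thP rT).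
Qed.

Lemma start_new_right i : ~~ phi c -> cell c i \notin D -> cell r i \in D ->
  start_content (cell r i) = r.
Proof.
move=> nphi cD rD; have /(mem_decomposition dec)[th thP rT] := rD.
rewrite (start_contentE thP rT) /p_content.
rewrite -(start_after_right sp dec thP rT) ?content_cell ?addrK //.
by rewrite -right_of_cell right_ofK.
Qed.

Lemma start_new_up i : phi c -> cell c i.+1 \notin D -> cell r i \in D ->
  start_content (cell r i) = r.
Proof.
move=> phic cD rD; have /(mem_decomposition dec)[th thP rT] := rD.
rewrite (start_contentE thP rT) /p_content.
rewrite -(start_after_up sp dec thP rT) ?content_cell ?addrK //.
by rewrite -above_cell aboveK.
Qed.

Lemma end_right i th : ~~ phi c -> th \in Pi -> cell c i \in th ->
  (cell c i == end_box th) = (cell r i \notin D).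
Proof.
move=> nphi thP cT; have := goes_upP dec thP cT.
rewrite -(directionE sp dec thP cT) content_cell (negPf nphi) right_of_cell -/D.
by case: ifP => // _ [/negPf-> _].
Qed.

Lemma end_up i th : phi c -> th \in Pi -> cell c i \in th ->
  (cell c i == end_box th) = (above (cell c i) \notin D).
Proof.
move=> phic thP cT; have := goes_upP dec thP cT.
rewrite -(directionE sp dec thP cT) content_cell phic -/D.
by case: ifP => // _ [/negPf-> _].
Qed.

Lemma direction_gap : (forall i, cell c i \notin D) ->
  phi c = (r \in labels mu) && (r \in labels la).
Proof.
move=> gap; rewrite /direction ifF //; apply/negP => /mapP[b bD ec].
have [i ei] := cellP bD; case/negP: (gap i); by rewrite ec -ei.
Qed.
End Step.

Definition ended c : seq (int * int) :=
  [seq strip_ends th | th <- [seq th <- enum_fset Pi | q_content th < c]].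

(** The strips that cross the diagonal c, from top left to bottom right. *)
Definition crossing c : seq int :=
  [seq start_content (cell c i)
     | i <- iota (above_cut mu c) (above_cut la c - above_cut mu c)].

(** The strips are those of the decomposition that end before the diagonal c, and
    the strips that follow the rows from the diagonal c on: the latter are
    listed from top to bottom, hence the rows that start after c come first and
    the strips that cross the diagonal c come next. *)
Definition sweep c : series variable :=
  ldet (segment phi c)
    (unzip1 (ended c) ++ take (above_cut mu c) (labels mu) ++ crossing c)
    (unzip2 (ended c) ++ take (above_cut la c) (labels la)).

Lemma above_cut_leq c : (above_cut mu c <= above_cut la c)%N.
Proof.
case e : (above_cut mu c) => [//|n].
have : (n < above_cut mu c)%N by rewrite e.
by rewrite !above_cutE // sz_mu => /andP[-> /=]; have := le_mu n; clear; lia.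
Qed.

Lemma above_cut_size ka c : (above_cut ka c <= size ka)%N.
Proof. by rewrite /above_cut (leq_trans (count_size _ _)) // size_labels. Qed.

(** The labels decrease strictly, so c + 1 can only be the last label above c. *)
Lemma take_labels ka c : sorted geq ka -> take (above_cut ka c) (labels ka)
  = take (above_cut ka (c + 1)) (labels ka) ++ nseq (c + 1 \in labels ka) (c + 1).
Proof.
move=> dka; have e := above_cut_step c dka; rewrite e.
case: (boolP (c + 1 \in labels ka)) e => _ e; last by rewrite addn0 cats0.
have lt_n : (above_cut ka (c + 1)%R < above_cut ka c)%N by rewrite e addn1.
have n_lt : (above_cut ka (c + 1)%R < above_cut ka (c + 1)%R)%N = false by rewrite ltnn.
move: lt_n n_lt; rewrite !above_cutE // => /andP[lt_n gt_c]; rewrite lt_n /= => le_c.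
rewrite addn1 (take_nth 0) ?size_labels // -cats1; congr (_ ++ [:: _]).
by rewrite nth_labels //; move: gt_c le_c; clear; lia.
Qed.

Lemma take_labels_gt ka c : sorted geq ka ->
  all (fun x => c < x) (take (above_cut ka c) (labels ka)).
Proof.
move=> dka; apply/(all_nthP 0) => i; rewrite size_take.
rewrite size_labels; case: ifP => [_ lt_i|]; last first.
  move/negbT; rewrite -leqNgt => le_n lt_i.
  have : (i < above_cut ka c)%N by apply: leq_trans le_n.
  by rewrite above_cutE // => /andP[lt_ik]; rewrite nth_take ?nth_labels //;
    apply: leq_trans le_n.
rewrite nth_take //; have := lt_i; rewrite above_cutE // => /andP[lt_ik].
by rewrite nth_labels.
Qed.

Lemma ended_lt c :
  all (fun x => x < c + 1) (unzip1 (ended c)) /\ all (fun x => x < c + 1) (unzip2 (ended c)).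
Proof.
have bnd th : th \in [seq th <- enum_fset Pi | q_content th < c] ->
    q_content th < c /\ p_content th <= q_content th.
  rewrite mem_filter => /andP[-> thP]; split=> //.
  have stT := decomposition_strip dec thP.
  by have /andP[+ _] := strip_content_bounds stT (end_box_in stT).
by split; apply/allP => _ /mapP[_ /mapP[th /bnd[lt_q le_pq] ->] ->] /=;
  move: lt_q le_pq; clear; lia.
Qed.

Lemma crossing_lt c : all (fun x => x < c + 1) (crossing c).
Proof.
apply/allP => _ /mapP[i + ->]; rewrite mem_iota => lt_i.
have cD : cell c i \in D.
  by rewrite mem_cell; have := above_cut_leq c; move: lt_i; clear; lia.
by have := start_content_le cD; rewrite content_cell; clear; lia.
Qed.

Lemma size_ended c : size (unzip1 (ended c)) = size (unzip2 (ended c)).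
Proof. by rewrite !size_map. Qed.

Section Ends.
Variable c : int.
Local Notation r := (c + 1).

Let finishing := [seq th <- enum_fset Pi | q_content th == c].

Lemma ended_step : perm_eq (ended r) ([seq strip_ends th | th <- finishing] ++ ended c).
Proof.
rewrite /ended -map_cat; apply: perm_map; rewrite /finishing.
rewrite -(perm_filterC (fun th => q_content th == c)) -!filter_predI.
apply: perm_cat.
  rewrite (@eq_filter _ _ (fun th => q_content th == c)) // => th /=.
  by case: eqP => //= ->; clear; lia.
rewrite (@eq_filter _ _ (fun th => q_content th < c)) // => th /=.
by clear; lia.
Qed.

Lemma finishingP th : th \in finishing ->
  th \in Pi /\ exists2 i, cell c i \in th & cell c i == end_box th.
Proof.
rewrite mem_filter => /andP[/eqP eq_q thP]; split=> //.
have stT := decomposition_strip dec thP.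
have eT := end_box_in stT; have [i ei] := cellP (strip_sub dec thP eT).
have eqc : content (end_box th) = c by [].
by exists i; rewrite -eqc -ei.
Qed.

Lemma ended_none :
    (forall i th, th \in Pi -> cell c i \in th -> (cell c i == end_box th) = false) ->
  perm_eq (ended r) (ended c).
Proof.
move=> no; apply: perm_trans ended_step _.
suff -> : finishing = [::] by [].
case e : finishing => [//|th s]; have thf : th \in finishing by rewrite e mem_head.
by have [thP [i iT]] := finishingP thf; rewrite no.
Qed.

Lemma ended_one i0 : cell c i0 \in D ->
    (forall i th, th \in Pi -> cell c i \in th -> (cell c i == end_box th) = (i == i0)) ->
  perm_eq (ended r) ((start_content (cell c i0), r) :: ended c).
Proof.
move=> cD one; apply: perm_trans ended_step _.
have /(mem_decomposition dec)[th thP cT] := cD.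
have eT : cell c i0 = end_box th by apply/eqP; rewrite one ?eqxx.
have eq_q : q_content th = c by rewrite /q_content -eT content_cell.
suff pf : perm_eq finishing [:: th].
  have := perm_map strip_ends pf; rewrite -(perm_cat2r (ended c)) /=.
  by rewrite {2}/strip_ends eq_q -(start_contentE thP cT).
apply: uniq_perm; rewrite ?filter_uniq ?fset_uniq // => t; rewrite inE.
apply/idP/eqP => [tf|->]; last by rewrite mem_filter eq_q eqxx.
have [tP [i iT]] := finishingP tf; rewrite one // => /eqP ei.
by rewrite ei in iT; apply: (strip_unique dec tP thP iT cT).
Qed.
End Ends.

(** The matrix does not change; if a row ends at c + 1, the last strip that
    crosses the diagonal moves to the strips that have ended. *)
Lemma sweep_straight c : ~~ phi c -> sweep (c + 1) = sweep c.
Proof.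
move=> nphi; set r := c + 1.
have eF := above_cut_step c dla; have eG := above_cut_step c dmu.
have le_c := above_cut_leq c; have le_r := above_cut_leq r.
(* Otherwise the diagonal c would be missing and an empty row would start and
   end at c + 1; then [direction] makes the diagonal go up. *)
have lt_cut : (above_cut mu c <= above_cut la r)%N.
  rewrite leqNgt; apply/negP => lt.
  have gap i : cell c i \notin D.
    rewrite mem_cell; move: lt le_c le_r eF eG; rewrite -/r; clear.
    by case: (r \in _); case: (r \in _); lia.
  move: nphi; rewrite (direction_gap gap) -/r.
  by move: lt le_c le_r eF eG; rewrite -/r; clear; case: (r \in _); case: (r \in _) => //=; lia.
have le_Gr : (above_cut mu r <= above_cut mu c)%N by rewrite eG -/r leq_addr.
pose com := [seq start_content (cell c i) | i <- iota (above_cut mu c)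
  (above_cut la r - above_cut mu c)].
pose x := start_content (cell c (above_cut la r)).
have crc : crossing c = com ++ nseq (r \in labels la) x.
  rewrite /crossing eF -/r addnC -addnBA // addnC iotaD map_cat -/com; congr (_ ++ _).
  by rewrite subnKC //; case: (r \in _).
have crr : crossing r = nseq (r \in labels mu) r ++ com.
  have -> : com = [seq start_content (cell r i)
      | i <- iota (above_cut mu c) (above_cut la r - above_cut mu c)].
    apply/eq_in_map => i; rewrite mem_iota => lt_i; apply/esym/start_right => //.
      by rewrite mem_cell; move: lt_i lt_cut eF; rewrite -/r; clear; lia.
    by rewrite -/r mem_cell; move: lt_i lt_cut le_Gr; clear; lia.
  rewrite /crossing; move: eG lt_cut; rewrite -/r; case: (boolP (r \in labels mu)) => rP eG lt_cut.
    rewrite eG; have -> : (above_cut la r - above_cut mu r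
        = (above_cut la r - (above_cut mu r + true)).+1)%N.
      by move: eG lt_cut; clear; lia.
    rewrite addn1 /=; congr (_ :: _); apply: start_new_right => //.
      by rewrite mem_cell; move: eG; clear; lia.
    by rewrite -/r mem_cell; move: eG lt_cut; clear; lia.
  by rewrite eG addn0.
have rowsE : take (above_cut mu c) (labels mu) ++ crossing c
    = (take (above_cut mu r) (labels mu) ++ crossing r) ++ nseq (r \in labels la) x.
  by rewrite take_labels // crc crr -!catA.
have colsE := take_labels c dla; rewrite -/r in colsE.
have sz : size (take (above_cut mu r) (labels mu) ++ crossing r)
    = size (take (above_cut la r) (labels la)).
  rewrite size_cat !size_takel ?size_labels ?above_cut_size // size_map size_iota.
  by rewrite subnKC.
rewrite /sweep rowsE colsE.
have segE := segment_straight (phi := phi) (c := c) nphi.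
case: (boolP (r \in labels la)) eF => rQ eF; rewrite -/r in eF *.
  have cD : cell c (above_cut la r) \in D by rewrite mem_cell lt_cut eF addn1 leqnn.
  have pe : perm_eq (ended r) ((x, r) :: ended c).
    apply: ended_one => // i th thP iT; rewrite (end_right nphi thP iT) -/r mem_cell.
    have := strip_sub dec thP iT; rewrite -/D mem_cell eF; move: le_Gr; clear; lia.
  rewrite (ldet_perm_cat _ sz pe) !cats1 ldet_rcons //.
  apply: eq_ldet => [|a f _ _]; last exact: segE.
by rewrite [LHS]size_cat [RHS]size_cat sz /= !size_map.
have pe : perm_eq (ended r) (ended c).
  apply: ended_none => i th thP iT; rewrite (end_right nphi thP iT) -/r mem_cell.
  have := strip_sub dec thP iT; rewrite -/D mem_cell eF; move: le_Gr; clear; lia.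
rewrite (ldet_perm_cat _ sz pe) !cats0.
apply: eq_ldet => [|a f _ _]; last exact: segE.
by rewrite [LHS]size_cat [RHS]size_cat sz /= !size_map.
Qed.

(** The strip which crosses the next diagonal in row i crosses the diagonal c in
    row i + 1.  The four cases are those of the lemmas [turn_start_end],
    [turn_start], [turn_end] and [turn_end_start]. *)
Lemma sweep_turn c : phi c -> sweep (c + 1) = sweep c.
Proof.
move=> phic; set r := c + 1.
have eF := above_cut_step c dla; have eG := above_cut_step c dmu.
rewrite -/r in eF eG.
have le_c := above_cut_leq c; have le_r := above_cut_leq r.
have n_gap : ~~ ((r \in labels mu) && (r \in labels la)) ->
    (above_cut mu c < above_cut la c)%N.
  apply: contraNltn => le; rewrite -(direction_gap (c := c)) // => i.
  by rewrite mem_cell; move: le; clear; lia.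
pose com n := [seq start_content (cell r i) | i <- iota (above_cut mu r) n].
have comE n : (above_cut mu r + n < above_cut la c)%N ->
    (above_cut mu r + n <= above_cut la r)%N ->
    com n = [seq start_content (cell c i) | i <- iota (above_cut mu r).+1 n].
  move=> lt1 lt2; rewrite /com -[_.+1]add1n iotaDl -map_comp.
  apply/eq_in_map => i; rewrite mem_iota /= => lt_i; apply: start_up => //.
    rewrite mem_cell; move: lt_i lt1 eG; clear; case: (r \in _); lia.
  by rewrite -/r mem_cell; move: lt_i lt2; clear; lia.
have crr : crossing r = com (above_cut la r - above_cut mu r)%N by [].
pose a := start_content (cell c (above_cut mu c)).
have endsE i th : th \in Pi -> cell c i \in th ->
    (cell c i == end_box th) = (r \notin labels mu) && (i == above_cut mu c).
  move=> thP iT; rewrite (end_up phic thP iT).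
  have := strip_sub dec thP iT; rewrite -/D mem_cell; case: i {iT} => [|i].
    have -> : above (cell c 0) \notin D.
      by apply/negP => /diagramP[i [j [[]]]]; clear; lia.
    by move: eG; case: (r \in _); clear; lia.
  rewrite above_cell -/r mem_cell; move: eG eF.
  by case: (r \in labels mu); case: (r \in labels la); clear; lia.
have lt_a : (above_cut mu c < above_cut la c)%N -> a < r.
  move=> lt; have cD : cell c (above_cut mu c) \in D by rewrite mem_cell leqnn.
  by have := start_content_le cD; rewrite content_cell /a /r; clear; lia.
have [P_lt Q_lt] := ended_lt c.
have G_gt := take_labels_gt r dmu; have H_gt := take_labels_gt r dla.
have szG : size (take (above_cut mu r) (labels mu)) = above_cut mu r.
  by rewrite size_takel // size_labels above_cut_size.
have szH : size (take (above_cut la r) (labels la)) = above_cut la r.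
  by rewrite size_takel // size_labels above_cut_size.
have A_lt := crossing_lt c; have szPQ := size_ended c.
have lastE : r \notin labels la -> (above_cut mu r < above_cut la r)%N ->
    crossing r = rcons (com (above_cut la r - above_cut mu r).-1) r.
  move=> rQ lt; rewrite (negPf rQ) addn0 in eF.
  have {1}-> : crossing r = com ((above_cut la r - above_cut mu r).-1 + 1)%N.
    by rewrite crr; congr com; move: lt; clear; lia.
  rewrite /com iotaD map_cat /= cats1; congr rcons; apply: start_new_up => //.
    by rewrite mem_cell eF; move: lt; clear; lia.
  by rewrite -/r mem_cell; move: lt; clear; lia.
have headE : (above_cut mu c < above_cut la c)%N -> crossing c = a ::
    [seq start_content (cell c i)
       | i <- iota (above_cut mu c).+1 (above_cut la c - above_cut mu c).-1].
  by rewrite /crossing -subn_gt0; case: (_ - _)%N.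
rewrite /sweep (take_labels c dmu) (take_labels c dla) -/r.
case: (boolP (r \in labels mu)) eG n_gap endsE => rP eG n_gap endsE;
  case: (boolP (r \in labels la)) eF n_gap lastE => rQ eF n_gap lastE.
- have crc : crossing c = crossing r.
    rewrite crr comE; last 2 first.
    - by move: eF le_r; clear; lia.
    - by move: eF le_r; clear; lia.
    by rewrite /crossing eG eF !addn1 subSS.
  have pe : perm_eq (ended r) (ended c).
    by apply: ended_none => i th thP iT; rewrite endsE.
  have szA : (above_cut mu r + size (crossing r) = above_cut la r)%N.
    by rewrite size_map size_iota subnKC.
  rewrite (ldet_perm_cat _ _ pe); last by rewrite size_cat szG szH szA.
  rewrite -catA /= cats1 crc (turn_start_end phic) ?szG ?szH //.
  by rewrite -crc.
- have lt : (above_cut mu r < above_cut la r)%N by move: (n_gap isT) eG eF; clear; lia.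
  have crr' : crossing r = rcons (crossing c) r.
    rewrite lastE //; congr rcons; rewrite comE; last 2 first.
    - by move: eF lt; clear; lia.
    - by move: eF lt; clear; lia.
    rewrite /crossing eG eF addn1 addn0; congr (map _ (iota _ _)).
    by move: lt; clear; lia.
  have pe : perm_eq (ended r) (ended c).
    by apply: ended_none => i th thP iT; rewrite endsE.
  have szA : (above_cut la r = (above_cut mu r + size (crossing c)).+1)%N.
    by rewrite size_map size_iota eG eF; move: lt; clear; lia.
  rewrite (ldet_perm_cat _ _ pe); last first.
    by rewrite size_cat crr' size_rcons szG szH addnS.
  by rewrite crr' /= cats0 -catA -(turn_start phic) ?szG ?szH.
- have lt : (above_cut mu c < above_cut la c)%N by move: (n_gap isT).
  have crc : crossing c = a :: crossing r.
    rewrite headE // crr comE; last 2 first.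
    - by move: eF le_r; clear; lia.
    - by move: eF le_r; clear; lia.
    rewrite eG eF addn1 addn0; congr (_ :: map _ (iota _ _)).
    by move: le_r; clear; lia.
  have cD : cell c (above_cut mu c) \in D by rewrite mem_cell leqnn.
  have pe : perm_eq (ended r) ((a, r) :: ended c).
    by apply: ended_one => // i th thP iT; rewrite endsE.
  have szA : (above_cut la r = above_cut mu r + size (crossing r))%N.
    by rewrite size_map size_iota subnKC.
  rewrite (ldet_perm_cat _ _ pe); last by rewrite size_cat szG szH -szA.
  have A_lt' : all (fun x => x < r) (crossing r) by move: A_lt; rewrite crc => /andP[].
  by rewrite crc /= !cats0 cats1 (turn_end phic) ?szG ?szH ?lt_a.
have lt : (above_cut mu c < above_cut la c)%N by move: (n_gap isT).
have lt' : (above_cut mu r < above_cut la r)%N by move: lt eG eF; clear; lia.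
pose A1 := com (above_cut la r - above_cut mu r).-1.
have crr' : crossing r = rcons A1 r by rewrite lastE.
have crc : crossing c = a :: A1.
  rewrite headE // /A1 comE; last 2 first.
  - by move: eF lt'; clear; lia.
  - by move: eF lt'; clear; lia.
  by rewrite eG eF !addn0.
have cD : cell c (above_cut mu c) \in D by rewrite mem_cell leqnn.
have pe : perm_eq (ended r) ((a, r) :: ended c).
  by apply: ended_one => // i th thP iT; rewrite endsE.
have szA : (above_cut la r = (above_cut mu r + size A1).+1)%N.
  by rewrite size_map size_iota; move: lt'; clear; lia.
rewrite (ldet_perm_cat _ _ pe); last by rewrite size_cat szG szH crr' size_rcons szA addnS.
have A_lt' : all (fun x => x < r) A1 by move: A_lt; rewrite crc => /andP[].
by rewrite crc crr' /= !cats0 -(turn_end_start phic) ?szG ?szH ?lt_a.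
Qed.

(** The sweep starts before the first diagonal, at the content -k where k is the
    number of rows, and stops after the last one. *)
Theorem strips_determinant :
  ldet (segment phi (head 0%N la)%:Z)
    [seq p_content th | th <- enum_fset Pi]
    [seq q_content th + 1 | th <- enum_fset Pi] = jacobi_trudi la mu.
Proof.
have swE n : sweep (- k%:Z + n%:Z) = sweep (- k%:Z).
  elim: n => [|n <-]; first by rewrite addr0.
  have -> : - k%:Z + n.+1%:Z = - k%:Z + n%:Z + 1 by clear; lia.
  by case: (boolP (phi (- k%:Z + n%:Z))) => [/sweep_turn|/sweep_straight].
have q_bounds th : th \in Pi -> - k%:Z < q_content th < (head 0%N la)%:Z.
  move=> thP; have eD := strip_sub dec thP (end_box_in (decomposition_strip dec thP)).
  rewrite /q_content; case/diagramP: eD => i [j [-> /andP[_ lt_j]]].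
  have lt_i : (i < k)%N.
    by case: (ltnP i k) lt_j => // le_i; rewrite [X in (_ < X)%N]nth_default.
  have := sorted_geq_nth dla (leq0n i); rewrite nth0 (content_box_at i j).
  by move: lt_i lt_j; clear; lia.
have cut_top ka : sorted geq ka -> (head 0%N ka <= head 0%N la)%N ->
    above_cut ka (head 0%N la)%:Z = 0%N.
  move=> dka le_hd; apply/eqP; rewrite -leqn0 leqNgt above_cutE // negb_and.
  by rewrite nth0; apply/orP; right; move: le_hd; clear; lia.
have cut_bot ka : sorted geq ka -> size ka = k -> above_cut ka (- k%:Z) = k.
  move=> dka sz; apply/eqP; rewrite eqn_leq; apply/andP; split.
    by rewrite -[X in (_ <= X)%N]sz above_cut_size.
  case: (posnP k) => [-> //|gt0]; rewrite -[X in (X <= _)%N](prednK gt0).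
  by rewrite above_cutE // sz; apply/andP; split; move: gt0; clear; lia.
have -> : ldet (segment phi (head 0%N la)%:Z)
    [seq p_content th | th <- enum_fset Pi]
    [seq q_content th + 1 | th <- enum_fset Pi] = sweep (head 0%N la)%:Z.
  rewrite /sweep /crossing !cut_top //; last by rewrite -!nth0.
  rewrite !take0 !cats0 /ended.
  have -> : [seq th <- enum_fset Pi | q_content th < head 0%N la] = enum_fset Pi.
    by apply/all_filterP/allP => th /q_bounds/andP[].
  by rewrite /unzip1 /unzip2 -!map_comp.
have -> : (head 0%N la)%:Z = - k%:Z + (k + head 0%N la)%N%:Z by clear; lia.
rewrite swE /sweep /crossing !cut_bot // subnn cats0.
have -> : ended (- k%:Z) = [::].
  rewrite /ended (_ : [seq th <- _ | _] = [::]) //; apply/eqP.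
  rewrite -size_eq0 size_filter -leqn0 leqNgt -has_count.
  by apply/hasPn => th /q_bounds/andP[lt_q _]; rewrite -leNgt ltW.
rewrite /= !take_oversize ?size_labels ?sz_mu //.
rewrite ldet_tr ?size_labels ?sz_mu //; apply: eq_ldet => [|a f _ fL].
  by rewrite !size_labels sz_mu.
apply: segment_complete; case/mapP: fL => i; rewrite mem_iota sz_mu => lt_i ->.
by move: lt_i; clear; lia.
Qed.
End Sweep.

Theorem theorem4p1 (la mu : seq nat) (Pi : {fset {fset box}}) :
  skew_pair la mu ->
  outside_decomposition (diagram la mu) Pi ->
  hamel_goulden_determinant (diagram la mu) Pi = super_schur la mu.
Proof.
move=> sp dec.
by rewrite (hamel_goulden_ldet sp dec) (strips_determinant sp dec) super_jacobi_trudi.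
Qed.
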